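(* Let $p>1$. Let $\Omega$ be a domain in $\mathbb{R}^N$, $N\ge2$, and let $K$ be a closed piecewise smooth surface of codimension $k$, $k\in\{1,\ldots,N\}$, with finitely many connected components, where $K$ is a finite union of points if $k=N$ and $K=\partial\Omega$ if $k=1$. Let $d(x)=\mathrm{dist}(x,K)$ and suppose that $\sup_{x\in\Omega}d(x)<\infty$. Suppose also that $k>2p$ and that $$d\,\Delta d-k+1\ge0\quad\text{in }\Omega\setminus K$$ in the distributional sense. Let $Q=\frac{(p-1)k(k-2p)}{p^2}$. Then there exists a positive constant $D_0\ge\sup_{x\in\Omega}d(x)$ such that for any $D\ge D_0$ and all real-valued $u\in C_c^\infty(\Omega\setminus K)$ there holds $$\int_\Omega|\Delta u|^p\,dx\ge Q^p\int_\Omega\frac{|u|^p}{d^{2p}}\,dx+\frac{p-1}{2p^3}|Q|^{p-2}\bigl\{k^2(p-1)^2+(k-2p)^2\bigr\}\sum_{i=1}^\infty\int_\Omega\frac{|u|^p}{d^{2p}}X_1^2X_2^2\cdots X_i^2\,dx,$$ where $X_j=X_j(d(x)/D)$.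
   Context: The iterated logarithmic functions $X_i$ are defined recursively by $X_1(t)=(1-\log t)^{-1}$ for $t\in(0,1]$ and $X_i(t)=X_1(X_{i-1}(t))$ for $i=2,3,\ldots$, $t\in(0,1]$. All functions are real-valued. The distance $d$ is Lipschitz; the distribution $d\,\Delta d$ on $\Omega\setminus K$ acts on test functions by $\varphi\mapsto-\int\nabla d\cdot\nabla(d\varphi)\,dx$. *)

(* Defs.v *)
From HB Require Import structures.
From mathcomp Require Import all_boot all_order all_algebra.
From mathcomp Require Import all_classical all_reals all_analysis.
Set Implicit Arguments.
Unset Strict Implicit.
Unset Printing Implicit Defensive.
Import Order.TTheory GRing.Theory Num.Theory.
Import numFieldNormedType.Exports.
Local Open Scope classical_set_scope.
Local Open Scope ring_scope.

(* Row vectors carry the sigma-algebra generated by the coordinates, like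
   n.-tuple in the library; for T = R it is the Borel sigma-algebra of R^n. *)
Definition measure_rV_display : measure_display -> measure_display.
Proof. exact. Qed.

Section measurable_rV.
Context {d} {T : sigmaRingType d}.
Variable n : nat.

Let coors : 'I_n -> 'rV[T]_n -> T := fun i x => x ord0 i.

Let rV_set0 : g_sigma_preimage coors set0.
Proof. exact: sigma_algebra0. Qed.

Let rV_setC A : g_sigma_preimage coors A -> g_sigma_preimage coors (~` A).
Proof. exact: sigma_algebraC. Qed.

Let rV_bigcup (F : _^nat) : (forall i, g_sigma_preimage coors (F i)) ->
  g_sigma_preimage coors (\bigcup_i (F i)).
Proof. exact: sigma_algebra_bigcup. Qed.

HB.instance Definition _ := @isMeasurable.Build (measure_rV_display d)
  ('rV[T]_n) (g_sigma_preimage coors) rV_set0 rV_setC rV_bigcup.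

End measurable_rV.

Lemma measurable_coord d (T : sigmaRingType d) n (i : 'I_n) :
  measurable_fun [set: 'rV[T]_n] (fun x : 'rV[T]_n => x ord0 i).
Proof.
move=> _ Y mY; rewrite setTI; apply: sub_sigma_algebra => /=.
rewrite -bigcup_seq/=; exists i => /=; first by rewrite mem_index_enum.
by exists Y => //; rewrite setTI.
Qed.

Lemma measurable_fun_rV d1 d2 (T1 : measurableType d1) (T2 : measurableType d2)
    n (f : T1 -> 'rV[T2]_n) :
  (forall i, measurable_fun [set: T1] (fun x => f x ord0 i)) ->
  measurable_fun [set: T1] f.
Proof.
move=> mf _ /= Y; rewrite setTI => mY.
suff : [set A | measurable (f @^-1` A)] Y by [].
apply: mY; split=> [|A HA].
  split => [|A /= mA|F /= mF].
  - by rewrite /= preimage_set0.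
  - rewrite setTD preimage_setC; exact: measurableC.
  - by rewrite preimage_bigcup; exact: bigcupT_measurable.
move: HA; rewrite -bigcup_seq => -[i _ [B mB <-]].
by have := mf i measurableT B mB; rewrite !setTI.
Qed.

Section lebesgue_rV.
Context {R : realType}.

Definition rV_cons n (p : R * 'rV[R]_n) : 'rV[R]_n.+1 :=
  row_mx (p.1)%:M p.2 : 'rV[R]_(1 + n).

Lemma rV_cons0 n (p : R * 'rV[R]_n) : rV_cons p ord0 ord0 = p.1.
Proof.
have -> : (ord0 : 'I_n.+1) = lshift n (ord0 : 'I_1) :> 'I_(1 + n).
  exact/val_inj.
by apply: etrans (row_mxEl _ _ _ _) _; rewrite mxE eqxx mulr1n.
Qed.

Lemma rV_consS n (p : R * 'rV[R]_n) (i : 'I_n) :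
  rV_cons p ord0 (lift ord0 i) = p.2 ord0 i.
Proof.
have -> : lift ord0 i = rshift 1 i :> 'I_(1 + n) by exact/val_inj.
exact: (row_mxEr _ _ _ _).
Qed.

Lemma measurable_rV_cons n : measurable_fun setT (@rV_cons n).
Proof.
apply: measurable_fun_rV => i; have [j|] := unliftP ord0 i => ->.
  apply: (@eq_measurable_fun _ _ _ _ _
      ((fun x : 'rV[R]_n => x ord0 j) \o snd)).
    by move=> x _ /=; rewrite rV_consS.
  apply: measurableT_comp; first exact: measurable_coord.
  exact: measurable_snd.
apply: (@eq_measurable_fun _ _ _ _ _ fst); last exact: measurable_fst.
by move=> x _; rewrite rV_cons0.
Qed.

Section step.
Variables (n : nat) (mu : {sigma_finite_measure set 'rV[R]_n -> \bar R}).

(* The product of the one-dimensional Lebesgue measure and mu, transported to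
   R^(n+1) by adding a first coordinate. *)
Definition lebesgue_rV_step : set 'rV[R]_n.+1 -> \bar R :=
  pushforward (lebesgue_measure \x mu)%E (@rV_cons n).

Let step0 : lebesgue_rV_step set0 = 0%E.
Proof. by rewrite /lebesgue_rV_step /pushforward preimage_set0 measure0. Qed.

Let step_ge0 A : (0 <= lebesgue_rV_step A)%E.
Proof. by rewrite /lebesgue_rV_step /pushforward; exact: measure_ge0. Qed.

Let step_sigma_additive : semi_sigma_additive lebesgue_rV_step.
Proof.
move=> F mF tF mUF; rewrite /lebesgue_rV_step /pushforward preimage_bigcup.
apply: measure_semi_sigma_additive.
- by move=> i; rewrite -[X in measurable X]setTI; exact: measurable_rV_cons.
- apply/trivIsetP => /= i j _ _ ij; rewrite -preimage_setI.
  by move/trivIsetP : tF => /(_ _ _ _ _ ij) ->//; rewrite preimage_set0.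
- by rewrite -preimage_bigcup -[X in measurable X]setTI;
    exact: measurable_rV_cons.
Qed.

HB.instance Definition _ := isMeasure.Build _ _ _ lebesgue_rV_step
  step0 step_ge0 step_sigma_additive.

Let step_sigma_finite : sigma_finite setT lebesgue_rV_step.
Proof.
have /sigma_finiteP[F [TF ndF mF]] := sigma_finiteT (@lebesgue_measure R).
have /sigma_finiteP[G [TG ndG mG]] := sigma_finiteT mu.
pose tail (x : 'rV[R]_n.+1) : 'rV[R]_n := \row_i x ord0 (lift ord0 i).
have mtail : measurable_fun setT tail.
  apply: measurable_fun_rV => i.
  rewrite (_ : (fun _ => _) = fun x : 'rV[R]_n.+1 => x ord0 (lift ord0 i)).
    exact: measurable_coord.
  by apply/funext => x; rewrite mxE.
pose H i := [set x : 'rV[R]_n.+1 | F i (x ord0 ord0)] `&` tail @^-1` G i.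
exists H.
  apply/esym; rewrite -subTset => x _.
  have [a _ Fa] : (\bigcup_i F i) (x ord0 ord0) by rewrite -TF.
  have [b _ Gb] : (\bigcup_i G i) (tail x) by rewrite -TG.
  exists (maxn a b) => //; split.
    by have /subsetPset := ndF _ _ (leq_maxl a b); apply.
  by have /subsetPset := ndG _ _ (leq_maxr a b); apply.
move=> i; have [mFi Fioo] := mF i; have [mGi Gioo] := mG i; split.
  apply: measurableI.
    by rewrite -[X in measurable X]setTI; exact: measurable_coord.
  by rewrite -[X in measurable X]setTI; exact: mtail.
rewrite /lebesgue_rV_step /pushforward.
rewrite (_ : _ @^-1` _ = F i `*` G i).
  by rewrite product_measure1E// lte_mul_pinfty// ge0_fin_numE.
apply/seteqP; split => -[a b]; rewrite /H /preimage/= rV_cons0;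
  rewrite (_ : tail _ = b)//; apply/rowP => j; rewrite mxE;
  exact: (rV_consS (a, b)).
Qed.

HB.instance Definition _ := @Measure_isSigmaFinite.Build _ _ _
  lebesgue_rV_step step_sigma_finite.

End step.

Fixpoint lebesgue_rV n : {sigma_finite_measure set 'rV[R]_n -> \bar R} :=
  if n is m.+1 then lebesgue_rV_step (lebesgue_rV m) else \d_(0 : 'rV[R]_0).

Lemma lebesgue_rV_box n (A : 'I_n -> set R) :
  (forall i, measurable (A i)) ->
  lebesgue_rV n [set x | forall i, A i (x ord0 i)] =
  (\prod_(i < n) lebesgue_measure (A i))%E.
Proof.
elim: n A => [|n IHn] A mA /=.
  by rewrite big_ord0 /dirac/= indicE mem_set// => -[].
rewrite big_ord_recl -IHn => [|i]; last exact: mA.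
have mB : measurable
    [set b : 'rV[R]_n | forall i, A (lift ord0 i) (b ord0 i)].
  rewrite [X in measurable X](_ : _ =
      \bigcap_(i in setT) [set x : 'rV[R]_n | A (lift ord0 i) (x ord0 i)]).
    apply: fin_bigcap_measurable => // i _.
    by rewrite -[X in measurable X]setTI; exact: measurable_coord.
  by apply/seteqP; split => x /= h i; [move=> _; exact: h|exact: h].
rewrite /lebesgue_rV_step /pushforward -product_measure1E//; last exact: mA.
congr (product_measure1 _ _ _); apply/seteqP; split => -[a b] /=.
  move=> h; split=> [|i]; first by have := h ord0; rewrite rV_cons0.
  by have := h (lift ord0 i); rewrite (rV_consS (a, b)).
case=> ha hb i; have [j|] := unliftP ord0 i => ->.
  by rewrite (rV_consS (a, b)); exact: hb.
by rewrite rV_cons0.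
Qed.

End lebesgue_rV.
Arguments lebesgue_rV {R} n.

Section euclidean.
Context {R : realType} {n : nat}.
Implicit Types (f g u : 'rV[R]_n -> R) (x : 'rV[R]_n) (U K : set 'rV[R]_n).

(* The norm `|x| of the library on row vectors is the sup norm. *)
Definition enorm x : R := Num.sqrt (\sum_i x ord0 i ^+ 2).

Definition eudist K x : R := inf [set enorm (x - y) | y in K].

Definition domain U := [/\ U !=set0, open U & connected U].

Definition boundary U := closure U `\` interior U.

Definition pderive (i : 'I_n) f : 'rV[R]_n -> R := 'D_(delta_mx ord0 i) f.

Definition pderives (s : seq 'I_n) f : 'rV[R]_n -> R := foldr pderive f s.

Definition smooth f := forall s, continuous (pderives s f) /\
  forall i x, derivable (pderives s f) x (delta_mx ord0 i).

Definition laplacian f x : R := \sum_i pderive i (pderive i f) x.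

Definition grad_dot f g x : R := \sum_i pderive i f x * pderive i g x.

(* C_c^oo(U), its elements being extended by 0 to R^n *)
Definition test_function U u :=
  [/\ smooth u, compact (closure [set x | u x != 0]) &
      closure [set x | u x != 0] `<=` U].

(* The distribution d Laplacian(d) on U. For Lipschitz d, the partial
   derivatives of d exist almost everywhere and are the weak ones; the junk
   value of pderive on the exceptional null set is harmless. *)
Definition mul_laplacian_distr U d (phi : 'rV[R]_n -> R) : R :=
  - \int[lebesgue_rV n]_(x in U) grad_dot d (fun y => d y * phi y) x.

(* d Laplacian(d) - c >= 0 in U in the sense of distributions *)
Definition mul_laplacian_ge U d (c : R) :=
  forall phi, test_function U phi -> (forall x, 0 <= phi x) ->
  0 <= mul_laplacian_distr U d phi - c * \int[lebesgue_rV n]_(x in U) phi x.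

End euclidean.

Section surface.
Context {R : realType}.

Definition cube (m : nat) : set 'rV[R]_m :=
  [set x | forall i, 0 <= x ord0 i <= 1].

Definition open_cube (m : nat) : set 'rV[R]_m :=
  [set x | forall i, 0 < x ord0 i < 1].

Arguments cube : clear implicits.
Arguments open_cube : clear implicits.

(* A piecewise smooth surface of dimension m: a nonempty locally finite union
   of smooth images of the closed m-cube, each parametrization being regular
   and one-to-one in the interior of the cube, and distinct pieces meeting only
   along their boundaries. Requiring phi j to be smooth on the whole of R^m
   rather than near the (compact) cube is no restriction: multiply by a cutoff. *)
Definition piecewise_smooth_surface m n (K : set 'rV[R]_n) :=
  K !=set0 /\
  exists (J : set nat) (phi : nat -> 'rV[R]_m -> 'rV[R]_n),
  [/\ K = \bigcup_(j in J) (phi j @` cube m),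
      forall x : 'rV[R]_n, exists2 V, nbhs x V &
        finite_set [set j | J j /\ (phi j @` cube m) `&` V !=set0],
      forall j l, J j -> smooth (fun x => phi j x ord0 l),
      forall j x, J j -> open_cube m x -> injective ('d (phi j) x) &
      forall i j x y, J i -> J j -> open_cube m x -> cube m y ->
        phi i x = phi j y -> i = j /\ x = y].

End surface.

Definition X1 {R : realType} (t : R) : R := (1 - ln t)^-1.

Definition Xlog {R : realType} (i : nat) (t : R) : R := iter i X1 t.

(* Main.v *)
From HB Require Import structures.
Require Import Defs.
From mathcomp Require Import all_boot all_order all_algebra.
From mathcomp Require Import all_classical all_reals all_analysis.
From mathcomp Require Import ring lra measurable_realfun.
Import Order.TTheory GRing.Theory Num.Theory.
Import numFieldNormedType.Exports.
Local Open Scope classical_set_scope.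
Local Open Scope ring_scope.

(** Why the inequality holds.

    Write A = d^2 / 2 and p' = p / (p - 1).  Let a be a smooth function with
    |grad a|^2 <= 2 a and Lap a >= k near the support of u, and let f > 0,
    h >= 0 >= h' and g be functions of one variable with
    f' = - h - 2 (p - 1) g.  Add to |Lap u|^p the divergence of the field
      p f(a) |u|^(p-2) u grad u + h(a) |u|^p grad a,
    whose integral is 0.  Young's inequality absorbs the term with Lap u,
    completing a square absorbs the terms with grad u, and the two conditions
    on a bound the rest: pointwise, the sum is at least W(a) |u|^p as soon as
      W(s) <= 2 s h' + k h - (p - 1) f^p' - 2 p (p - 1) s g^2 / f
    ([pointwise_ineq]).  Hence the integral of W(a) |u|^p is at most that of
    |Lap u|^p ([integrated_ineq]).  For p < 2 the power |u|^p is not smooth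
    enough, so it is first replaced by (u^2 + e^2)^(p/2).

    The choice of f, g, h is a problem in one variable ([admissible_exists]).
    With f = (2s)^(1-p) F, g = (2s)^(-p) G and h = (2s)^(-p) H, suitable
    constants F, G and H give W = Q^p (2s)^(-p), that is Q^p d^(-2p) at s = A.
    The logarithmic terms come from perturbing these constants by multiples of
    Xsum = X_1 + X_1 X_2 + X_1 X_2 X_3 + ... and of its square, at
    t = sqrt (2s) / D.  The operator t d/dt maps Xsum to
    (Xsum^2 + Xsum2) / 2, where Xsum2 is the sum of the squares
    X_1^2 ... X_i^2.  A suitable perturbation cancels the terms in Xsum and
    Xsum^2, leaves the wanted multiple of Xsum2, and has a cubic part that
    dominates the remaining errors for small t ([scalar_core]).  All constants
    are independent of the number of terms, because Xsum t * - ln t is bounded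
    uniformly ([Xsum_log_bound]).

    The function A itself satisfies the two conditions on a only weakly, but
    both survive mollification.  Along each coordinate line
    A(x + t e) - t^2 / 2 is an infimum of affine functions of t, hence concave;
    its one-sided derivatives enclose (x - y)_i for y nearest to x, and both are
    weak derivatives of A ([hsdq_weak]), so they agree almost everywhere
    ([Dp_eq_Dm_ae]) and |grad A|^2 = 2 A there.  The hypothesis on d Lap d then
    says that Lap A >= k weakly ([weak_laplacian_ge]).  Mollifying A gives
    smooth functions with |grad|^2 <= 2 A_r, by Jensen's inequality
    ([hsd_moll_grad]), and Lap A_r >= k ([hsd_moll_laplacian]).  Letting the
    radius r tend to 0 gives the inequality with finitely many logarithmic terms
    ([finite_sum_ineq]), and then the series is the limit of its partial sums. *)

Set Implicit Arguments.
Unset Strict Implicit.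
Unset Printing Implicit Defensive.

(** * Lebesgue measure on row vectors *)

Section measure_tools.
Context {R : realType}.

Lemma row_norm_ltP n (x : 'rV[R]_n) (r : R) : 0 < r ->
  (`|x| < r) <-> (forall i, `|x ord0 i| < r).
Proof.
move=> r0; rewrite /Num.norm /= mx_normrE; split.
  move=> h i; apply: le_lt_trans h.
  exact: (le_bigmax _ (fun k : 'I_1 * 'I_n => `|x k.1 k.2|) (ord0, i)).
move=> h; apply: bigmax_lt => [|[i j] _ /=]; first by [].
by rewrite (ord1 i); exact: h.
Qed.

Lemma row_coord_le n (x : 'rV[R]_n) i : `|x ord0 i| <= `|x|.
Proof.
rewrite {2}/Num.norm /= mx_normrE.
exact: (le_bigmax _ (fun k : 'I_1 * 'I_n => `|x k.1 k.2|) (ord0, i)).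
Qed.

Lemma measurable_row_ball n (c : 'rV[R]_n) (r : R) : measurable (ball c r).
Proof.
have [r0|r0] := leP r 0.
  rewrite (_ : ball c r = set0) //; apply/seteqP; split => // x.
  by rewrite -ball_normE /ball_/= => h; have := le_lt_trans (normr_ge0 _) (lt_le_trans h r0); rewrite ltxx.
rewrite (_ : ball c r = \bigcap_(i in setT) [set x : 'rV[R]_n | ball (c ord0 i) r (x ord0 i)]).
  apply: fin_bigcap_measurable => // i _.
  have mb : measurable (ball (c ord0 i) r) by apply: open_measurable; exact: ball_open.
  by have := measurable_coord i measurableT mb; rewrite setTI.
apply/seteqP; split=> x.
  rewrite -ball_normE /ball_/= => /(row_norm_ltP _ r0) h i _.
  by rewrite /= -ball_normE /ball_/=; have := h i; rewrite !mxE.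
move=> h; rewrite -ball_normE /ball_/=; apply/(row_norm_ltP _ r0) => i.
by have := h i I; rewrite /= -ball_normE /ball_/= !mxE.
Qed.

(** A ball of the sup norm is a box, hence measurable, and U is the union of
    the countably many such balls inside U with rational centre and radius. *)
Lemma open_measurable_row n (U : set 'rV[R]_n) : open U -> measurable U.
Proof.
move=> oU.
pose I := 'rV[rat]_n * rat : Type.
pose c (q : 'rV[rat]_n) : 'rV[R]_n := map_mx ratr q.
pose B (q : 'rV[rat]_n * rat) : set 'rV[R]_n :=
  if pselect (ball (c q.1) (ratr q.2) `<=` U) then ball (c q.1) (ratr q.2) else set0.
have -> : U = \bigcup_q B q.
  apply/seteqP; split=> [x Ux|x [q _]]; last first.
    by rewrite /B; case: pselect => // h /h.
  have [e /= e0 xeU] : nbhs_ball x U by apply/nbhs_ballP; exact: oU.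
  have [r /andP[r0 re]] : exists r : rat, 0 < (ratr r : R) < e / 2.
    have [r rin] := @rat_in_itvoo R 0 (e / 2) ltac:(lra).
    by exists r; move: rin; rewrite in_itv.
  have /choice[q qP] : forall i : 'I_n, exists q : rat, `|x ord0 i - ratr q| < ratr r.
    move=> i.
    have [q] := @rat_in_itvoo R (x ord0 i - ratr r) (x ord0 i + ratr r) ltac:(lra).
    rewrite in_itv/= => /andP[a b]; exists q; rewrite ltr_norml.
    by apply/andP; split; lra.
  exists (\row_i q i, r) => //; rewrite /B; case: pselect => /=.
    move=> _; rewrite -ball_normE /ball_/=; apply/row_norm_ltP => // i.
    by rewrite !mxE distrC qP.
  case=> y yc; apply: xeU; rewrite -ball_normE /ball_/=.
  apply/row_norm_ltP => // i; move: yc; rewrite -ball_normE /ball_/=.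
  move/(row_norm_ltP _ r0)/(_ i); rewrite !mxE => yc.
  rewrite (splitr e); apply: le_lt_trans (ltrD (lt_trans (qP i) re) (lt_trans yc re)).
  by rewrite -{1}(subrK (ratr (q i)) (x ord0 i)) -addrA; exact: ler_normD.
apply: countable_bigcupT_measurable => [|q]; first exact: countableP.
rewrite /B; case: pselect => qU /=; last by [].
exact: measurable_row_ball.
Qed.

Lemma closed_measurable_row n (U : set 'rV[R]_n) : closed U -> measurable U.
Proof.
move=> cU; rewrite -(setCK U); apply: measurableC; apply: open_measurable_row.
exact: closed_openC.
Qed.

Lemma open_continuous_measurable_row n (D : set 'rV[R]_n) (f : 'rV[R]_n -> R) :
  open D -> (forall x, D x -> {for x, continuous f}) -> measurable_fun D f.
Proof.
move=> oD cf; apply: (measurability _ (RGenOpens.measurableE R)).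
move=> _ [_ [a [b ->] <-]]; apply: open_measurable_row.
rewrite openE => x [Dx fx]; apply: filterI; first exact: oD.
apply: (cf _ Dx); apply: open_nbhs_nbhs; split => //; exact: interval_open.
Qed.

Lemma continuous_measurable_row n (f : 'rV[R]_n -> R) :
  continuous f -> measurable_fun setT f.
Proof.
by move=> cf; apply: open_continuous_measurable_row => [|x _]; [exact: openT|exact: cf].
Qed.

(** The translate is again a measure, so it is enough to compare half-open
    intervals. *)
Lemma lebesgue_measure_shift (a : R) (A : set R) : measurable A ->
  lebesgue_measure [set x | A (x + a)] = lebesgue_measure A.
Proof.
move=> mA.
have mphi : measurable_fun [set: measurableTypeR R] (fun x : measurableTypeR R => x + a : measurableTypeR R).
  by apply: measurable_funD => //; exact: measurable_cst.
pose phi : {mfun measurableTypeR R >-> measurableTypeR R} := HB.pack (fun x : measurableTypeR R => x + a : measurableTypeR R) (isMeasurableFun.Build _ _ _ _ _ mphi).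
have E B : measurable B ->
    lebesgue_measure B = pushforward (@lebesgue_measure R) phi B; last first.
  by rewrite [RHS]E.
move: B; apply: lebesgue_measure_unique.
move=> _ [[b c] _ <-]; rewrite /pushforward /= lebesgue_measure_itv/=.
transitivity (lebesgue_measure `]b - a, c - a]%classic); last first.
  congr lebesgue_measure; apply/seteqP; split=> x /=;
  by rewrite !in_itv/= => /andP[? ?]; apply/andP; split; lra.
rewrite lebesgue_measure_itv/= !lte_fin ltrD2r.
by case: ifP => // _; rewrite -!EFinD; congr EFin; ring.
Qed.

Lemma measurable_shift_row n (v : 'rV[R]_n) :
  measurable_fun setT (fun x : 'rV[R]_n => x + v).
Proof.
apply: measurable_fun_rV => i.
rewrite (_ : (fun _ => _) = (fun x : 'rV[R]_n => x ord0 i + v ord0 i)); last first.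
  by apply/funext => x; rewrite !mxE.
apply: measurable_funD => //; exact: measurable_coord.
Qed.

Lemma rV_consD n (a : R) (b : 'rV[R]_n) (v : 'rV[R]_n.+1) :
  rV_cons (a, b) + v = rV_cons (a + v ord0 ord0, b + \row_i v ord0 (lift ord0 i)).
Proof.
apply/rowP => i; rewrite [LHS]mxE; have [j|] := unliftP ord0 i => ->.
  by rewrite !rV_consS /= !mxE.
by rewrite !rV_cons0.
Qed.

(** By induction on the dimension: a translation acts on each factor of the
    product measure, which is determined by its values on rectangles. *)
Lemma lebesgue_rV_shift n (v : 'rV[R]_n) (A : set 'rV[R]_n) : measurable A ->
  lebesgue_rV n [set x | A (x + v)] = lebesgue_rV n A.
Proof.
elim: n v A => [|n IHn] v A mA.
  by congr (lebesgue_rV 0 _); apply/seteqP; split=> x /=;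
    rewrite (_ : x + v = x) //; apply/rowP; case.
pose v' : 'rV[R]_n := \row_i v ord0 (lift ord0 i).
pose T := (measurableTypeR R * 'rV[R]_n)%type.
pose tau (q : T) : T := (q.1 + v ord0 ord0, q.2 + v').
have mtau : measurable_fun setT tau.
  apply/measurable_fun_pairP; split.
    apply: measurable_funD => //; exact: measurable_fst.
  exact: (measurableT_comp (measurable_shift_row v') measurable_snd).
pose phi : {mfun T >-> T} := HB.pack tau (isMeasurableFun.Build _ _ _ _ _ mtau).
have E X : measurable X ->
    ((@lebesgue_measure R) \x (lebesgue_rV n))%E X =
    pushforward ((@lebesgue_measure R) \x (lebesgue_rV n))%E phi X.
  move: X; apply: product_measure_unique => B C mB mC.
  rewrite /pushforward /=.
  transitivity (((@lebesgue_measure R) \x (lebesgue_rV n))%E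
    ([set x : measurableTypeR R | B (x + v ord0 ord0)] `*` [set x | C (x + v')])); first by [].
  rewrite product_measure1E//=; first last.
  - by have := measurable_shift_row v' measurableT mC; rewrite setTI.
  - have m1 : measurable_fun setT (fun x : measurableTypeR R => x + v ord0 ord0 : measurableTypeR R).
      by apply: measurable_funD => //; exact: measurable_cst.
    by have := m1 measurableT B mB; rewrite setTI.
  by rewrite lebesgue_measure_shift// IHn.
rewrite /= /lebesgue_rV_step [RHS]/pushforward E.
  rewrite /pushforward /=; congr (product_measure1 _ _ _).
  by apply/seteqP; split=> -[a b] /=; rewrite rV_consD.
by have := measurable_rV_cons measurableT mA; rewrite setTI.
Qed.

Notation mu n := (@lebesgue_rV R n).

Lemma ge0_integral_shift n (v : 'rV[R]_n) (f : 'rV[R]_n -> \bar R) :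
  measurable_fun setT f -> (forall x, 0 <= f x)%E ->
  (\int[mu n]_x f (x + v)%R = \int[mu n]_x f x)%E.
Proof.
move=> mf f0.
pose phi : {mfun 'rV[R]_n >-> 'rV[R]_n} := HB.pack (fun x : 'rV[R]_n => x + v)
  (isMeasurableFun.Build _ _ _ _ _ (measurable_shift_row v)).
have mphi : measurable_fun setT phi by exact: measurable_shift_row.
have := @ge0_integral_pushforward _ _ _ _ _ phi mphi (mu n) setT f measurableT mf (fun y _ => f0 y).
rewrite preimage_setT /= => <-.
apply: eq_measure_integral => A mA _ /=.
by rewrite /pushforward /=; apply: lebesgue_rV_shift.
Qed.

End measure_tools.

(** * Integration of bounded functions with bounded support *)

Section tame.
Context {R : realType} {n : nat}.
Notation mu := (@lebesgue_rV R n).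
Implicit Types f g : 'rV[R]_n -> R.

(** The bounds are explicit because dominated convergence asks for bounds that
    are uniform along a sequence. *)
Definition dom_by (C M : R) f := forall x, `|f x| <= C /\ (M < `|x| -> f x = 0).

(** Every integrand below is of this kind. The class is stable under the
    operations in use and contains integrable functions only, so that it
    settles all questions of integrability. *)
Definition tame f := measurable_fun setT f /\ exists C M, dom_by C M f.

Definition integ f : R := \int[mu]_x f x.

Lemma closed_row_ball (M : R) : closed [set x : 'rV[R]_n | `|x| <= M].
Proof.
apply: (@preimage_closed _ _ (fun x : 'rV[R]_n => `|x|) [set t | t <= M]).
  by move=> x _; exact: norm_continuous.
exact: closed_le.
Qed.

Lemma lebesgue_rV_ball_fin (M : R) : (mu [set x | (`|x| <= M)%R] < +oo)%E.
Proof.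
set B := [set x : 'rV[R]_n | `|x| <= M].
pose A := [set x : 'rV[R]_n | forall i, `[-M, M]%classic (x ord0 i)].
apply: (@le_lt_trans _ _ (mu A)).
  apply: le_measure; rewrite ?inE.
  - apply: closed_measurable_row.
    exact: closed_row_ball.
  - have -> : A =
        \bigcap_(i in setT) [set x : 'rV[R]_n | `[-M,M]%classic (x ord0 i)].
      by apply/seteqP; split=> x h i => [_|]; apply: h.
    apply: fin_bigcap_measurable => // i _.
    have mb : measurable `[-M, M]%classic by [].
    by have := measurable_coord i measurableT mb; rewrite setTI.
  - move=> x /= xM i; rewrite /= in_itv /= -ler_norml.
    exact: le_trans (row_coord_le _ _) xM.
have mI : measurable `[-M, M]%classic by [].
have -> : mu A = _ := @lebesgue_rV_box R n (fun=> `[-M, M]%classic) (fun=> mI).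
set P := (\prod_(i < n) _)%E; suff: (0 <= P)%E /\ (P < +oo)%E by case.
rewrite /P; elim/big_ind : _.
- by rewrite lee01 ltry.
- move=> x y [x0 xy] [y0 yy]; split; first exact: mule_ge0.
  by rewrite lte_mul_pinfty// ge0_fin_numE.
- move=> i _; split => //; rewrite lebesgue_measure_itv/=.
  by case: ifP => // _; rewrite -EFinB ltry.
Qed.

Lemma tame_integrable f : tame f -> mu.-integrable setT (EFin \o f).
Proof.
move=> [mf [C [M h]]].
pose B := [set x : 'rV[R]_n | `|x| <= M].
have mB : measurable B.
  by apply: closed_measurable_row; exact: closed_row_ball.
have iB : mu.-integrable B (EFin \o f).
  apply: measurable_bounded_integrable => //.
  - exact: lebesgue_rV_ball_fin.
  - exact: measurable_funTS.
  - exists C; split; first exact: num_real.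
    by move=> y Cy x _; exact: le_trans (h x).1 (ltW Cy).
rewrite (_ : EFin \o f = (EFin \o f) \_ B); first by rewrite -integrable_mkcond.
apply/funext => x; rewrite /restrict; case: ifPn => // /negP xB.
rewrite /= (h x).2 // ltNge; apply/negP => xM; apply: xB; exact/mem_set.
Qed.

Lemma tame0 : tame (fun=> 0).
Proof.
by split; [exact: measurable_cst|exists 0, 0 => x; split=> //; rewrite normr0].
Qed.

Lemma tameD f g : tame f -> tame g -> tame (fun x => f x + g x).
Proof.
move=> [mf [C [M h]]] [mg [C' [M' h']]]; split; first exact: measurable_funD.
exists (C + C'), (Num.max M M') => x; split.
  by apply: (le_trans (ler_normD _ _)); apply: lerD; [exact: (h x).1|exact: (h' x).1].
by rewrite gt_max => /andP[a b]; rewrite (h x).2// (h' x).2// addr0.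
Qed.

Lemma tameZ (k : R) f : tame f -> tame (fun x => k * f x).
Proof.
move=> [mf [C [M h]]]; split; first by apply: measurable_funM => //; exact: measurable_cst.
exists (`|k| * C), M => x; split; first by rewrite normrM ler_wpM2l// (h x).1.
by move=> /(h x).2 ->; rewrite mulr0.
Qed.

Lemma tameN f : tame f -> tame (fun x => - f x).
Proof. by move=> /(tameZ (-1)); under eq_fun do rewrite mulN1r. Qed.

Lemma tameB f g : tame f -> tame g -> tame (fun x => f x - g x).
Proof. by move=> hf hg; apply: tameD => //; exact: tameN. Qed.

Lemma tame_sum (I : Type) (s : seq I) (F : I -> 'rV[R]_n -> R) :
  (forall i, tame (F i)) -> tame (fun x => \sum_(i <- s) F i x).
Proof.
move=> h; elim: s => [|i s IH].
  by under eq_fun do rewrite big_nil; exact: tame0.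
by under eq_fun do rewrite big_cons; exact: tameD.
Qed.

Definition loc_bounded f := forall M : R, exists C : R, forall x, `|x| <= M -> `|f x| <= C.

Lemma tameM f g : measurable_fun setT f -> loc_bounded f -> tame g -> tame (fun x => f x * g x).
Proof.
move=> mf bf [mg [C [M h]]]; split; first exact: measurable_funM.
have [C' h'] := bf M; exists (`|C'| * C), M => x; split; last first.
  by move=> /(h x).2 ->; rewrite mulr0.
have C0 : 0 <= C by apply: le_trans (normr_ge0 _) (h x).1.
have [xM|xM] := leP `|x| M; last first.
  by rewrite (h x).2// mulr0 normr0 mulr_ge0.
rewrite normrM ler_pM// ?(h x).1//.
by apply: le_trans (h' _ xM) (ler_norm _).
Qed.

Lemma tame_shift f v : tame f -> tame (fun x => f (x + v)).
Proof.
move=> [mf [C [M h]]]; split.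
  exact: (measurableT_comp mf (measurable_shift_row v)).
exists C, (M + `|v|) => x; split; first exact: (h _).1.
move=> Mx; apply: (h _).2; rewrite -(ltrD2r `|v|); apply: lt_le_trans Mx _.
by rewrite -{1}(addrK v x); apply: ler_normB.
Qed.

Lemma compact_row_ball M : compact [set x : 'rV[R]_n | `|x| <= M].
Proof.
apply: bounded_closed_compact.
  by exists M; split; [exact: num_real|move=> y My x /= xM; exact: le_trans (ltW My)].
exact: closed_row_ball.
Qed.

Lemma continuous_loc_bounded f : continuous f -> loc_bounded f.
Proof.
move=> cf M; have [M0|M0] := leP 0 M; last first.
  by exists 0 => x xM; have := le_lt_trans xM M0; rewrite normr_lt0.
have B0 : [set x : 'rV[R]_n | `|x| <= M] !=set0 by exists 0; rewrite /= normr0.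
have [|c _ h] := @EVT_max_rV R n (fun x => `|f x|) _ B0 (@compact_row_ball M).
  apply: continuous_subspaceT => x; apply: (continuous_comp (cf x)); exact: norm_continuous.
by exists `|f c| => x xM; apply: h; rewrite inE.
Qed.

Lemma continuous_tame f M : continuous f -> (forall x, M < `|x| -> f x = 0) -> tame f.
Proof.
move=> cf h; split; first exact: continuous_measurable_row.
have [C hC] := continuous_loc_bounded cf M.
exists `|C|, M => x; split; last exact: h.
have [xM|xM] := leP `|x| M; first exact: le_trans (hC _ xM) (ler_norm _).
by rewrite h// normr0.
Qed.

Lemma integD f g : tame f -> tame g -> integ (fun x => f x + g x) = integ f + integ g.
Proof. by move=> hf hg; rewrite /integ RintegralD//; exact: tame_integrable. Qed.

Lemma integB f g : tame f -> tame g -> integ (fun x => f x - g x) = integ f - integ g.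
Proof. by move=> hf hg; rewrite /integ RintegralB//; exact: tame_integrable. Qed.

Lemma integZ (k : R) f : tame f -> integ (fun x => k * f x) = k * integ f.
Proof. by move=> hf; rewrite /integ RintegralZl//; exact: tame_integrable. Qed.

Lemma integN f : tame f -> integ (fun x => - f x) = - integ f.
Proof.
by move=> hf; rewrite -mulN1r -integZ//; congr integ; apply/funext => x; rewrite mulN1r.
Qed.

Lemma integ_zero : integ (fun=> 0) = 0.
Proof. by rewrite /integ /Rintegral integral0. Qed.

Lemma integ_sum (I : Type) (s : seq I) (F : I -> 'rV[R]_n -> R) :
  (forall i, tame (F i)) -> integ (fun x => \sum_(i <- s) F i x) = \sum_(i <- s) integ (F i).
Proof.
move=> h; elim: s => [|i s IH].
  by under eq_fun do rewrite big_nil; rewrite integ_zero big_nil.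
under eq_fun do rewrite big_cons; rewrite big_cons -IH integD//.
exact: tame_sum.
Qed.

Lemma integ_ge0 f : (forall x, 0 <= f x) -> 0 <= integ f.
Proof. by move=> h; apply: Rintegral_ge0. Qed.

Lemma integ_le f g : tame f -> tame g -> (forall x, f x <= g x) -> integ f <= integ g.
Proof.
by move=> hf hg h; apply: le_Rintegral => //; [exact: tame_integrable|exact: tame_integrable].
Qed.

Lemma integ_EFin f : tame f -> (\int[mu]_x (f x)%:E)%E = (integ f)%:E.
Proof.
move=> /tame_integrable h; rewrite /integ /Rintegral fineK//.
exact: (integrable_fin_num measurableT h).
Qed.

Lemma tame_pos f : tame f -> tame (fun x => Num.max (f x) 0).
Proof.
move=> [mf [C [M h]]]; split.
  by apply: measurable_maxr => //; exact: measurable_cst.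
exists C, M => x; have [a b] := h x; split; last by move=> /b ->; rewrite maxxx.
apply: le_trans a; rewrite /Num.max; case: ifP => // _; by rewrite normr0.
Qed.

(** The change of variables is available for nonnegative functions; apply it
    to the positive and the negative part. *)
Lemma integ_shift v f : tame f -> integ (fun x => f (x + v)) = integ f.
Proof.
move=> tf.
have key g : tame g -> (forall x, 0 <= g x) -> integ (fun x => g (x + v)) = integ g.
  move=> tg g0; rewrite /integ /Rintegral; congr fine.
  apply: (@ge0_integral_shift R n v (EFin \o g)) => [|x]; last by rewrite lee_fin /=.
  by apply/measurable_EFinP; exact: tg.1.
have fE x : f x = Num.max (f x) 0 - Num.max (- f x) 0.
  have [a|a] := leP 0 (f x).
    by rewrite max_r ?oppr_le0// subr0.
  by rewrite max_l ?oppr_ge0 ?ltW// sub0r opprK.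
have t1 := tame_pos tf; have t2 := tame_pos (tameN tf).
have fE' : f = fun x => Num.max (f x) 0 - Num.max (- f x) 0 by exact/funext.
move: t1 t2 fE'; set f1 := (fun x => Num.max (f x) 0); set f2 := (fun x => Num.max (- f x) 0).
move=> t1 t2 ->; rewrite (integB t1 t2) -(key f1)// -?(key f2)//.
- exact: (integB (tame_shift v t1) (tame_shift v t2)).
- by move=> x; rewrite /f2 le_max lexx orbT.
- by move=> x; rewrite /f1 le_max lexx orbT.
Qed.

Lemma integ_ae f g : measurable_fun setT f -> measurable_fun setT g ->
  (\forall x \ae mu, f x = g x) -> integ f = integ g.
Proof.
move=> mf mg h; rewrite /integ /Rintegral; congr fine; apply: ae_eq_integral => //.
- exact/measurable_EFinP.
- exact/measurable_EFinP.
- by apply: filterS h => x fg _; rewrite fg.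
Qed.

Lemma integ_eq0_ae f : tame f -> (forall x, 0 <= f x) -> integ f = 0 ->
  \forall x \ae mu, f x = 0.
Proof.
move=> tf f0 If.
have /(ae_eq_integral_abs mu measurableT)[+ _] : measurable_fun setT (EFin \o f).
  by apply/measurable_EFinP; exact: tf.1.
have -> : (\int[mu]_x `|(EFin \o f) x|)%E = 0%E.
  under eq_integral => x _ do rewrite /= ger0_norm//.
  by rewrite integ_EFin// If.
by move=> /(_ erefl); apply: filterS => x /(_ I) [].
Qed.

(** Dominated by C times the indicator of the ball of radius M; the limit
    inherits these bounds and is therefore tame. *)
Lemma integ_cvg (F : nat -> 'rV[R]_n -> R) f C M :
  (forall k, measurable_fun setT (F k)) -> (forall k, dom_by C M (F k)) ->
  (forall x, F k x @[k --> \oo] --> f x) ->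
  tame f /\ integ (F k) @[k --> \oo] --> integ f.
Proof.
move=> mF dF cF.
have df : dom_by C M f.
  move=> x; split.
    have cn : `|F k x| @[k --> \oo] --> `|f x| by apply: cvg_norm; exact: cF.
    rewrite -(cvg_lim _ cn)//; apply: limr_le; first by apply/cvg_ex; exists `|f x|.
    by apply: nearW => k; exact: (dF k x).1.
  move=> Mx; rewrite -(cvg_lim _ (cF x))//.
  rewrite (_ : (fun k => F k x) = cst 0); first exact: lim_cst.
  by apply/funext => k; exact: (dF k x).2.
have mf : measurable_fun setT f by apply: (measurable_fun_cvg (h := F)) => // x _; exact: cF.
have tf : tame f by split => //; exists C, M.
split => //.
pose g := fun x : 'rV[R]_n => C * \1_([set x | `|x| <= M]) x : R.
have mB : measurable [set x : 'rV[R]_n | `|x| <= M].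
  by apply: closed_measurable_row; exact: closed_row_ball.
have tg : tame g.
  split; first by apply: measurable_funM; [exact: measurable_cst|exact: measurable_indic].
  exists `|C|, M => x; rewrite /g indicE; split.
    by case: (_ \in _); rewrite ?mulr1 ?mulr0 ?normr0.
  by move=> Mx; rewrite memNset ?mulr0//= leNgt Mx.
have h := @dominated_convergence _ _ R mu setT measurableT
  (fun k x => (F k x)%:E) (EFin \o f) (EFin \o g).
have [] := h.
- by move=> k; apply/measurable_EFinP.
- by apply/measurable_EFinP.
- by apply: aeW => x _; apply/fine_cvgP; split; [exact: nearW|exact: cF].
- exact: tame_integrable.
- apply: aeW => x k _; rewrite /= lee_fin /g indicE.
  have [xM|xM] := leP `|x| M; first by rewrite mem_set// mulr1 (dF k x).1.
  by rewrite (dF k x).2// normr0 memNset ?mulr0//= leNgt xM.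
move=> _ _; rewrite integ_EFin// => /fine_cvgP[_].
apply: cvg_trans; rewrite /integ /Rintegral /=; exact: cvg_id.
Qed.

End tame.

(** * Directional derivatives and continuity *)

Section directional.
Context {R : realType}.

Lemma is_derive_quotientP (V : normedModType R) (f : V -> R) x v (l : R) :
  is_derive x v f l <->
  h^-1 * (f (h *: v + x) - f x) @[h --> 0^'] --> l.
Proof.
split=> [[df <-]|h]; first exact: df.
split; first by apply/cvg_ex; exists l.
exact: cvg_lim h.
Qed.

(** Restricting to a line reduces directional derivatives to one real
    variable, where the chain rule and the mean value theorem live. *)
Lemma is_derive_lineP (V : normedModType R) (f : V -> R) x v (t l : R) :
  is_derive (t *: v + x) v f l <-> is_derive t 1 (fun s : R => f (s *: v + x)) l.
Proof.
apply: (iff_trans (is_derive_quotientP _ _ _ _)).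
apply: iff_sym; apply: (iff_trans (is_derive_quotientP (V := R^o) _ _ _ _)).
by under eq_fun do rewrite -[_ *: 1]/(_ * 1) mulr1 scalerDl -addrA.
Qed.

Lemma is_derive_comp_line (V : normedModType R) (u : V -> R) (phi : R -> R) x v (du dphi : R) :
  is_derive x v u du -> is_derive (u x) 1 phi dphi ->
  is_derive x v (fun y => phi (u y)) (dphi * du).
Proof.
move=> hu hphi; have E : 0 *: v + x = x by rewrite scale0r add0r.
rewrite -E; apply: (proj2 (is_derive_lineP _ x v 0 _)).
apply: (@is_derive1_comp R phi (fun s => u (s *: v + x))); first by rewrite E.
by apply: (proj1 (is_derive_lineP u x v 0 du)); rewrite E.
Qed.

Lemma derivable_line_lipschitz (V : normedModType R) (f : V -> R) (df : V -> R) x v (C : R) (t : R) :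
  (forall y, is_derive y v f (df y)) -> (forall y, `|df y| <= C) ->
  `|f (t *: v + x) - f x| <= C * `|t|.
Proof.
move=> hf hC.
have dg (s : R) : is_derive s (1 : R) (fun s : R => f (s *: v + x)) (df (s *: v + x)).
  exact: (proj1 (is_derive_lineP f x v s _)).
have cg : continuous (fun s : R => f (s *: v + x)).
  move=> s; apply: differentiable_continuous; apply/derivable1_diffP.
  by have [] := dg s.
have E : 0 *: v + x = x by rewrite scale0r add0r.
have [t0|t0] := leP 0 t.
  have [c _] := MVT_segment t0 (fun s _ => dg s) (continuous_subspaceT cg).
  by rewrite E subr0 => ->; rewrite normrM ler_wpM2r.
have [c _] := MVT_segment (ltW t0) (fun s _ => dg s) (continuous_subspaceT cg).
rewrite E sub0r => h; rewrite distrC h normrM normrN ler_wpM2r//.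
Qed.

Lemma harmonic_cvg0 : (k.+1%:R^-1 : R) @[k --> \oo] --> (0 : R).
Proof. exact: cvg_harmonic. Qed.

Lemma quotient_seq_cvg (V : normedModType R) (f : V -> R) x v (l : R) (u : nat -> R) :
  is_derive x v f l -> (forall k, u k != 0) -> u k @[k --> \oo] --> (0 : R) ->
  (u k)^-1 * (f (u k *: v + x) - f x) @[k --> \oo] --> l.
Proof.
by move=> /is_derive_quotientP /cvgr_dnbhsP h u0 uc; exact: (h u).
Qed.

End directional.

Section ibp.
Context {R : realType} {n : nat}.
Implicit Types f g u : 'rV[R]_n -> R.
Local Notation e_ i := (delta_mx ord0 i : 'rV[R]_n).

Lemma norm_delta_le1 (i : 'I_n) : `|e_ i| <= 1.
Proof.
rewrite /Num.norm /= mx_normrE; apply: bigmax_le => // -[a b] _ /=.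
by rewrite mxE; case: (_ && _); rewrite ?normr1 ?normr0.
Qed.

Definition C1 i f := (forall x, derivable f x (e_ i)) /\ continuous (pderive i f).

Lemma C1_is_derive i f x : C1 i f -> is_derive x (e_ i) f (pderive i f x).
Proof. by move=> [h _]; exact/derivableP. Qed.

Lemma is_derive_C1 i f df : (forall x, is_derive x (e_ i) f (df x)) -> continuous df ->
  C1 i f /\ pderive i f = df.
Proof.
move=> h c; have E : pderive i f = df by apply/funext => x; have [] := h x.
by split => //; split; [move=> x; have [] := h x|rewrite E].
Qed.

Lemma pderive_supp i f M : (forall x, M < `|x| -> f x = 0) ->
  forall x, M < `|x| -> pderive i f x = 0.
Proof.
move=> h x Mx; rewrite /pderive (near_eq_derive (g := cst 0)) ?derive_cst//.
have : \forall y \near x, M < `|y|.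
  have : `|y| @[y --> x] --> `|x| by exact: norm_continuous.
  by move/cvgr_gt => /(_ _ Mx).
by apply: filterS => y /h.
Qed.

(** By translation invariance the integral of a difference quotient is 0; let
    the step tend to 0. *)
Lemma integ_pderive i f : tame f -> C1 i f -> integ (pderive i f) = 0.
Proof.
move=> tf cf; have [mf [C0 [M hM]]] := tf.
have [C hC] : exists C, forall x, `|pderive i f x| <= C.
  have [_ [C [M' h]]] := continuous_tame cf.2 (pderive_supp i (fun x => (hM x).2)).
  by exists C => x; exact: (h x).1.
pose F k x : R := k.+1%:R * (f (x + k.+1%:R^-1 *: e_ i) - f x).
have tF k : tame (F k).
  by apply: tameZ; apply: tameB => //; exact: tame_shift.
have dF k : dom_by C (M + 1) (F k).
  move=> x; split.
    have := derivable_line_lipschitz x (k.+1%:R^-1) (fun y => C1_is_derive y cf) hC.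
    rewrite /F normrM (addrC x) => h; apply: le_trans (ler_wpM2l (normr_ge0 _) h) _.
    by rewrite mulrCA -normrM divff ?normr1 ?mulr1.
  move=> Mx; have h : `|x| <= `|x + k.+1%:R^-1 *: e_ i| + 1.
    rewrite -{1}(addrK (k.+1%:R^-1 *: e_ i) x); apply: le_trans (ler_normB _ _) _.
    rewrite lerD2l normrZ -[leRHS](mulr1 1) ler_pM// ?norm_delta_le1//.
    by rewrite ger0_norm// invf_le1// ler1n.
  have M1 : M < `|x| by apply: le_lt_trans Mx; rewrite lerDl.
  have M2 : M < `|x + k.+1%:R^-1 *: e_ i|.
    by rewrite -(ltrD2r 1); apply: lt_le_trans h.
  by rewrite /F ((hM _).2 M1) ((hM _).2 M2) subrr mulr0.
have cF x : F k x @[k --> \oo] --> pderive i f x.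
  have u0 k : k.+1%:R^-1 != 0 :> R by rewrite invr_eq0.
  have h := quotient_seq_cvg (C1_is_derive x cf) u0 (@harmonic_cvg0 R).
  apply: cvg_trans h; apply: near_eq_cvg; apply: nearW => k.
  by rewrite /F invrK (addrC x).
have [_ h] := integ_cvg (fun k => (tF k).1) dF cF.
rewrite -(cvg_lim _ h)//; rewrite (_ : (fun k => integ (F k)) = cst 0); first exact: lim_cst.
apply/funext => k; rewrite /F integZ; last by apply: tameB => //; exact: tame_shift.
by rewrite integB ?integ_shift ?subrr ?mulr0//; exact: tame_shift.
Qed.

End ibp.

Section continuity.
Context {R : realType} {T : topologicalType}.
Implicit Types (f g : T -> R) (x : T).

(** A head constant for continuity at a point, with which the rules below
    match functions written as abstractions. *)
Definition ctsat f x := {for x, continuous f}.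

Lemma ctsat_cst (c : R) x : ctsat (fun=> c) x.
Proof. exact: cst_continuous. Qed.
Lemma ctsatD f g x : ctsat f x -> ctsat g x -> ctsat (fun y => f y + g y) x.
Proof. by move=> hf hg; exact: (continuousD hf hg). Qed.
Lemma ctsatB f g x : ctsat f x -> ctsat g x -> ctsat (fun y => f y - g y) x.
Proof. by move=> hf hg; exact: (continuousB hf hg). Qed.
Lemma ctsatN f x : ctsat f x -> ctsat (fun y => - f y) x.
Proof. by move=> hf; exact: (continuousN hf). Qed.
Lemma ctsatM f g x : ctsat f x -> ctsat g x -> ctsat (fun y => f y * g y) x.
Proof. by move=> hf hg; exact: (continuousM hf hg). Qed.
Lemma ctsat_comp (phi : R -> R) f x : ctsat f x -> {for f x, continuous phi} ->
  ctsat (fun y => phi (f y)) x.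
Proof. by move=> hf hp; exact: (continuous_comp hf hp). Qed.
Lemma ctsatX f k x : ctsat f x -> ctsat (fun y => f y ^+ k) x.
Proof.
move=> hf; elim: k => [|k IH]; first exact: ctsat_cst.
by under eq_fun do rewrite exprS; exact: ctsatM.
Qed.
Lemma ctsat_norm f x : ctsat f x -> ctsat (fun y => `|f y|) x.
Proof. by move=> hf; apply: ctsat_comp hf _; exact: norm_continuous. Qed.
Lemma ctsat_sum (I : Type) (s : seq I) (F : I -> T -> R) x :
  (forall i, ctsat (F i) x) -> ctsat (fun y => \sum_(i <- s) F i y) x.
Proof.
move=> h; elim: s => [|i s IH].
  by under eq_fun do rewrite big_nil; exact: ctsat_cst.
by under eq_fun do rewrite big_cons; exact: ctsatD.
Qed.

End continuity.

Lemma ctsat_affine {R : realType} {n : nat} (f : 'rV[R]_n -> R) (a : R) (v x : 'rV[R]_n) :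
  ctsat f (a *: x + v) -> ctsat (fun y : 'rV[R]_n => f (a *: y + v)) x.
Proof.
move=> hf; apply: (@continuous_comp _ _ _ (fun y : 'rV[R]_n => a *: y + v) f); last exact: hf.
apply: (@continuousD _ _ _ (fun y : 'rV[R]_n => a *: y) (fun=> v) x).
  exact: scaler_continuous.
exact: cst_continuous.
Qed.

Lemma ctsat_shift {R : realType} {n : nat} (f : 'rV[R]_n -> R) (v x : 'rV[R]_n) :
  ctsat f (x + v) -> ctsat (fun y : 'rV[R]_n => f (y + v)) x.
Proof.
by have := @ctsat_affine R n f 1 v x; rewrite scale1r; under eq_fun do rewrite scale1r.
Qed.

Section quotient_cvg.
Context {R : realType} {n : nat}.
Local Notation e_ i := (delta_mx ord0 i : 'rV[R]_n).

(** The limit step of an integration by parts in which B has no derivative: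
    the difference quotient stands on zeta, and its increments may have any
    sign. *)
Lemma integ_quot_cvg i (B zeta : 'rV[R]_n -> R) (u : nat -> R) :
  measurable_fun setT B -> loc_bounded B -> C1 i zeta -> tame zeta ->
  (forall k, u k != 0) -> (forall k, `|u k| <= 1) -> u k @[k --> \oo] --> 0 ->
  (forall k, tame (fun x => B x * ((u k)^-1 * (zeta (u k *: e_ i + x) - zeta x)))) /\
  integ (fun x => B x * ((u k)^-1 * (zeta (u k *: e_ i + x) - zeta x))) @[k --> \oo] -->
    integ (fun x => B x * pderive i zeta x).
Proof.
move=> mB bB cz tz u0 u1 uc; have [mz [C0 [M hM]]] := tz.
have [C hC] : exists C, forall x, `|pderive i zeta x| <= C.
  have [_ [C [M' h]]] := continuous_tame cz.2 (pderive_supp i (fun x => (hM x).2)).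
  by exists C => x; exact: (h x).1.
have C00 : 0 <= C by apply: le_trans (normr_ge0 _) (hC 0).
have tS k : tame (fun x => zeta (u k *: e_ i + x)).
  by under eq_fun do rewrite addrC; exact: tame_shift.
have tF k : tame (fun x => B x * ((u k)^-1 * (zeta (u k *: e_ i + x) - zeta x))).
  by apply: tameM => //; apply: tameZ; apply: tameB.
split => //; have [C2 hC2] := bB (M + 1).
suff : tame (fun x => B x * pderive i zeta x) /\
   integ (fun x => B x * ((u k)^-1 * (zeta (u k *: e_ i + x) - zeta x))) @[k --> \oo] -->
    integ (fun x => B x * pderive i zeta x) by case.
apply: (integ_cvg (C := `|C2| * C) (M := M + 1)).
- by move=> k; exact: (tF k).1.
- move=> k x.
  have Z : M + 1 < `|x| -> (u k)^-1 * (zeta (u k *: e_ i + x) - zeta x) = 0.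
    move=> Mx; have h : `|x| <= `|u k *: e_ i + x| + 1.
      rewrite -{1}(addKr (u k *: e_ i) x) -scaleNr addrC.
      apply: le_trans (ler_normD _ _) _; rewrite lerD2l normrZ normrN.
      by rewrite -[leRHS](mulr1 1) ler_pM// norm_delta_le1.
    have M1 : M < `|x| by apply: le_lt_trans Mx; rewrite lerDl.
    have M2 : M < `|u k *: e_ i + x| by rewrite -(ltrD2r 1); apply: lt_le_trans h.
    by rewrite ((hM _).2 M1) ((hM _).2 M2) subrr mulr0.
  split; last by move=> /Z ->; rewrite mulr0.
  have [xM|xM] := leP `|x| (M + 1); last by rewrite Z// mulr0 normr0 mulr_ge0.
  rewrite normrM ler_pM//; first exact: le_trans (hC2 x xM) (ler_norm _).
  have h := derivable_line_lipschitz x (u k) (fun y => C1_is_derive y cz) hC.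
  rewrite normrM; apply: le_trans (ler_wpM2l (normr_ge0 _) h) _.
  by rewrite mulrCA -normrM mulVf// normr1 mulr1.
- move=> x; apply: cvgM; first exact: cvg_cst.
  exact: quotient_seq_cvg (C1_is_derive x cz) u0 uc.
Qed.

End quotient_cvg.

Section pointwise_derivatives.
Context {R : realType} {V : normedModType R}.
Implicit Types (f g : V -> R) (x v : V) (a b : R).

Lemma isd_eq f x v a b : is_derive x v f a -> a = b -> is_derive x v f b.
Proof. by move=> h <-. Qed.
Lemma isd_cst c x v : is_derive x v (fun=> c : R) 0.
Proof. exact: is_derive_cst. Qed.
Lemma isdD f g x v a b : is_derive x v f a -> is_derive x v g b ->
  is_derive x v (fun y => f y + g y) (a + b).
Proof. by move=> hf hg; exact: is_deriveD. Qed.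
Lemma isdB f g x v a b : is_derive x v f a -> is_derive x v g b ->
  is_derive x v (fun y => f y - g y) (a - b).
Proof. by move=> hf hg; exact: is_deriveB. Qed.
Lemma isdM f g x v a b : is_derive x v f a -> is_derive x v g b ->
  is_derive x v (fun y => f y * g y) (a * g x + f x * b).
Proof.
move=> hf hg; apply: (isd_eq (is_deriveM hf hg)).
by rewrite -![_ *: _]/(_ * _) addrC mulrC.
Qed.
Lemma isdZ f x v a c : is_derive x v f a -> is_derive x v (fun y => c * f y) (c * a).
Proof.
by move=> hf; apply: (isd_eq (isdM (isd_cst c x v) hf)); rewrite mul0r add0r.
Qed.
End pointwise_derivatives.

(** * Euclidean norm and distance to a closed set *)

Section euclid.
Context {R : realType} {n : nat}.
Implicit Types (x y z v : 'rV[R]_n).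
Local Notation e_ i := (delta_mx ord0 i : 'rV[R]_n).

Definition sqn x : R := \sum_i x ord0 i ^+ 2.

Lemma sqn_ge0 x : 0 <= sqn x.
Proof. by apply: sumr_ge0 => i _; exact: sqr_ge0. Qed.

Lemma enorm_sqr x : enorm x ^+ 2 = sqn x.
Proof. by rewrite /enorm sqr_sqrtr// sqn_ge0. Qed.

Lemma enorm_ge0 x : 0 <= enorm x.
Proof. exact: sqrtr_ge0. Qed.

(** Expanding the square of t x - s y gives the bound s t for all positive s
    and t above the two norms; positivity avoids the case of a zero norm,
    which is reached in the limit. *)
Lemma dot_le_enorm x y : \sum_i x ord0 i * y ord0 i <= enorm x * enorm y.
Proof.
have key (s t : R) : 0 < s -> 0 < t -> sqn x <= s ^+ 2 -> sqn y <= t ^+ 2 ->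
    \sum_i x ord0 i * y ord0 i <= s * t.
  move=> s0 t0 hs ht.
  have : 0 <= \sum_i (t * x ord0 i - s * y ord0 i) ^+ 2.
    by apply: sumr_ge0 => i _; exact: sqr_ge0.
  have -> : \sum_i (t * x ord0 i - s * y ord0 i) ^+ 2 =
      t ^+ 2 * sqn x + s ^+ 2 * sqn y - 2 * (s * t) * \sum_i x ord0 i * y ord0 i.
    rewrite /sqn !mulr_sumr -big_split -sumrB; apply: eq_bigr => i _ /=; ring.
  move=> h; rewrite -(ler_pM2l (_ : 0 < 2 * (s * t))); last by rewrite !mulr_gt0.
  have h1 : t ^+ 2 * sqn x <= t ^+ 2 * s ^+ 2 by rewrite ler_wpM2l// sqr_ge0.
  have h2 : s ^+ 2 * sqn y <= s ^+ 2 * t ^+ 2 by rewrite ler_wpM2l// sqr_ge0.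
  nra.
apply/ler_addgt0Pr => e e0.
pose M := enorm x + enorm y + 1.
have M0 : 0 < M by rewrite /M; have := enorm_ge0 x; have := enorm_ge0 y; lra.
pose r := Num.min 1 (e / (2 * M)).
have r0 : 0 < r by rewrite /r lt_min ltr01 divr_gt0// mulr_gt0.
have r1 : r <= 1 by rewrite /r ge_min lexx.
have re : r * (2 * M) <= e.
  by rewrite -ler_pdivlMr ?mulr_gt0// /r ge_min lexx orbT.
have hx := enorm_ge0 x; have hy := enorm_ge0 y.
have h1 : sqn x <= (enorm x + r) ^+ 2 by rewrite -enorm_sqr; nra.
have h2 : sqn y <= (enorm y + r) ^+ 2 by rewrite -enorm_sqr; nra.
apply: le_trans (key _ _ _ _ h1 h2) _; [lra|lra|].
by rewrite /M in re; nra.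
Qed.

Lemma ler_enormD x y : enorm (x + y) <= enorm x + enorm y.
Proof.
rewrite -(ler_pXn2r (n := 2))// ?nnegrE ?addr_ge0 ?enorm_ge0//.
rewrite enorm_sqr sqrrD !enorm_sqr.
have -> : sqn (x + y) = sqn x + (\sum_i x ord0 i * y ord0 i) *+ 2 + sqn y.
  rewrite /sqn -mulr_natl mulr_sumr -!big_split; apply: eq_bigr => i _ /=; rewrite !mxE; ring.
by rewrite lerD2r lerD2l lerMn2r/= dot_le_enorm.
Qed.

Lemma enormN x : enorm (- x) = enorm x.
Proof. by rewrite /enorm; congr Num.sqrt; apply: eq_bigr => i _; rewrite mxE sqrrN. Qed.

Lemma coord_le_enorm x i : `|x ord0 i| <= enorm x.
Proof.
rewrite -(ler_pXn2r (n := 2))// ?nnegrE ?enorm_ge0// real_normK ?num_real//.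
rewrite enorm_sqr /sqn (bigD1 i)//= lerDl; apply: sumr_ge0 => j _; exact: sqr_ge0.
Qed.

Lemma norm_le_enorm x : `|x| <= enorm x.
Proof.
rewrite /Num.norm /= mx_normrE; apply: bigmax_le; first exact: enorm_ge0.
by move=> [a b] _ /=; rewrite (ord1 a) coord_le_enorm.
Qed.

Lemma enorm_le_norm x : enorm x <= Num.sqrt n%:R * `|x|.
Proof.
rewrite -(ler_pXn2r (n := 2))// ?nnegrE ?enorm_ge0// ?mulr_ge0 ?sqrtr_ge0//.
rewrite enorm_sqr exprMn sqr_sqrtr ?ler0n// /sqn.
apply: (@le_trans _ _ (\sum_(i < n) `|x| ^+ 2)); last by rewrite sumr_const card_ord mulr_natl.
by apply: ler_sum => i _; rewrite -(real_normK (num_real (x ord0 i))) ler_pXn2r ?nnegrE// row_coord_le.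
Qed.

Lemma row_continuousP (f : 'rV[R]_n -> R) x :
  (forall e, 0 < e -> exists2 a, 0 < a &
     forall y, `|x - y| < a -> `|f x - f y| <= e) -> {for x, continuous f}.
Proof.
move=> h; apply: (proj2 (@cvgrPdist_le _ _ _ (nbhs x) _ f (f x))) => e e0.
have [a a0 ha] := h e e0.
by apply/nbhs_ballP; exists a => //= y; rewrite -ball_normE /ball_/=; exact: ha.
Qed.

Lemma enorm_le_near x : forall e, 0 < e -> exists2 a, 0 < a &
  forall y, `|x - y| < a -> enorm (x - y) <= e.
Proof.
move=> e e0; have s0 : 0 <= Num.sqrt n%:R :> R by exact: sqrtr_ge0.
exists (e / (Num.sqrt n%:R + 1)); first by rewrite divr_gt0// ltr_wpDl.
move=> y; rewrite ltr_pdivlMr ?ltr_wpDl// => h.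
apply: le_trans (enorm_le_norm _) _; apply: le_trans (ltW h).
by rewrite mulrC ler_wpM2l// lerDl.
Qed.

Lemma enorm_continuous : continuous (@enorm R n).
Proof.
move=> x; apply: row_continuousP => e /(enorm_le_near x)[a a0 h].
exists a => // y /h; apply: le_trans.
rewrite ler_norml; apply/andP; split.
  rewrite lerNl opprB lerBlDr -(enormN (x - y)) opprB.
  by rewrite -{1}(subrK x y); exact: ler_enormD.
by rewrite lerBlDr -{1}(subrK y x); exact: ler_enormD.
Qed.

Lemma sqn_line x (t : R) i : sqn (x + t *: e_ i) = sqn x + 2 * t * x ord0 i + t ^+ 2.
Proof.
rewrite /sqn (bigD1 i)//= [in RHS](bigD1 i)//=.
rewrite (eq_bigr (fun j => x ord0 j ^+ 2)); last first.
  by move=> j ji; rewrite !mxE eqxx /= (negbTE ji) mulr0 addr0.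
by rewrite !mxE !eqxx /=; ring.
Qed.

Section dist.
Variable K : set 'rV[R]_n.
Hypothesis K0 : K !=set0.
Hypothesis cK : closed K.
Local Notation d := (eudist K).

(** The infimum only involves the part of K in a suitable ball, which is
    compact. *)
Lemma nearest_point x : exists2 y, K y & d x = enorm (x - y).
Proof.
have [z0 Kz0] := K0.
pose B := K `&` [set y | `|y| <= `|x| + enorm (x - z0)].
have cB : compact B.
  apply: (subclosed_compact _ (@compact_row_ball _ _ (`|x| + enorm (x - z0)))).
    by apply: closedI => //; exact: closed_row_ball.
  by move=> y [].
have B0 : B !=set0.
  exists z0; split=> //=; rewrite -{1}(subKr x z0); apply: le_trans (ler_normB _ _) _.
  by rewrite lerD2l norm_le_enorm.
have ce : {within B, continuous (fun y => enorm (x - y))}.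
  apply: continuous_subspaceT => y.
  apply: (@continuous_comp _ _ _ (fun y => x - y) (@enorm R n)); last exact: enorm_continuous.
  exact: (continuousB (cvg_cst _) cvg_id).
have [y + hy] := EVT_min_rV B0 cB ce; rewrite inE => -[Ky _].
have miny z : K z -> enorm (x - y) <= enorm (x - z).
  move=> Kz; have [zz|zz] := leP (enorm (x - z)) (enorm (x - z0)); last first.
    apply: le_trans (ltW zz); apply: hy; rewrite inE; split => //=.
    rewrite -{1}(subKr x z0); apply: le_trans (ler_normB _ _) _.
    by rewrite lerD2l norm_le_enorm.
  apply: hy; rewrite inE; split => //=.
  rewrite -{1}(subKr x z); apply: le_trans (ler_normB _ _) _.
  by rewrite lerD2l (le_trans (norm_le_enorm _)).
exists y => //; apply/eqP; rewrite eq_le; apply/andP; split.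
  apply: ge_inf; last by exists y.
  by exists 0 => _ [z _ <-]; exact: enorm_ge0.
apply: lb_le_inf; first by exists (enorm (x - z0)), z0.
by move=> _ [z Kz <-]; exact: miny.
Qed.

Lemma eudist_le x y : K y -> d x <= enorm (x - y).
Proof.
move=> Ky; apply: ge_inf; last by exists y.
by exists 0 => _ [z _ <-]; exact: enorm_ge0.
Qed.

Lemma eudist_ge0 x : 0 <= d x.
Proof. by have [y _ ->] := nearest_point x; exact: enorm_ge0. Qed.

Lemma eudist_gt0 x : ~ K x -> 0 < d x.
Proof.
move=> Kx; rewrite lt_neqAle eudist_ge0 andbT; apply/eqP => d0; apply: Kx.
have [y Ky dy] := nearest_point x; suff -> : x = y by [].
apply/eqP; rewrite -subr_eq0 -normr_le0; apply: le_trans (norm_le_enorm _) _.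
by rewrite -dy -d0.
Qed.

Lemma eudist_lip x v : d (x + v) <= d x + enorm v.
Proof.
have [y Ky ->] := nearest_point x.
by apply: le_trans (eudist_le _ Ky) _; rewrite addrAC; exact: ler_enormD.
Qed.

Lemma eudist_lip_ge x v : d x - enorm v <= d (x + v).
Proof.
have := eudist_lip (x + v) (- v); rewrite addrK enormN; lra.
Qed.

Lemma eudist_continuous : continuous d.
Proof.
move=> x; apply: row_continuousP => e /(enorm_le_near x)[a a0 h].
exists a => // y /h; rewrite -enormN opprB.
have := eudist_lip x (y - x); have := eudist_lip_ge x (y - x).
rewrite (addrC x) subrK => h1 h2 h3; rewrite ler_norml; apply/andP; split; lra.
Qed.

End dist.
End euclid.

(** * Half the squared distance and its weak gradient *)

Section halfsq.
Context {R : realType} {n : nat}.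
Variable K : set 'rV[R]_n.
Hypothesis K0 : K !=set0.
Hypothesis cK : closed K.
Local Notation d := (eudist K).
Local Notation e_ i := (delta_mx ord0 i : 'rV[R]_n).
Implicit Types (x y z v : 'rV[R]_n) (i : 'I_n) (t s : R).

(** Half the squared distance: an infimum of the paraboloids |x - y|^2 / 2, y
    in K, all with the identity as Hessian. Hence A - |x|^2 / 2 is concave on
    the whole space, across K included. *)
Definition hsd x : R := d x ^+ 2 / 2.
Local Notation A := hsd.

Lemma hsd_le x y : K y -> A x <= sqn (x - y) / 2.
Proof.
move=> Ky; rewrite /hsd ler_pM2r// -enorm_sqr ler_pXn2r// ?nnegrE ?enorm_ge0 ?eudist_ge0//.
exact: eudist_le.
Qed.

Lemma hsd_nearest x : exists2 y, K y & A x = sqn (x - y) / 2.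
Proof.
by have [y Ky dy] := nearest_point K0 cK x; exists y; rewrite // /hsd dy enorm_sqr.
Qed.

Lemma hsd_continuous : continuous A.
Proof.
move=> x.
have cd := @eudist_continuous _ _ _ K0 cK x.
have c2 : {for x, continuous (fun y => d y ^+ 2)} by exact: (continuousM cd cd).
have c3 : {for x, continuous (fun _ : 'rV[R]_n => 2^-1 : R)} by exact: cst_continuous.
exact: (continuousM c2 c3).
Qed.

(** The difference quotient at t = 0 of the concave function of t given by A
    (x + t e_i) - t^2 / 2. *)
Definition hsdq i t x : R := (A (x + t *: e_ i) - A x) / t - t / 2.

Lemma hsd_line_le x y t i : K y ->
  A (x + t *: e_ i) <= sqn (x - y) / 2 + t * (x - y) ord0 i + t ^+ 2 / 2.
Proof.
move=> Ky; apply: le_trans (hsd_le _ Ky) _.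
by rewrite addrAC sqn_line; lra.
Qed.

Lemma hsd_line_eq x t i : exists2 y, K y &
  A (x + t *: e_ i) = sqn (x - y) / 2 + t * (x - y) ord0 i + t ^+ 2 / 2.
Proof.
have [y Ky Ay] := hsd_nearest (x + t *: e_ i); exists y => //.
by rewrite Ay addrAC sqn_line; lra.
Qed.

Lemma hsdqE i t x : t != 0 -> A (x + t *: e_ i) - t ^+ 2 / 2 = A x + t * hsdq i t x.
Proof. by move=> t0; rewrite /hsdq; field. Qed.

Lemma hsdq_le i t x y : 0 < t -> K y -> A x = sqn (x - y) / 2 ->
  hsdq i t x <= (x - y) ord0 i.
Proof.
move=> t0 Ky Ax; rewrite -(ler_pM2l t0).
have := hsdqE i x (lt0r_neq0 t0); have := hsd_line_le x t i Ky; rewrite -Ax.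
nra.
Qed.

Lemma hsdq_ge i t x y : t < 0 -> K y -> A x = sqn (x - y) / 2 ->
  (x - y) ord0 i <= hsdq i t x.
Proof.
move=> t0 Ky Ax; rewrite -(ler_nM2l t0).
have := hsdqE i x (ltr0_neq0 t0); have := hsd_line_le x t i Ky; rewrite -Ax.
nra.
Qed.

(** Concavity in elementary terms: compare with the paraboloid of a point y
    nearest to x + s e_i, which is exact at s and an upper bound at 0 and at
    t. *)
Lemma hsdq_mono i s t x : 0 < s -> s <= t -> hsdq i t x <= hsdq i s x.
Proof.
move=> s0 st; have t0 : 0 < t by exact: lt_le_trans st.
have [y Ky Ay] := hsd_line_eq x s i.
have h0 := hsd_le x Ky; have ht := hsd_line_le x t i Ky.
have es := hsdqE i x (lt0r_neq0 s0); have et := hsdqE i x (lt0r_neq0 t0).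
rewrite -(ler_pM2l (mulr_gt0 s0 t0)).
have a1 : t * hsdq i t x <= sqn (x - y) / 2 - A x + t * (x - y) ord0 i by lra.
have a2 : s * hsdq i s x = sqn (x - y) / 2 - A x + s * (x - y) ord0 i by lra.
have b1 := ler_wpM2l (ltW s0) a1.
have b2 : t * (s * hsdq i s x) = t * (sqn (x - y) / 2 - A x + s * (x - y) ord0 i) by rewrite a2.
have b3 : s * (sqn (x - y) / 2 - A x) <= t * (sqn (x - y) / 2 - A x) by rewrite ler_wpM2r//; lra.
lra.
Qed.

Lemma hsdq_mono_neg i s t x : t <= s -> s < 0 -> hsdq i s x <= hsdq i t x.
Proof.
move=> ts s0; have t0 : t < 0 by exact: le_lt_trans s0.
have [y Ky Ay] := hsd_line_eq x s i.
have h0 := hsd_le x Ky; have ht := hsd_line_le x t i Ky.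
have es := hsdqE i x (ltr0_neq0 s0); have et := hsdqE i x (ltr0_neq0 t0).
rewrite -(ler_pM2l (_ : 0 < s * t)); last by rewrite nmulr_rgt0.
have a1 : t * hsdq i t x <= sqn (x - y) / 2 - A x + t * (x - y) ord0 i by lra.
have a2 : s * hsdq i s x = sqn (x - y) / 2 - A x + s * (x - y) ord0 i by lra.
have b1 : s * (sqn (x - y) / 2 - A x + t * (x - y) ord0 i) <= s * (t * hsdq i t x) by rewrite ler_wnM2l// ltW.
have b2 : t * (s * hsdq i s x) = t * (sqn (x - y) / 2 - A x + s * (x - y) ord0 i) by rewrite a2.
have b3 : t * (sqn (x - y) / 2 - A x) <= s * (sqn (x - y) / 2 - A x) by rewrite ler_wpM2r//; lra.
lra.
Qed.

Definition hstep (k : nat) : R := k.+1%:R^-1.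

Lemma hstep_gt0 k : 0 < hstep k. Proof. by rewrite /hstep invr_gt0. Qed.
Lemma hstep_le1 k : hstep k <= 1. Proof. by rewrite /hstep invf_le1// ler1n. Qed.
Lemma hstep_le k l : (k <= l)%N -> hstep l <= hstep k.
Proof. by move=> kl; rewrite /hstep lef_pV2 ?posrE// ler_nat. Qed.

(** Dp and Dm are the right and the left derivative of A along e_i. They are
    limits of monotone sequences of continuous functions, so they exist
    everywhere and are measurable. *)
Definition Dp i x : R := limn (fun k => hsdq i (hstep k) x).
Definition Dm i x : R := limn (fun k => hsdq i (- hstep k) x).

Lemma Dp_cvg i x : hsdq i (hstep k) x @[k --> \oo] --> Dp i x.
Proof.
have [y Ky Ay] := hsd_nearest x.
apply: nondecreasing_is_cvgn.
  by apply/nondecreasing_seqP => k; apply: hsdq_mono (hstep_gt0 _) (hstep_le _).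
by exists ((x - y) ord0 i) => _ [k _ <-]; apply: hsdq_le => //; exact: hstep_gt0.
Qed.

Lemma Dm_cvg i x : hsdq i (- hstep k) x @[k --> \oo] --> Dm i x.
Proof.
have [y Ky Ay] := hsd_nearest x.
apply: nonincreasing_is_cvgn.
  apply/nonincreasing_seqP => k; apply: hsdq_mono_neg; first by rewrite lerN2 hstep_le.
  by rewrite oppr_lt0 hstep_gt0.
by exists ((x - y) ord0 i) => _ [k _ <-]; apply: hsdq_ge; rewrite // oppr_lt0 hstep_gt0.
Qed.

Lemma hsdq_le_Dp i t x : 0 < t -> hsdq i t x <= Dp i x.
Proof.
move=> t0; have h := @Dp_cvg i x; rewrite -(cvg_lim _ h)//.
apply: limr_ge; first by apply/cvg_ex; exists (Dp i x).
have : hstep k @[k --> \oo] --> 0 by exact: harmonic_cvg0.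
move/cvgr_lt => /(_ _ t0); apply: filterS => k kt.
exact: hsdq_mono (hstep_gt0 _) (ltW kt).
Qed.

Lemma Dm_le_hsdq i t x : t < 0 -> Dm i x <= hsdq i t x.
Proof.
move=> t0; have h := @Dm_cvg i x; rewrite -(cvg_lim _ h)//.
apply: limr_le; first by apply/cvg_ex; exists (Dm i x).
have : hstep k @[k --> \oo] --> 0 by exact: harmonic_cvg0.
have t0' : 0 < - t by rewrite oppr_gt0.
move/cvgr_lt => /(_ _ t0'); apply: filterS => k kt.
by apply: hsdq_mono_neg; rewrite ?oppr_lt0 ?hstep_gt0// lerNr ltW.
Qed.

(** With y nearest to x, the affine function of slope (x - y)_i lies above the
    concave one and touches it at 0, so its slope lies between the two one-
    sided derivatives. *)
Lemma Dp_le i x y : K y -> A x = sqn (x - y) / 2 -> Dp i x <= (x - y) ord0 i.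
Proof.
move=> Ky Ay; have h := @Dp_cvg i x; rewrite -(cvg_lim _ h)//.
apply: limr_le; first by apply/cvg_ex; exists (Dp i x).
by apply: nearW => k; apply: hsdq_le => //; exact: hstep_gt0.
Qed.

Lemma Dm_ge i x y : K y -> A x = sqn (x - y) / 2 -> (x - y) ord0 i <= Dm i x.
Proof.
move=> Ky Ay; have h := @Dm_cvg i x; rewrite -(cvg_lim _ h)//.
apply: limr_ge; first by apply/cvg_ex; exists (Dm i x).
by apply: nearW => k; apply: hsdq_ge => //; rewrite oppr_lt0 hstep_gt0.
Qed.

Lemma Dp_le_Dm i x : Dp i x <= Dm i x.
Proof.
have [y Ky Ay] := hsd_nearest x.
exact: le_trans (Dp_le i Ky Ay) (Dm_ge i Ky Ay).
Qed.

(** Where the one-sided derivatives agree they are the coordinates of x - y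
    for a nearest point y: the eikonal equation for A. *)
Lemma Dp_sqr x : (forall i, Dp i x = Dm i x) -> \sum_i Dp i x ^+ 2 = 2 * A x.
Proof.
move=> h; have [y Ky Ay] := hsd_nearest x.
rewrite Ay mulrC divfK// /sqn; apply: eq_bigr => i _; congr (_ ^+ 2).
by apply/eqP; rewrite eq_le (Dp_le i Ky Ay) h (Dm_ge i Ky Ay).
Qed.

Lemma Dp_is_derive i x : Dp i x = Dm i x -> is_derive x (e_ i) A (Dp i x).
Proof.
move=> E; apply/is_derive_quotientP.
have q t : t != 0 -> t^-1 * (A (t *: e_ i + x) - A x) = hsdq i t x + t / 2.
  by move=> t0; rewrite /hsdq (addrC x); ring.
have [y Ky Ay] := hsd_nearest x.
have Dy : Dp i x = (x - y) ord0 i.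
  by apply/eqP; rewrite eq_le (Dp_le i Ky Ay) E (Dm_ge i Ky Ay).
apply/cvgr_dnbhsP => u [u0 uc].
apply/cvgrPdist_le => e e0.
have e2 : 0 < e / 2 by rewrite divr_gt0.
have h1 : \forall k \near \oo, `|Dp i x - hsdq i (hstep k) x| <= e / 2.
  by move/cvgrPdist_le : (@Dp_cvg i x); apply.
have h2 : \forall k \near \oo, `|Dm i x - hsdq i (- hstep k) x| <= e / 2.
  by move/cvgrPdist_le : (@Dm_cvg i x); apply.
have [l [l1 l2]] : exists l, `|Dp i x - hsdq i (hstep l) x| <= e / 2 /\
   `|Dm i x - hsdq i (- hstep l) x| <= e / 2.
  have [l _ hl] := filterI h1 h2; exists l; exact: (hl l (leqnn l)).
have h3 : \forall k \near \oo, `|0 - u k| < Num.min (hstep l) e.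
  by move/cvgrPdist_lt : uc; apply; rewrite lt_min hstep_gt0.
apply: filterS h3 => k; rewrite sub0r normrN lt_min => /andP[ul ue].
rewrite q//; have [uk|uk] := leP 0 (u k).
  have uk0 : 0 < u k by rewrite lt_neqAle eq_sym u0.
  rewrite ger0_norm// in ul ue.
  have a1 := hsdq_mono i x uk0 (ltW ul).
  have a2 := hsdq_le_Dp i x uk0.
  move: l1; rewrite !ler_norml => /andP[? ?]; apply/andP; split; lra.
rewrite ltr0_norm// in ul ue.
have a1 : hsdq i (u k) x <= hsdq i (- hstep l) x.
  by apply: hsdq_mono_neg => //; rewrite lerNl ltW.
have a2 := Dm_le_hsdq i x uk.
move: l2; rewrite !ler_norml E => /andP[? ?]; apply/andP; split; lra.
Qed.

Lemma is_derive_Dp i x l : is_derive x (e_ i) A l -> Dp i x = l /\ Dm i x = l.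
Proof.
move=> h.
have gen (u : nat -> R) : (forall k, u k != 0) -> u k @[k --> \oo] --> 0 ->
    hsdq i (u k) x @[k --> \oo] --> l.
  move=> u0 uc; have h1 := quotient_seq_cvg h u0 uc.
  have -> : (fun k => hsdq i (u k) x) =
    (fun k => (u k)^-1 * (A (u k *: e_ i + x) - A x) - u k * 2^-1).
    by apply/funext => k; rewrite /hsdq (addrC x) [_ / u k]mulrC.
  rewrite -[X in _ --> X]subr0 -[X in _ - X](mul0r 2^-1).
  by apply: cvgB => //; apply: cvgM => //; exact: cvg_cst.
have h0 : hstep k @[k --> \oo] --> 0 by exact: harmonic_cvg0.
split.
  by apply: cvg_lim => //; apply: gen => // k; rewrite gt_eqF// hstep_gt0.
apply: cvg_lim => //; apply: gen => [k|]; first by rewrite oppr_eq0 gt_eqF// hstep_gt0.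
by rewrite -oppr0; apply: cvgN.
Qed.

Lemma hsdq_continuous i t : continuous (hsdq i t).
Proof.
move=> x; change (ctsat (fun y => (A (y + t *: e_ i) - A y) / t - t / 2) x).
apply: ctsatB; last exact: ctsat_cst.
apply: ctsatM; last exact: ctsat_cst.
by apply: ctsatB; [apply: ctsat_shift|]; exact: hsd_continuous.
Qed.

Lemma hsdq_measurable i t : measurable_fun setT (hsdq i t).
Proof. by apply: continuous_measurable_row; exact: hsdq_continuous. Qed.

Lemma Dp_measurable i : measurable_fun setT (Dp i).
Proof.
by apply: (measurable_fun_cvg (h := fun k => hsdq i (hstep k))) => [k|x _]; [exact: hsdq_measurable|exact: Dp_cvg].
Qed.

Lemma Dm_measurable i : measurable_fun setT (Dm i).
Proof.
by apply: (measurable_fun_cvg (h := fun k => hsdq i (- hstep k))) => [k|x _]; [exact: hsdq_measurable|exact: Dm_cvg].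
Qed.

(** By monotonicity the quotients with steps in [-1, 1] lie between those with
    steps 1 and -1, so this function dominates all of them. *)
Definition hsd_bd i x : R := `|hsdq i 1 x| + `|hsdq i (-1) x|.

Lemma hsdq_bd i t x : t != 0 -> `|t| <= 1 -> `|hsdq i t x| <= hsd_bd i x.
Proof.
have [y Ky Ay] := hsd_nearest x.
have p1 := hsdq_le i ltr01 Ky Ay.
have m1 : (x - y) ord0 i <= hsdq i (-1) x by apply: hsdq_ge => //; rewrite oppr_lt0.
move=> t0 t1; rewrite /hsd_bd.
have n1 := ler_norm (hsdq i (-1) x); have n2 := ler_norm (- hsdq i 1 x).
have n3 := normr_ge0 (hsdq i (-1) x); have n4 := normr_ge0 (hsdq i 1 x).
have n5 := ler_norm (hsdq i 1 x); have n6 := ler_norm (- hsdq i (-1) x).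
rewrite !normrN in n2 n6.
have [tp|tn] := leP 0 t.
  have tp0 : 0 < t by rewrite lt_neqAle eq_sym t0.
  rewrite ger0_norm// in t1.
  have a1 := hsdq_mono i x tp0 t1; have a2 := hsdq_le i tp0 Ky Ay.
  by rewrite ler_norml; apply/andP; split; lra.
rewrite ltr0_norm// in t1.
have a1 : hsdq i t x <= hsdq i (-1) x by apply: hsdq_mono_neg => //; lra.
have a2 := hsdq_ge i tn Ky Ay.
by rewrite ler_norml; apply/andP; split; lra.
Qed.

Lemma hsd_bd_continuous i : continuous (hsd_bd i).
Proof.
move=> x; change (ctsat (fun y => `|hsdq i 1 y| + `|hsdq i (-1) y|) x).
by apply: ctsatD; apply: ctsat_norm; exact: hsdq_continuous.
Qed.

(** Translation invariance moves the difference quotient from A to zeta, with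
    the opposite step; the correction t / 2 of the quotient vanishes in the
    limit. The sign of the steps is arbitrary, so Dp and Dm are both weak
    derivatives. *)
Lemma hsdq_weak i (u : nat -> R) (D : 'rV[R]_n -> R) (zeta : 'rV[R]_n -> R) :
  (forall k, u k != 0) -> (forall k, `|u k| <= 1) -> u k @[k --> \oo] --> 0 ->
  (forall x, hsdq i (u k) x @[k --> \oo] --> D x) ->
  C1 i zeta -> tame zeta ->
  tame (fun x => D x * zeta x) /\
  integ (fun x => D x * zeta x) = - integ (fun x => A x * pderive i zeta x).
Proof.
move=> u0 u1 uc cD cz tz; have [mz [C0 [M hM]]] := tz.
have mA : measurable_fun setT A by exact: continuous_measurable_row hsd_continuous.
have bA : loc_bounded A by exact: continuous_loc_bounded hsd_continuous.
have [C1 hC1] := continuous_loc_bounded (@hsd_bd_continuous i) M.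
have [tD cvgD'] : tame (fun x => D x * zeta x) /\
   integ (fun x => hsdq i (u k) x * zeta x) @[k --> \oo] --> integ (fun x => D x * zeta x).
  apply: (integ_cvg (C := `|C1| * C0) (M := M)).
  - by move=> k; apply: measurable_funM => //; exact: hsdq_measurable.
  - move=> k x; split; last by move=> /(hM x).2 ->; rewrite mulr0.
    have [xM|xM] := leP `|x| M; last first.
      rewrite (hM x).2// mulr0 normr0 mulr_ge0//.
      exact: le_trans (normr_ge0 _) (hM x).1.
    rewrite normrM ler_pM//; last exact: (hM x).1.
    apply: le_trans (hsdq_bd i x (u0 k) (u1 k)) _; apply: le_trans (ler_norm _) _.
    exact: le_trans (hC1 x xM) (ler_norm _).
  - by move=> x; apply: cvgM => //; exact: cvg_cst.
split => //.
pose F k x := A x * ((- u k)^-1 * (zeta (- u k *: e_ i + x) - zeta x)).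
have u0' k : - u k != 0 by rewrite oppr_eq0.
have uc' : - u k @[k --> \oo] --> 0 by rewrite -oppr0; apply: cvgN.
have tS k : tame (fun x => zeta (- u k *: e_ i + x)).
  by under eq_fun do rewrite addrC; exact: tame_shift.
have u1' k : `|- u k| <= 1 by rewrite normrN.
have [tF cvgF] := integ_quot_cvg mA bA cz tz u0' u1' uc'.
have E k : integ (fun x => hsdq i (u k) x * zeta x) = - integ (F k) - u k / 2 * integ zeta.
  pose B x := A (x + u k *: e_ i) * zeta x.
  have tB : tame B.
    apply: tameM => //.
      exact: (measurableT_comp mA (measurable_shift_row _)).
    by apply: continuous_loc_bounded => x; apply: ctsat_shift; exact: hsd_continuous.
  have tAz : tame (fun x => A x * zeta x) by exact: tameM.
  have tAS : tame (fun x => A x * zeta (- u k *: e_ i + x)) by exact: tameM.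
  have -> : (fun x => hsdq i (u k) x * zeta x) =
    (fun x => ((u k)^-1 * (B x - A x * zeta x)) - (u k / 2) * zeta x).
    by apply/funext => x; rewrite /B /hsdq; field; exact: u0.
  rewrite (integB (tameZ _ (tameB tB tAz)) (tameZ _ tz)).
  rewrite (integZ _ (tameB tB tAz)) (integZ _ tz) (integB tB tAz); congr (_ - _).
  have -> : F k = fun x => (- u k)^-1 * (A x * zeta (- u k *: e_ i + x) - A x * zeta x).
    by apply/funext => x; rewrite /F; ring.
  rewrite (integZ _ (tameB tAS tAz)) (integB tAS tAz).
  have -> : integ B = integ (fun x => A x * zeta (- u k *: e_ i + x)).
    rewrite -(integ_shift (- u k *: e_ i) tB); congr integ; apply/funext => x.
    by rewrite /B -addrA -scalerDl addNr scale0r addr0 (addrC x).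
  by rewrite invrN mulNr opprK.
have : (fun k => integ (fun x => hsdq i (u k) x * zeta x)) @ \oo -->
   - integ (fun x => A x * pderive i zeta x) - 0 / 2 * integ zeta.
  under eq_fun do rewrite E.
  apply: cvgB; first exact: cvgN.
  by apply: cvgM; [apply: cvgM => //; exact: cvg_cst|exact: cvg_cst].
rewrite mul0r mul0r subr0 => h; exact: cvg_unique cvgD' h.
Qed.

End halfsq.

(** * The weak Laplacian of half the squared distance *)

Lemma measurable_fun_invr {R : realType} {d} {T : measurableType d} (D : set T) (f : T -> R) :
  measurable_fun D f -> measurable_fun D (fun x => (f x)^-1).
Proof.
move=> mf; rewrite (_ : (fun x => _) = fun x => f x * (f x ^+ 2) `^ (-1)); last first.
  apply/funext => x; rewrite powR_inv1 ?sqr_ge0//.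
  by have [->|f0] := eqVneq (f x) 0; [rewrite mul0r invr0|rewrite expr2 invfM mulrA mulfV// mul1r].
apply: measurable_funM => //.
by apply: (measurableT_comp (measurable_powR _)); exact: measurable_funX.
Qed.

Section smooth_facts.
Context {R : realType} {n : nat}.
Implicit Types (f g u phi : 'rV[R]_n -> R) (i j : 'I_n) (U : set 'rV[R]_n).
Local Notation e_ i := (delta_mx ord0 i : 'rV[R]_n).

Lemma smooth_continuous f : smooth f -> continuous f.
Proof. by move=> /(_ [::]) []. Qed.

Lemma smooth_pderive i f : smooth f -> smooth (pderive i f).
Proof.
move=> h s; have := h (rcons s i).
by rewrite /pderives -cats1 foldr_cat.
Qed.

Lemma smooth_C1 i f : smooth f -> C1 i f.
Proof.
move=> h; split; first by move=> x; have [_] := h [::]; apply.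
exact: smooth_continuous (smooth_pderive i h).
Qed.

Lemma test_support U u : test_function U u -> exists M, forall x, M < `|x| -> u x = 0.
Proof.
move=> [_ /compact_bounded [M [_ hM]] _]; exists (M + 1) => x Mx.
apply/eqP; apply: contraTT Mx => ux; rewrite -leNgt; apply: (hM (M + 1)); first by rewrite ltrDl.
exact: subset_closure.
Qed.

Lemma near_zero_out u x : ~ closure [set x | u x != 0] x -> \forall y \near x, u y = 0.
Proof.
move=> h; have : nbhs x (~` closure [set x | u x != 0]).
  by apply: open_nbhs_nbhs; split => //; exact: closed_openC (@closed_closure _ _).
apply: filterS => y hy; apply/eqP; apply: contrapT => /negP uy; apply: hy.
exact: subset_closure.
Qed.

Lemma pderive_near0 i u x : (\forall y \near x, u y = 0) -> pderive i u x = 0.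
Proof.
by move=> h; rewrite /pderive (near_eq_derive (g := cst 0)) ?derive_cst.
Qed.

Lemma pderive_ge0_eq0 i f x : derivable f x (e_ i) -> (forall y, 0 <= f y) -> f x = 0 ->
  pderive i f x = 0.
Proof.
move=> /derivableP/is_derive_quotientP/cvgr_dnbhsP h f0 fx.
have h0 : hstep k @[k --> \oo] --> (0 : R) by exact: harmonic_cvg0.
have hn k : hstep k != 0 :> R by rewrite gt_eqF// hstep_gt0.
have hn' k : - hstep k != 0 :> R by rewrite oppr_eq0.
have h0' : - hstep k @[k --> \oo] --> (0 : R) by rewrite -oppr0; apply: cvgN.
have c1 := h _ (conj hn h0); have c2 := h _ (conj hn' h0').
apply/eqP; rewrite eq_le; apply/andP; split.
  rewrite /pderive -(cvg_lim _ c2)//; apply: limr_le; first by apply/cvg_ex; eexists; exact: c2.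
  apply: nearW => k; rewrite fx subr0 invrN mulNr oppr_le0; apply: mulr_ge0; last exact: f0.
  by rewrite invr_ge0 ltW// hstep_gt0.
rewrite /pderive -(cvg_lim _ c1)//; apply: limr_ge; first by apply/cvg_ex; eexists; exact: c1.
by apply: nearW => k; rewrite fx subr0 mulr_ge0// invr_ge0 ltW// hstep_gt0.
Qed.

Lemma derive_not_derivable f x (v : 'rV[R]_n) : ~ derivable f x v -> 'D_v f x = 0.
Proof. by move=> h; rewrite /derive dvgP. Qed.

End smooth_facts.

Section weak_laplacian.
Context {R : realType} {n : nat}.
Variable K : set 'rV[R]_n.
Hypothesis K0 : K !=set0.
Hypothesis cK : closed K.
Local Notation d := (eudist K).
Local Notation A := (hsd K).
Local Notation mu := (@lebesgue_rV R n).
Local Notation e_ i := (delta_mx ord0 i : 'rV[R]_n).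
Local Notation Dp := (Dp K).
Local Notation Dm := (Dm K).

Lemma eudist_sqrt x : d x = Num.sqrt (2 * A x).
Proof.
by rewrite /hsd mulrC divfK// sqrtr_sqr ger0_norm// eudist_ge0.
Qed.

(** Where the one-sided derivatives of A agree, d = sqrt (2 A) is
    differentiable off K and the chain rule applies. Where they differ, d has
    no derivative, and the total derivative takes its default value 0. *)
Lemma grad_dot_component i x phi : ~ K x -> derivable phi x (e_ i) ->
  pderive i d x * pderive i (fun y => d y * phi y) x =
  if Dp i x == Dm i x then Dp i x ^+ 2 / d x ^+ 2 * phi x + Dp i x * pderive i phi x else 0.
Proof.
move=> Kx dphi; have d0 := eudist_gt0 K0 cK Kx.
case: eqP => E.
  have dA := Dp_is_derive K0 cK E.
  have A0 : 0 < 2 * A x by rewrite /hsd mulrC divfK// exprn_gt0.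
  have dd : is_derive x (e_ i) d (Dp i x / d x).
    have -> : d = fun y => Num.sqrt (2 * A y) by apply/funext => y; exact: eudist_sqrt.
    have h2 : is_derive x (e_ i) (fun y => 2 * A y) (2 * Dp i x).
      exact: (@is_deriveZ _ _ _ A 2 x (e_ i) (Dp i x)).
    have := is_derive_comp_line h2 (is_derive1_sqrt A0).
    rewrite -eudist_sqrt => h.
    have -> : Dp i x / d x = (2 * d x)^-1 * (2 * Dp i x) by field; rewrite gt_eqF.
    exact: h.
  have dp := @is_deriveM _ _ d phi x (e_ i) _ _ dd (derivableP dphi).
  have [_ e1] := dd; have [_ e2] := dp.
  rewrite /pderive e1 (_ : 'D_(e_ i) (fun y => d y * phi y) x = 'D_(e_ i) (d * phi) x)// e2.
  rewrite -![_ *: _]/(_ * _); field.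
  by rewrite gt_eqF.
rewrite [pderive i d x]derive_not_derivable ?mul0r//.
move=> /derivableP dd; apply: E.
have h := @is_deriveZ _ _ _ (d * d) (2^-1) x (e_ i) _ (@is_deriveM _ _ d d x (e_ i) _ _ dd dd).
have fg : \forall y \near x, (2^-1 *: (d * d)) y = A y.
  by apply: (@filterE _ (nbhs x)) => y; rewrite /hsd; change (2^-1 * (d y * d y) = d y ^+ 2 / 2); ring.
have hA := near_eq_is_derive fg h.
by have [-> ->] := is_derive_Dp hA.
Qed.

(** Both one-sided derivatives are weak derivatives of A, so the nonnegative
    function (Dm - Dp) phi has integral 0. *)
Lemma Dp_eq_Dm_ae phi : (forall i, C1 i phi) -> tame phi -> (forall x, 0 <= phi x) ->
  \forall x \ae mu, phi x != 0 -> forall i, Dp i x = Dm i x.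
Proof.
move=> cphi tphi phi0.
have key i : \forall x \ae mu, (Dm i x - Dp i x) * phi x = 0.
  have hn k : hstep k != 0 :> R by rewrite gt_eqF// hstep_gt0.
  have h0 : hstep k @[k --> \oo] --> (0 : R) by exact: harmonic_cvg0.
  have h1 k : `|hstep k| <= 1 :> R by rewrite gtr0_norm ?hstep_gt0// hstep_le1.
  have [t1 e1] := hsdq_weak K0 cK hn h1 h0 (fun x => @Dp_cvg _ _ _ K0 cK i x) (cphi i) tphi.
  have hn' k : - hstep k != 0 :> R by rewrite oppr_eq0.
  have h1' k : `|- hstep k| <= 1 :> R by rewrite normrN.
  have h0' : - hstep k @[k --> \oo] --> (0 : R) by rewrite -oppr0; apply: cvgN.
  have [t2 e2] := hsdq_weak K0 cK hn' h1' h0' (fun x => @Dm_cvg _ _ _ K0 cK i x) (cphi i) tphi.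
  have E : (fun x => (Dm i x - Dp i x) * phi x) = fun x => Dm i x * phi x - Dp i x * phi x.
    by apply/funext => x; rewrite mulrBl.
  apply: integ_eq0_ae.
  - by rewrite E; exact: tameB.
  - by move=> x; rewrite mulr_ge0// subr_ge0 Dp_le_Dm.
  - by rewrite E integB// e1 e2 subrr.
have : \forall x \ae mu, forall i : 'I_n, i \in enum 'I_n -> (Dm i x - Dp i x) * phi x = 0.
  elim: (enum 'I_n) => [|j s IH]; first by apply: aeW.
  apply: filterS2 (key j) IH => x hj hs i; rewrite in_cons => /orP[/eqP -> //|]; exact: hs.
apply: filterS => x h px i; have := h i (mem_enum _ i).
by move/eqP; rewrite mulf_eq0 (negbTE px) orbF subr_eq0 => /eqP.
Qed.

Lemma hsd_weak_grad i (zeta : 'rV[R]_n -> R) : C1 i zeta -> tame zeta ->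
  tame (fun x => Dp i x * zeta x) /\
  integ (fun x => Dp i x * zeta x) = - integ (fun x => A x * pderive i zeta x).
Proof.
move=> cz tz; apply: (hsdq_weak K0 cK (u := @hstep R)) => //.
- by move=> k; rewrite gt_eqF// hstep_gt0.
- by move=> k; rewrite gtr0_norm ?hstep_gt0// hstep_le1.
- exact: harmonic_cvg0.
- exact: Dp_cvg.
Qed.

(** From d grad d = grad A and |grad d| = 1 one expects d Lap d + 1 = Lap A,
    which turns the bound c - 1 for d Lap d into the bound c for Lap A.
    Precisely, grad d . grad (d phi) = phi + grad A . grad phi almost
    everywhere on the support of phi, and grad A is a weak gradient. *)
Lemma weak_laplacian_ge U (c : R) phi : open U -> (forall x, U x -> ~ K x) ->
  mul_laplacian_ge U d (c - 1) -> test_function U phi -> (forall x, 0 <= phi x) ->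
  c * integ phi <= integ (fun x => A x * laplacian phi x).
Proof.
move=> oU UK hd tphi phi0; have := hd phi tphi phi0.
have [sphi _ suppU] := tphi; have [M hM] := test_support tphi.
have mU : measurable U by exact: open_measurable_row.
have tp : tame phi by apply: continuous_tame hM; exact: smooth_continuous.
have tpi i : tame (pderive i phi).
  apply: continuous_tame (pderive_supp i hM); exact: smooth_continuous (smooth_pderive i sphi).
have cphi i : C1 i phi by exact: smooth_C1.
have out x : ~ U x -> phi x = 0 /\ forall i, pderive i phi x = 0.
  move=> Ux; have h : \forall y \near x, phi y = 0 by apply: near_zero_out => /suppU.
  by split; [exact: nbhs_singleton h|move=> i; exact: pderive_near0].
have IU : \int[mu]_(x in U) phi x = integ phi.
  rewrite Rintegral_mkcond; congr Rintegral; apply/funext => x.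
  by rewrite /restrict; case: ifPn => // /negP; rewrite inE => /out[->].
pose G x := \sum_i (if Dp i x == Dm i x then
   Dp i x ^+ 2 / d x ^+ 2 * phi x + Dp i x * pderive i phi x else 0).
pose g x := phi x + \sum_i Dp i x * pderive i phi x.
have md : measurable_fun setT d.
  by apply: continuous_measurable_row; exact: eudist_continuous.
have mG : measurable_fun setT G.
  apply: measurable_sum => i; apply: measurable_fun_ifT.
  - by apply: measurable_fun_eqr; [exact: Dp_measurable|exact: Dm_measurable].
  - apply: measurable_funD; apply: measurable_funM => //; last exact: (tpi i).1.
    + apply: measurable_funM; first by apply: measurable_funX; exact: Dp_measurable.
      by apply: measurable_fun_invr; exact: measurable_funX.
    + exact: tp.1.
    + exact: Dp_measurable.
  - exact: measurable_cst.
have dist : mul_laplacian_distr U d phi = - integ g.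
  rewrite /mul_laplacian_distr; congr (- _).
  transitivity (integ G).
    rewrite Rintegral_mkcond; congr Rintegral; apply/funext => x.
    rewrite /restrict; case: ifPn => [|/negP]; rewrite inE => Ux.
      rewrite /grad_dot /G; apply: eq_bigr => i _.
      by apply: grad_dot_component; [exact: UK|have [] := cphi i].
    have [p0 pi0] := out x Ux.
    by rewrite /G big1// => i _; rewrite p0 pi0 !mulr0 addr0; case: ifP.
  apply: integ_ae => //.
    apply: measurable_funD; first exact: tp.1.
    by apply: measurable_sum => i; apply: measurable_funM; [exact: Dp_measurable|exact: (tpi i).1].
  apply: filterS (Dp_eq_Dm_ae cphi tp phi0) => x hx.
  rewrite /G /g; have [p0|p0] := eqVneq (phi x) 0.
    rewrite p0 big1 => [|i _].
      by rewrite add0r big1// => i _; rewrite (pderive_ge0_eq0 ((cphi i).1 x) phi0 p0) mulr0.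
    rewrite (pderive_ge0_eq0 ((cphi i).1 x) phi0 p0) !mulr0 addr0; by case: ifP.
  have E := hx p0.
  have Ux : U x by apply: contrapT => /out[p00 _]; rewrite p00 eqxx in p0.
  have d0 := eudist_gt0 K0 cK (UK _ Ux).
  rewrite (eq_bigr (fun i => Dp i x ^+ 2 / d x ^+ 2 * phi x + Dp i x * pderive i phi x)); last first.
    by move=> i _; rewrite E eqxx.
  rewrite big_split /= -mulr_suml -mulr_suml (Dp_sqr K0 cK E); congr (_ + _).
  by rewrite /hsd mulrC; field; rewrite gt_eqF.
rewrite dist IU.
have tDi i : tame (fun x => Dp i x * pderive i phi x).
  exact: (hsd_weak_grad (smooth_C1 i (smooth_pderive i sphi)) (tpi i)).1.
have tAi i : tame (fun x => A x * pderive i (pderive i phi) x).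
  apply: tameM.
  - by apply: continuous_measurable_row; exact: hsd_continuous.
  - by apply: continuous_loc_bounded; exact: hsd_continuous.
  - apply: continuous_tame (pderive_supp i (pderive_supp i hM)).
    exact: smooth_continuous (smooth_pderive i (smooth_pderive i sphi)).
have -> : integ g = integ phi - integ (fun x => A x * laplacian phi x).
  rewrite /g integD//; last exact: tame_sum.
  congr (_ + _); rewrite integ_sum//.
  have -> : (fun x => A x * laplacian phi x) =
      fun x => \sum_i A x * pderive i (pderive i phi) x.
    by apply/funext => x; rewrite /laplacian mulr_sumr.
  rewrite integ_sum// -sumrN; apply: eq_bigr => i _.
  exact: (hsd_weak_grad (smooth_C1 i (smooth_pderive i sphi)) (tpi i)).2.
lra.
Qed.

End weak_laplacian.

(** * Smooth functions and mollifiers *)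

Section smooth_closure.
Context {R : realType} {n : nat}.
Implicit Types (f g u : 'rV[R]_n -> R) (i j : 'I_n) (s : seq 'I_n) (x y z v : 'rV[R]_n).
Local Notation e_ i := (delta_mx ord0 i : 'rV[R]_n).

(** Derivatives of a product are sums of products, so closure under products
    is proved by induction on an order of differentiation, for all pairs of
    factors at once. *)
Definition smooth_upto m f := forall s, (size s <= m)%N ->
  continuous (pderives s f) /\ forall i x, derivable (pderives s f) x (e_ i).

Lemma smooth_upto_all f : (forall m, smooth_upto m f) -> smooth f.
Proof. by move=> h s; exact: (h (size s)). Qed.

Lemma smooth_uptoS m f : smooth_upto 0 f -> (forall i, smooth_upto m (pderive i f)) ->
  smooth_upto m.+1 f.
Proof.
move=> h0 h s; elim/last_ind: s => [_|s i _]; first exact: (h0 [::]).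
rewrite size_rcons ltnS => sm; have := h i s sm.
by rewrite /pderives -cats1 foldr_cat.
Qed.

Lemma smooth_uptoD m f g : smooth_upto m f -> smooth_upto m g ->
  smooth_upto m (fun x => f x + g x).
Proof.
move=> hf hg.
have E s : (size s <= m)%N ->
    pderives s (fun x => f x + g x) = fun x => pderives s f x + pderives s g x.
  elim: s => //= i s IH sm; rewrite IH ?(ltnW sm)//; apply/funext => x.
  have [_ df] := hf s (ltnW sm); have [_ dg] := hg s (ltnW sm).
  exact: (deriveD (df i x) (dg i x)).
move=> s sm; rewrite E//; have [cf df] := hf s sm; have [cg dg] := hg s sm.
split; first by move=> x; apply: ctsatD; [exact: cf|exact: cg].
by move=> i x; exact: (derivableD (df i x) (dg i x)).
Qed.

Lemma smooth_uptoM m f g : smooth f -> smooth g -> smooth_upto m (fun x => f x * g x).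
Proof.
elim: m f g => [|m IH] f g sf sg.
  move=> s; rewrite leqn0 size_eq0 => /eqP -> /=.
  split; first by move=> x; apply: ctsatM; exact: smooth_continuous.
  by move=> i x; exact: (derivableM ((smooth_C1 i sf).1 x) ((smooth_C1 i sg).1 x)).
apply: smooth_uptoS.
  move=> s; rewrite leqn0 size_eq0 => /eqP -> /=.
  split; first by move=> x; apply: ctsatM; exact: smooth_continuous.
  by move=> i x; exact: (derivableM ((smooth_C1 i sf).1 x) ((smooth_C1 i sg).1 x)).
move=> i.
have -> : pderive i (fun x => f x * g x) =
    fun x => f x * pderive i g x + g x * pderive i f x.
  by apply/funext => x; exact: (deriveM ((smooth_C1 i sf).1 x) ((smooth_C1 i sg).1 x)).
exact: smooth_uptoD (IH _ _ sf (smooth_pderive i sg)) (IH _ _ sg (smooth_pderive i sf)).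
Qed.

Lemma smoothM f g : smooth f -> smooth g -> smooth (fun x => f x * g x).
Proof. by move=> sf sg; apply: smooth_upto_all => m; exact: smooth_uptoM. Qed.

Lemma smooth_cst (c : R) : smooth ((fun=> c) : 'rV[R]_n -> R).
Proof.
move=> s; have [b ->] : exists b, pderives s ((fun=> c) : 'rV[R]_n -> R) = fun=> b.
  elim: s => [|i s [b IH]]; first by exists c.
  by exists 0; rewrite /= IH; apply/funext => x; exact: derive_cst.
by split; [move=> x; exact: cst_continuous|move=> i x; exact: derivable_cst].
Qed.

Lemma is_derive_affine f (a : R) v x i (l : R) : is_derive (a *: x + v) (e_ i) f l ->
  is_derive x (e_ i) (fun z => f (a *: z + v)) (a * l).
Proof.
move=> h; have E : 0 *: e_ i + x = x by rewrite scale0r add0r.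
rewrite -{1}E; apply: (proj2 (is_derive_lineP (fun z => f (a *: z + v)) x (e_ i) 0 _)).
have -> : (fun s : R => f (a *: (s *: e_ i + x) + v)) =
   (fun s : R => f (s *: e_ i + (a *: x + v))) \o (fun s : R => a * s).
  by apply/funext => s /=; rewrite scalerDr scalerA addrA.
rewrite mulrC; apply: is_derive1_comp.
  apply: (proj1 (is_derive_lineP f (a *: x + v) (e_ i) _ _)).
  by rewrite mulr0 scale0r add0r.
have := @is_deriveZ R R^o R^o id a 0 1 1 (is_derive_id _ _).
by rewrite -[a *: 1]/(a * 1) mulr1.
Qed.

Lemma smooth_affine f (a : R) v : smooth f -> smooth (fun z => f (a *: z + v)).
Proof.
move=> sf s.
have E : pderives s (fun z => f (a *: z + v)) = fun z => a ^+ size s * pderives s f (a *: z + v).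
  elim: s => [|i s IH]; first by apply/funext => z; rewrite expr0 mul1r.
  rewrite /= IH; apply/funext => z.
  have [_ /(_ i (a *: z + v))/derivableP d] := sf s.
  have := @is_deriveZ _ _ _ (fun z => pderives s f (a *: z + v)) (a ^+ size s) z (e_ i) _ (is_derive_affine d).
  move=> [_ e]; rewrite /pderive e exprSr -mulrA; by [].
rewrite E; have [c d] := sf s; split.
  move=> x; change (ctsat (fun z => a ^+ size s * pderives s f (a *: z + v)) x).
  by apply: (@ctsatM _ _ (fun=> a ^+ size s)); [exact: ctsat_cst|apply: ctsat_affine; exact: c].
move=> i x; have /derivableP dx := d i (a *: x + v).
have [+ _] := @is_deriveZ _ _ _ (fun z => pderives s f (a *: z + v)) (a ^+ size s) x (e_ i) _ (is_derive_affine dx).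
by [].
Qed.

Lemma pderive_shift i f v : (forall x, derivable f x (e_ i)) ->
  pderive i (fun z => f (z + v)) = fun z => pderive i f (z + v).
Proof.
move=> df; apply/funext => x; have /derivableP d := df (1 *: x + v).
have [_] := is_derive_affine d; under eq_fun do rewrite scale1r.
by rewrite mul1r scale1r.
Qed.

Lemma smooth_shift f v : smooth f -> smooth (fun z => f (z + v)).
Proof. by move/(smooth_affine 1 v); under eq_fun do rewrite scale1r. Qed.

End smooth_closure.

Section mollifier.
Context {R : realType} {n : nat}.
Implicit Types (f g u : 'rV[R]_n -> R) (i j : 'I_n) (x y z v : 'rV[R]_n).
Local Notation mu := (@lebesgue_rV R n).

Definition mollifier (r : R) eta := [/\ smooth eta, forall z, 0 <= eta z,
  forall z, r < enorm z -> eta z = 0 & integ eta = 1].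

Lemma integ_gt0 f x0 : continuous f -> tame f -> (forall x, 0 <= f x) -> f x0 != 0 -> 0 < integ f.
Proof.
move=> cf tf f0 fx0; rewrite lt_neqAle integ_ge0// andbT eq_sym; apply/eqP => If.
have [N [mN N0 subN]] := integ_eq0_ae tf f0 If.
have fx0' : 0 < f x0 by rewrite lt_neqAle eq_sym fx0 f0.
have [r /= r0 hr] : nbhs_ball x0 [set x | 0 < f x].
  apply/nbhs_ballP; have h : nbhs (f x0) [set t : R | 0 < t].
    by apply: open_nbhs_nbhs; split; [exact: open_gt|exact: fx0'].
  exact: (cf x0 _ h).
pose B := [set x : 'rV[R]_n | forall i, `]x0 ord0 i - r, x0 ord0 i + r[%classic (x ord0 i)].
have BN : B `<=` N.
  move=> x Bx; apply: subN => /= fx; suff : 0 < f x by rewrite fx ltxx.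
  apply: hr; rewrite -ball_normE /ball_/=; apply/row_norm_ltP => // i.
  by have := Bx i; rewrite /= in_itv/= !mxE ltr_norml => /andP[? ?]; apply/andP; split; lra.
have mI i : measurable `]x0 ord0 i - r, x0 ord0 i + r[%classic by [].
have mB : measurable B.
  have -> : B = \bigcap_(i in setT) [set x : 'rV[R]_n | `]x0 ord0 i - r, x0 ord0 i + r[%classic (x ord0 i)].
    by apply/seteqP; split=> x h i => [_|]; apply: h.
  apply: fin_bigcap_measurable => // i _.
  by have := measurable_coord i measurableT (mI i); rewrite setTI.
have : (0 < mu B)%E.
  have -> : mu B = _ := @lebesgue_rV_box R n (fun i => `]x0 ord0 i - r, x0 ord0 i + r[%classic) mI.
  elim/big_ind : _ => [|a b a0 b0|i _]; [exact: lte01|exact: mule_gt0|].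
  by rewrite lebesgue_measure_itv/= lte_fin ifT ?lte_fin -?EFinD ?lte_fin; lra.
rewrite lt_neqAle => /andP[/eqP + _]; apply; apply/esym.
exact: subset_measure0 N0.
Qed.

(** A test function that does not vanish at x0 is itself a bump: centre it at
    x0, square it, shrink its support into the ball of radius r and normalize. *)
Lemma mollifier_exists U u x0 r : test_function U u -> u x0 != 0 -> 0 < r ->
  exists eta, mollifier r eta.
Proof.
move=> tu ux0 r0; have [su _ _] := tu; have [M hM] := test_support tu.
(* u vanishes outside the sup-norm ball of radius M, and sqrt n compares the
   sup norm with the Euclidean one; the final 1 makes a positive. *)
pose a : R := Num.sqrt n%:R * (`|M| + `|x0| + 1) / r + 1.
have s0 : 0 <= Num.sqrt n%:R :> R by exact: sqrtr_ge0.
have a0 : 0 < a by rewrite /a ltr_wpDl// divr_ge0// ?mulr_ge0// ltW.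
pose w z := u (a *: z + x0); pose w2 z := w z * w z.
have sw2 : smooth w2 by apply: smoothM; exact: smooth_affine.
have supp z : r < enorm z -> w2 z = 0.
  move=> rz; rewrite /w2 /w hM ?mul0r//.
  have h1 : r < Num.sqrt n%:R * `|z| by apply: lt_le_trans rz (enorm_le_norm _).
  have h2 : a * `|z| <= `|a *: z + x0| + `|x0|.
    rewrite -{1}(gtr0_norm a0) -normrZ -{1}(addrK x0 (a *: z)); exact: ler_normB.
  have h3 : Num.sqrt n%:R * (`|M| + `|x0| + 1) / r * `|z| <= a * `|z|.
    by rewrite ler_wpM2r// /a lerDl.
  have h4 : `|M| + `|x0| + 1 <= Num.sqrt n%:R * (`|M| + `|x0| + 1) / r * `|z|.
    have -> : Num.sqrt n%:R * (`|M| + `|x0| + 1) / r * `|z| =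
      (`|M| + `|x0| + 1) * ((Num.sqrt n%:R * `|z|) / r) by ring.
    rewrite ler_peMr// ?addr_ge0//; by rewrite ler_pdivlMr// mul1r ltW.
  have h5 := ler_norm M; lra.
have supp' z : r < `|z| -> w2 z = 0 by move=> h; apply: supp; apply: lt_le_trans h (norm_le_enorm _).
have tw : tame w2 by apply: continuous_tame supp'; exact: smooth_continuous.
have c0 : 0 < integ w2.
  apply: (integ_gt0 (x0 := 0)) => //; first exact: smooth_continuous.
    by move=> z; rewrite /w2 -expr2 sqr_ge0.
  by rewrite /w2 /w scaler0 add0r mulf_neq0.
exists (fun z => (integ w2)^-1 * w2 z); split.
- exact: (smoothM (smooth_cst _) sw2).
- by move=> z; rewrite mulr_ge0 ?invr_ge0 ?(ltW c0)// /w2 -expr2 sqr_ge0.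
- by move=> z /supp ->; rewrite mulr0.
- by rewrite integZ// mulVf// gt_eqF.
Qed.

End mollifier.

(** * Mollification of half the squared distance *)

Section mollified.
Context {R : realType} {n : nat}.
Variable K : set 'rV[R]_n.
Hypothesis K0 : K !=set0.
Hypothesis cK : closed K.
Implicit Types (f g u zeta : 'rV[R]_n -> R) (i j : 'I_n) (x y z v : 'rV[R]_n).
Local Notation e_ i := (delta_mx ord0 i : 'rV[R]_n).
Local Notation d := (eudist K).
Local Notation A := (hsd K).

(** The point x enters through zeta only, so that all derivatives fall on
    zeta. *)
Definition moll zeta x : R := integ (fun y => A y * zeta (y - x)).

Let mA : measurable_fun setT A.
Proof. by apply: continuous_measurable_row; exact: hsd_continuous. Qed.

Let bA : loc_bounded A.
Proof. by apply: continuous_loc_bounded; exact: hsd_continuous. Qed.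

Lemma tame_moll zeta x : tame zeta -> tame (fun y => A y * zeta (y - x)).
Proof. by move=> tz; apply: tameM => //; exact: tame_shift. Qed.

Lemma moll_shift zeta x : tame zeta -> moll zeta x = integ (fun z => A (z + x) * zeta z).
Proof.
move=> tz; rewrite /moll -(integ_shift x (tame_moll x tz)); congr integ.
by apply/funext => z; rewrite addrK.
Qed.

Lemma tame_moll_shift zeta x : tame zeta -> tame (fun z => A (z + x) * zeta z).
Proof.
move=> tz; have := tame_shift x (tame_moll x tz).
by congr tame; apply/funext => z; rewrite addrK.
Qed.

Lemma tame_norm zeta : tame zeta -> tame (fun x => `|zeta x|).
Proof.
move=> [mz [C [M h]]]; split; first exact: measurableT_comp.
exists C, M => x; rewrite normr_id; split; first exact: (h x).1.
by move=> /(h x).2 ->; rewrite normr0.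
Qed.

Lemma moll_continuous zeta : tame zeta -> continuous (moll zeta).
Proof.
move=> tz x; have [mz [C0 [M hM]]] := tz.
have [C hC] := continuous_loc_bounded (@eudist_continuous _ _ _ K0 cK) (`|M| + `|x|).
pose B := (`|C| + 1) * integ (fun z => `|zeta z|) + 1.
have I0 : 0 <= integ (fun z => `|zeta z|) by apply: integ_ge0.
have B0 : 0 < B by rewrite /B ltr_wpDl// mulr_ge0// addr_ge0.
apply: row_continuousP => e e0.
have e'0 : 0 < Num.min 1 (e / B) by rewrite lt_min ltr01 divr_gt0.
have [a a0 ha] := enorm_le_near x e'0; exists a => // y /ha.
set dl := enorm (x - y); rewrite le_min => /andP[dl1 dle].
rewrite !moll_shift// -integB; [|exact: tame_moll_shift|exact: tame_moll_shift].
have dl0 : 0 <= dl by exact: enorm_ge0.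
have key z : `|A (z + x) * zeta z - A (z + y) * zeta z| <= (dl * (`|C| + 1)) * `|zeta z|.
  rewrite -mulrBl normrM; have [zM|zM] := leP `|z| M; last first.
    by rewrite (hM z).2// normr0 !mulr0.
  rewrite ler_wpM2r//.
  have h1 : d (z + x) <= `|C|.
    apply: le_trans (ler_norm _) _; apply: le_trans (hC _ _) (ler_norm _).
    apply: le_trans (ler_normD _ _) _; rewrite lerD2r; exact: le_trans zM (ler_norm _).
  have h2 : d (z + y) <= d (z + x) + dl.
    have := eudist_lip K0 cK (z + x) (y - x); rewrite -enormN opprB -/dl.
    by rewrite -addrA (addrC x) subrK.
  have h3 : d (z + x) - dl <= d (z + y).
    have := eudist_lip_ge K0 cK (z + x) (y - x); rewrite -enormN opprB -/dl.
    by rewrite -addrA (addrC x) subrK.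
  have p1 := eudist_ge0 K0 cK (z + x); have p2 := eudist_ge0 K0 cK (z + y).
  have n0 := normr_ge0 C.
  rewrite /hsd ler_norml; apply/andP; split; nra.
have tD : tame (fun z => A (z + x) * zeta z - A (z + y) * zeta z).
  by apply: tameB; exact: tame_moll_shift.
have tN : tame (fun z => (dl * (`|C| + 1)) * `|zeta z|) by apply: tameZ; exact: tame_norm.
have h : `|integ (fun z => A (z + x) * zeta z - A (z + y) * zeta z)| <= dl * (`|C| + 1) * integ (fun z => `|zeta z|).
  rewrite -integZ; last exact: tame_norm.
  rewrite ler_norml; apply/andP; split.
    rewrite -integN//; apply: integ_le => //; first exact: tameN.
    by move=> z; have := key z; rewrite ler_norml => /andP[].
  by apply: integ_le => // z; have := key z; rewrite ler_norml => /andP[].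
apply: le_trans h _; rewrite ler_pdivlMr// in dle.
rewrite -mulrA; apply: le_trans dle; rewrite ler_wpM2l// /B lerDl//.
Qed.

Lemma C1_shift i zeta v : C1 i zeta -> C1 i (fun z => zeta (z + v)).
Proof.
move=> [dz cz]; split.
  move=> x; have /derivableP h := dz (1 *: x + v).
  have [h' _] := is_derive_affine h; move: h'.
  by under eq_fun do rewrite scale1r.
by rewrite pderive_shift// => x; apply: ctsat_shift; exact: cz.
Qed.

Lemma moll_is_derive i zeta x : C1 i zeta -> tame zeta ->
  is_derive x (e_ i) (moll zeta) (- moll (pderive i zeta) x).
Proof.
move=> cz tz; apply/is_derive_quotientP; apply/cvgr_dnbhsP => u [u0 uc].
pose w k := if `|u k| <= 1 then u k else 1.
have uw : \forall k \near \oo, u k = w k.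
  have := uc; move/cvgrPdist_lt => /(_ _ ltr01); apply: filterS => k.
  by rewrite sub0r normrN /w => /ltW ->.
have w0 k : - w k != 0 by rewrite oppr_eq0 /w; case: ifP.
have w1 k : `|- w k| <= 1 by rewrite normrN /w; case: ifP => //; rewrite normr1.
have wc : - w k @[k --> \oo] --> 0.
  rewrite -oppr0; apply: cvgN; apply: cvg_trans uc; apply: near_eq_cvg.
  by apply: filterS uw => k ->.
have tzx : tame (fun y => zeta (y - x)) by exact: tame_shift.
have [tQ cQ] := integ_quot_cvg mA bA (C1_shift (- x) cz) tzx w0 w1 wc.
have -> : moll (pderive i zeta) x = integ (fun y => A y * pderive i (fun y => zeta (y - x)) y).
  by rewrite /moll pderive_shift//; exact: cz.1.
have cN : - integ (fun y => A y * ((- w k)^-1 * (zeta (- w k *: e_ i + y - x) - zeta (y - x)))) @[k --> \oo] -->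
    - integ (fun y => A y * pderive i (fun y => zeta (y - x)) y) by exact: cvgN.
apply: cvg_trans cN; apply: near_eq_cvg.
apply: filterS uw => k uk; rewrite uk -(integN (tQ k)).
rewrite /moll -integB; [|exact: tame_moll|exact: tame_moll].
rewrite -integZ; last by apply: tameB; exact: tame_moll.
congr integ; apply/funext => y.
have -> : y - (w k *: e_ i + x) = - w k *: e_ i + y - x.
  by rewrite opprD addrA scaleNr; congr (_ - _); rewrite addrC.
by rewrite invrN; ring.
Qed.

Lemma tame_pderive i zeta : smooth zeta -> tame zeta -> tame (pderive i zeta).
Proof.
move=> sz [mz [C [M h]]]; apply: (continuous_tame (M := M)).
  exact: smooth_continuous (smooth_pderive i sz).
by apply: pderive_supp => x; exact: (h x).2.
Qed.

Variables (r : R) (eta : 'rV[R]_n -> R).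
Hypothesis heta : mollifier r eta.

Let seta : smooth eta. Proof. by have [] := heta. Qed.
Let eta0 z : 0 <= eta z. Proof. by have [] := heta. Qed.
Let eta_supp z : r < enorm z -> eta z = 0. Proof. by have [_ _ h _] := heta; exact: h. Qed.
Let eta1 : integ eta = 1. Proof. by have [] := heta. Qed.
Let teta : tame eta.
Proof.
apply: (continuous_tame (M := r)); first exact: smooth_continuous.
by move=> x h; apply: eta_supp; apply: lt_le_trans h (norm_le_enorm _).
Qed.

Definition hsd_moll := moll eta.

Lemma hsd_moll_pderive i : pderive i hsd_moll = fun x => - moll (pderive i eta) x.
Proof. by apply/funext => x; have [] := moll_is_derive x (smooth_C1 i seta) teta. Qed.

Lemma hsd_moll_C1 i : C1 i hsd_moll.
Proof.
split; first by move=> x; have [] := moll_is_derive x (smooth_C1 i seta) teta.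
rewrite hsd_moll_pderive => x; apply: ctsatN; apply: moll_continuous; exact: tame_pderive.
Qed.

Lemma hsd_moll_continuous : continuous hsd_moll.
Proof. exact: moll_continuous. Qed.

Lemma hsd_moll_pderive2_is_derive i x :
  is_derive x (e_ i) (pderive i hsd_moll) (moll (pderive i (pderive i eta)) x).
Proof.
rewrite hsd_moll_pderive.
have h := moll_is_derive x (smooth_C1 i (smooth_pderive i seta)) (tame_pderive i seta teta).
by have := @is_deriveN _ _ _ _ _ _ _ h; rewrite opprK.
Qed.

Lemma hsd_moll_pderive2 i : pderive i (pderive i hsd_moll) = moll (pderive i (pderive i eta)).
Proof. by apply/funext => x; have [] := hsd_moll_pderive2_is_derive i x. Qed.

Lemma hsd_moll_C2 i : C1 i (pderive i hsd_moll).
Proof.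
split; first by move=> x; have [] := hsd_moll_pderive2_is_derive i x.
rewrite hsd_moll_pderive2; apply: moll_continuous.
by apply: tame_pderive; [exact: smooth_pderive|exact: tame_pderive].
Qed.

Lemma hsd_moll_upper x : hsd_moll x <= (d x + r) ^+ 2 / 2.
Proof.
have -> : (d x + r) ^+ 2 / 2 = integ (fun z => (d x + r) ^+ 2 / 2 * eta z).
  by rewrite integZ// eta1 mulr1.
rewrite /hsd_moll moll_shift//; apply: integ_le.
- exact: tame_moll_shift.
- exact: tameZ.
move=> z; have [zr|zr] := leP (enorm z) r; last by rewrite eta_supp// !mulr0.
rewrite ler_wpM2r// /hsd ler_pM2r// (addrC z).
have := eudist_lip K0 cK x z; have := eudist_ge0 K0 cK (x + z).
have := eudist_ge0 K0 cK x; have := enorm_ge0 z; nra.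
Qed.

Lemma hsd_moll_lower x : r <= d x -> (d x - r) ^+ 2 / 2 <= hsd_moll x.
Proof.
move=> rd; have -> : (d x - r) ^+ 2 / 2 = integ (fun z => (d x - r) ^+ 2 / 2 * eta z).
  by rewrite integZ// eta1 mulr1.
rewrite /hsd_moll moll_shift//; apply: integ_le.
- exact: tameZ.
- exact: tame_moll_shift.
move=> z; have [zr|zr] := leP (enorm z) r; last by rewrite eta_supp// !mulr0.
rewrite ler_wpM2r// /hsd ler_pM2r// (addrC z).
rewrite ler_pXn2r ?nnegrE ?subr_ge0 ?eudist_ge0//.
by have := eudist_lip_ge K0 cK x z; lra.
Qed.

(** Jensen's inequality for |grad A|^2 = 2 A. If c is the gradient of the
    mollification at x, then |c|^2 is the average of c . grad A, which is at
    most |c|^2 / 2 + A almost everywhere; the average of the latter is |c|^2 /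
    2 + A_r (x). *)
Lemma hsd_moll_grad x : \sum_i pderive i hsd_moll x ^+ 2 <= 2 * hsd_moll x.
Proof.
pose zeta y := eta (y - x); pose c i := pderive i hsd_moll x.
have tz : tame zeta by exact: tame_shift.
have cz i : C1 i zeta by apply: C1_shift; exact: smooth_C1.
have cE i : c i = integ (fun y => Dp K i y * zeta y).
  rewrite (hsd_weak_grad K0 cK (cz i) tz).2 /c hsd_moll_pderive /moll; congr (- integ _).
  apply/funext => y; rewrite pderive_shift//; exact: (smooth_C1 i seta).1.
have tDi i : tame (fun y => Dp K i y * zeta y) by exact: (hsd_weak_grad K0 cK (cz i) tz).1.
have z1 : integ zeta = 1 by rewrite /zeta integ_shift.
have E : \sum_i c i ^+ 2 = integ (fun y => \sum_i c i * (Dp K i y * zeta y)).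
  rewrite integ_sum; last by move=> i; exact: tameZ.
  by apply: eq_bigr => i _; rewrite integZ// -cE expr2.
pose S := \sum_i c i ^+ 2.
have tA : tame (fun y => A y * zeta y) by exact: tameM.
have tR : tame (fun y => S / 2 * zeta y + A y * zeta y) by apply: tameD => //; exact: tameZ.
have tL : tame (fun y => \sum_i c i * (Dp K i y * zeta y)).
  by apply: tame_sum => i; exact: tameZ.
have le : integ (fun y => \sum_i c i * (Dp K i y * zeta y)) <= integ (fun y => S / 2 * zeta y + A y * zeta y).
  pose L y := \sum_i c i * (Dp K i y * zeta y).
  pose Rt y := S / 2 * zeta y + A y * zeta y.
  have tm : tame (fun y => Num.max (L y - Rt y) 0) by apply: tame_pos; exact: tameB.
  rewrite -subr_le0 -integB//.
  apply: (@le_trans _ _ (integ (fun y => Num.max (L y - Rt y) 0))).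
    by apply: integ_le => //; [exact: tameB|move=> y; rewrite le_max lexx].
  rewrite le_eqVlt; apply/orP; left; apply/eqP; rewrite -[RHS](@integ_zero R n).
  apply: integ_ae; [exact: tm.1|exact: measurable_cst|].
  have ez0 y : 0 <= zeta y by exact: eta0.
  apply: filterS (Dp_eq_Dm_ae K0 cK cz tz ez0) => y hy.
  apply: max_r; rewrite subr_le0 /L /Rt.
  have [zy|zy] := eqVneq (zeta y) 0.
    by rewrite zy !mulr0 addr0 big1// => i _; rewrite !mulr0.
  rewrite -mulrDl.
  rewrite (eq_bigr (fun i => c i * Dp K i y * zeta y)); last by move=> i _; rewrite mulrA.
  rewrite -mulr_suml ler_wpM2r//.
  have := Dp_sqr K0 cK (hy zy) => hA.
  have -> : A y = (\sum_i Dp K i y ^+ 2) / 2 by rewrite hA mulrC mulKf.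
  rewrite /S -mulrDl -big_split mulr_suml; apply: ler_sum => i _ /=.
  rewrite ler_pdivlMr//; have := sqr_ge0 (c i - Dp K i y); lra.
rewrite -[leLHS]/S.
have : S <= S / 2 * 1 + hsd_moll x.
  by rewrite {1}/S E; apply: le_trans le _; rewrite integD// ?integZ// ?z1//; exact: tameZ.
lra.
Qed.

(** The Laplacian at x is the integral of A against the Laplacian of the
    mollifier centred at x, which is a test function on U. *)
Lemma hsd_moll_laplacian U (c : R) x : open U -> (forall x, U x -> ~ K x) ->
  mul_laplacian_ge U d (c - 1) -> (forall z, enorm z <= r -> U (x + z)) ->
  c <= laplacian hsd_moll x.
Proof.
move=> oU UK hd hU.
pose zeta y := eta (y - x).
pose B := [set y | enorm (y - x) <= r].
have cB : closed B.
  apply: (@preimage_closed _ _ (fun y => enorm (y - x)) [set t | t <= r]); last exact: closed_le.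
  by move=> y _; apply: ctsat_shift; exact: enorm_continuous.
have suppB : [set y | zeta y != 0] `<=` B.
  move=> y /=; rewrite /B /=; apply: contraNT; rewrite -ltNge => h; by rewrite /zeta eta_supp.
have suppC : closure [set y | zeta y != 0] `<=` B.
  by have := closureS suppB; rewrite -(proj1 (closure_id _) cB).
have sz : smooth zeta by exact: smooth_shift.
have tz : tame zeta by exact: tame_shift.
have test : test_function U zeta.
  split => //.
    apply: (subclosed_compact _ (@compact_row_ball _ _ (`|x| + r))).
      exact: closed_closure.
    move=> y /suppC h /=; rewrite -(subrK x y) addrC.
    apply: le_trans (ler_normD _ _) _; rewrite lerD2l.
    exact: le_trans (norm_le_enorm _) h.
  by move=> y /suppC h; rewrite -(subrK x y) addrC; exact: hU.
have := weak_laplacian_ge K0 cK oU UK hd test (fun y => eta0 _).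
rewrite /zeta integ_shift// eta1 mulr1; congr (_ <= _).
have -> : laplacian hsd_moll x = \sum_i integ (fun y => A y * pderive i (pderive i eta) (y - x)).
  by apply: eq_bigr => i _; rewrite hsd_moll_pderive2.
rewrite -integ_sum; last first.
  by move=> i; apply: tame_moll; apply: tame_pderive; [exact: smooth_pderive|exact: tame_pderive].
congr integ; apply/funext => y; rewrite /laplacian mulr_sumr; apply: eq_bigr => i _.
rewrite pderive_shift; last exact: (smooth_C1 i seta).1.
by rewrite pderive_shift//; exact: (smooth_C1 i (smooth_pderive i seta)).1.
Qed.

End mollified.

(** * The pointwise inequality *)

Lemma powRD_gt0 {R : realType} (x r s : R) : 0 < x -> x `^ (r + s) = x `^ r * x `^ s.
Proof. by move=> x0; rewrite powRD// (gt_eqF x0) implybT. Qed.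

Section regularized_power.
Context {R : realType}.
Variables (p e : R).
Hypothesis p1 : 1 < p.
Hypothesis e0 : 0 < e.
Local Notation p' := (p / (p - 1)).

Implicit Type s : R.
(** rS regularizes |s|^p, which for p < 2 is not twice differentiable at 0.
    Its derivative is p rbeta, where rbeta regularizes |s|^(p-2) s, and rbeta1
    is the derivative of rbeta. *)
Definition rq (s : R) := s ^+ 2 + e ^+ 2.
Definition rS s := rq s `^ (p / 2).
(** Subtracting the value at 0 makes rw vanish there, so that it preserves
    compact supports under composition. *)
Definition rw s := rS s - e `^ p.
Definition rbeta s := s * rq s `^ (p / 2 - 1).
Definition rbeta1 s := rq s `^ (p / 2 - 2) * ((p - 1) * s ^+ 2 + e ^+ 2).

Lemma rq_gt0 s : 0 < rq s.
Proof. by rewrite /rq ltr_wpDl ?sqr_ge0// exprn_gt0. Qed.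

Let p0 : 0 < p. Proof. exact: lt_trans p1. Qed.

Let is_derive_rq s : is_derive s (1 : R) rq (2 * s).
Proof.
have h : is_derive s (1 : R) id (1 : R) by exact: is_derive_id.
apply: (isd_eq (isdD (isdM h h) (isd_cst (e ^+ 2) _ _))).
by rewrite /=; ring.
Qed.

Lemma is_derive_rS s : is_derive s (1 : R) rS (p * rbeta s).
Proof.
apply: (isd_eq (is_derive_comp_line (is_derive_rq s) (is_derive1_powR (p / 2) (rq_gt0 s)))).
by rewrite /rbeta; field.
Qed.

Lemma is_derive_rw s : is_derive s (1 : R) rw (p * rbeta s).
Proof. by apply: (isd_eq (isdB (is_derive_rS s) (isd_cst (e `^ p) _ _))); rewrite subr0. Qed.

Lemma is_derive_rbeta s : is_derive s (1 : R) rbeta (rbeta1 s).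
Proof.
have hi : is_derive s (1 : R) id (1 : R) by exact: is_derive_id.
have h := is_derive_comp_line (is_derive_rq s) (is_derive1_powR (p / 2 - 1) (rq_gt0 s)).
apply: (isd_eq (isdM hi h)) => /=.
have -> : rq s `^ (p / 2 - 1) = rq s * rq s `^ (p / 2 - 2).
  rewrite -{2}(powRr1 (ltW (rq_gt0 s))) -powRD_gt0 ?rq_gt0//.
  by congr powR; ring.
have -> : p / 2 - 1 - 1 = p / 2 - 2 by ring.
by rewrite /rbeta1 {1}/rq; field.
Qed.

Lemma rbeta1_gt0 s : 0 < rbeta1 s.
Proof.
apply: mulr_gt0; first by rewrite powR_gt0// rq_gt0.
by rewrite ltr_wpDl ?exprn_gt0// mulr_ge0 ?sqr_ge0// subr_ge0 ltW.
Qed.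

Lemma rbeta0 : rbeta 0 = 0. Proof. by rewrite /rbeta mul0r. Qed.

Lemma rw0 : rw 0 = 0.
Proof.
by rewrite /rw /rS /rq expr0n add0r -powR_mulrn ?ltW// -powRrM mulrC divfK// subrr.
Qed.

Lemma rS_ge0 s : 0 <= rS s. Proof. exact: powR_ge0. Qed.

Lemma abs_le_sqrt_rq s : `|s| <= rq s `^ (2^-1).
Proof.
have q0 := ltW (rq_gt0 s); rewrite powR12_sqrt//.
rewrite -(ler_pXn2r (n := 2))// ?nnegrE ?sqrtr_ge0// sqr_sqrtr//.
by rewrite real_normK ?num_real// /rq lerDl sqr_ge0.
Qed.

Lemma rS_ge_powR s : `|s| `^ p <= rS s.
Proof.
rewrite /rS (mulrC p) powRrM; apply: (ge0_ler_powR (ltW p0)).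
- by rewrite nnegrE.
- by rewrite nnegrE powR_ge0.
- exact: abs_le_sqrt_rq.
Qed.

(** For e = 0 this is the equality of (p - 1) (|s|^(p-2) s)^2 and |s|^p times
    (p - 1) |s|^(p-2). *)
Lemma rbeta_sqr_le s : (p - 1) * rbeta s ^+ 2 <= rS s * rbeta1 s.
Proof.
rewrite /rS /rbeta1 /rbeta.
set Q := rq s `^ (p / 2 - 2).
have q0 := rq_gt0 s.
have E1 : rq s `^ (p / 2 - 1) = rq s * Q.
  rewrite -{2}(powRr1 (ltW q0)) -powRD_gt0//.
  by congr powR; ring.
have E2 : rq s `^ (p / 2) = rq s ^+ 2 * Q.
  rewrite -(powR_mulrn 2 (ltW q0)) -powRD_gt0//.
  by congr powR; ring.
rewrite E1 E2 -subr_ge0.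
have -> : rq s ^+ 2 * Q * (Q * ((p - 1) * s ^+ 2 + e ^+ 2)) - (p - 1) * (s * (rq s * Q)) ^+ 2 = (rq s * Q * e) ^+ 2 by ring.
exact: sqr_ge0.
Qed.

Lemma rbeta_conj_le s : `|rbeta s| `^ p' <= rS s.
Proof.
have q0 := rq_gt0 s; have pm : 0 < p - 1 by rewrite subr_gt0.
have h : `|rbeta s| <= rq s `^ ((p - 1) / 2).
  rewrite /rbeta normrM (ger0_norm (powR_ge0 _ _)).
  apply: le_trans (ler_wpM2r (powR_ge0 _ _) (abs_le_sqrt_rq s)) _.
  rewrite -powRD_gt0//.
  by rewrite le_eqVlt; apply/orP; left; apply/eqP; congr powR; field.
apply: le_trans (ge0_ler_powR _ _ _ h) _; rewrite ?nnegrE ?powR_ge0 ?normr_ge0//.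
  by rewrite divr_ge0// ltW.
rewrite -powRrM /rS le_eqVlt; apply/orP; left; apply/eqP; congr powR; field.
by rewrite gt_eqF.
Qed.

(** Young's inequality for the product of t and X, solved for |X|^p. *)
Lemma young_neg (t X : R) : - (p * t * X) - (p - 1) * `|t| `^ p' <= `|X| `^ p.
Proof.
have pm : 0 < p - 1 by rewrite subr_gt0.
have := @conjugate_powR R `|X| `|t| p p' (normr_ge0 _) (normr_ge0 _) p0 (divr_gt0 p0 pm).
have -> : p^-1 + p'^-1 = 1 by field; rewrite !gt_eqF.
move=> /(_ erefl); rewrite -normrM => h.
have h2 : p * `|X * t| <= `|X| `^ p + (p - 1) * `|t| `^ p'.
  have := ler_wpM2l (ltW p0) h.
  suff -> : p * (`|X| `^ p / p + `|t| `^ p' / p') = `|X| `^ p + (p - 1) * `|t| `^ p' by [].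
  by field; rewrite !gt_eqF.
have h3 : - (p * t * X) <= p * `|X * t|.
  by rewrite -mulrA -mulrN ler_wpM2l ?(ltW p0)// (mulrC X) -normrN ler_norm.
lra.
Qed.

End regularized_power.

Section pointwise.
Context {R : realType} {n : nat}.
Variables (p e k : R).
Hypothesis p1 : 1 < p.
Hypothesis e0 : 0 < e.
Local Notation p' := (p / (p - 1)).

(** The second summand on the right is the divergence of p f(a) beta(u) grad u
    + h(a) w(u) grad a at a point where u and a take the values s and a, for
    f' = - h - 2 (p - 1) g. The term with Lu is handled by Young's inequality,
    those with du by completing a square, the last one by the bounds on da and
    La. The second term on the left is the price of having w = S - e^p instead
    of S. *)
Lemma pointwise_ineq (s a f g h h1 W La Lu : R) (da du : 'I_n -> R) :
  0 < f -> 0 <= h -> h1 <= 0 -> 0 < a ->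
  \sum_i da i ^+ 2 <= 2 * a -> k <= La -> 0 <= W ->
  W <= 2 * a * h1 + k * h - (p - 1) * f `^ p' - 2 * p * (p - 1) * a * g ^+ 2 / f ->
  W * `|s| `^ p - e `^ p * (2 * a * h1 + k * h) <=
  `|Lu| `^ p +
    (- (2 * p * (p - 1) * g * rbeta p e s) * (\sum_i da i * du i)
     + p * f * rbeta1 p e s * (\sum_i du i ^+ 2) + p * f * rbeta p e s * Lu
     + rw p e s * (h1 * (\sum_i da i ^+ 2) + h * La)).
Proof.
move=> f0 h0 h10 a0 hda hLa W0 hW.
set b := rbeta p e s; set b1 := rbeta1 p e s; set S := rS p e s.
have pm : 0 < p - 1 by rewrite subr_gt0.
have p0 : 0 < p by exact: lt_trans p1.
have b10 : 0 < b1 by exact: rbeta1_gt0.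
have S0 : 0 <= S by exact: rS_ge0.
have Sp : `|s| `^ p <= S by exact: rS_ge_powR.
have wE : rw p e s = S - e `^ p by [].
have w0 : 0 <= rw p e s.
  rewrite wE subr_ge0 /S /rS.
  have -> : e `^ p = (e ^+ 2) `^ (p / 2) by rewrite -powR_mulrn ?ltW// -powRrM mulrC divfK.
  apply: ge0_ler_powR.
  - by rewrite divr_ge0// ltW.
  - by rewrite nnegrE sqr_ge0.
  - by rewrite nnegrE ltW// rq_gt0.
  - by rewrite /rq lerDr sqr_ge0.
have Y := young_neg p1 (f * b) Lu.
have Yb : `|f * b| `^ p' <= f `^ p' * S.
  rewrite normrM powRM// gtr0_norm// ler_wpM2l ?powR_ge0//; exact: rbeta_conj_le.
(* the square whose expansion has the cross term 2 p (p - 1) g b da . du; the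
   third summand is what must be added to complete it *)
have SQ : p * f * b1 * (\sum_i du i ^+ 2) - 2 * p * (p - 1) * g * b * (\sum_i da i * du i)
    + p * (p - 1) ^+ 2 * g ^+ 2 * b ^+ 2 / (f * b1) * (\sum_i da i ^+ 2) >= 0.
  have -> : p * f * b1 * (\sum_i du i ^+ 2) - 2 * p * (p - 1) * g * b * (\sum_i da i * du i)
    + p * (p - 1) ^+ 2 * g ^+ 2 * b ^+ 2 / (f * b1) * (\sum_i da i ^+ 2) =
    \sum_i p * f * b1 * (du i - (p - 1) * g * b / (f * b1) * da i) ^+ 2.
    rewrite !mulr_sumr -sumrB -big_split; apply: eq_bigr => i _ /=.
    by field; rewrite !gt_eqF.
  apply: sumr_ge0 => i _; apply: mulr_ge0; last exact: sqr_ge0.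
  exact: (mulr_ge0 (mulr_ge0 (ltW p0) (ltW f0)) (ltW b10)).
(* by |da|^2 <= 2 a, the added summand costs at most the last term of the
   bound on W *)
have B2 : p * (p - 1) ^+ 2 * g ^+ 2 * b ^+ 2 / (f * b1) * (\sum_i da i ^+ 2) <=
    2 * p * (p - 1) * a * g ^+ 2 / f * S.
  have c0 : 0 <= p * (p - 1) * g ^+ 2 / f.
    apply: divr_ge0 (ltW f0); apply: mulr_ge0 (sqr_ge0 _); apply/ltW; exact: mulr_gt0.
  have c1 : (p - 1) * b ^+ 2 / b1 <= S by rewrite ler_pdivrMr//; exact: rbeta_sqr_le.
  have c2 : 0 <= (p - 1) * b ^+ 2 / b1.
    exact: divr_ge0 (mulr_ge0 (ltW pm) (sqr_ge0 _)) (ltW b10).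
  have -> : p * (p - 1) ^+ 2 * g ^+ 2 * b ^+ 2 / (f * b1) * (\sum_i da i ^+ 2) =
    p * (p - 1) * g ^+ 2 / f * (((p - 1) * b ^+ 2 / b1) * (\sum_i da i ^+ 2)).
    by field; rewrite !gt_eqF.
  have -> : 2 * p * (p - 1) * a * g ^+ 2 / f * S = p * (p - 1) * g ^+ 2 / f * (S * (2 * a)).
    by field; rewrite !gt_eqF.
  rewrite ler_wpM2l// ler_pM//.
  by apply: sumr_ge0 => i _; exact: sqr_ge0.
have H1 : rw p e s * (2 * a * h1 + k * h) <= rw p e s * (h1 * (\sum_i da i ^+ 2) + h * La).
  rewrite ler_wpM2l// lerD//; last by rewrite mulrC ler_wpM2l.
  by rewrite mulrC ler_wnM2l.
have W1 : W * `|s| `^ p <= W * S by rewrite ler_wpM2l.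
have W2 := ler_wpM2r S0 hW.
have Y2 : (p - 1) * `|f * b| `^ p' <= (p - 1) * (f `^ p' * S) by rewrite ler_wpM2l// ltW.
rewrite wE in H1 *.
move: Y2 Y SQ B2 H1 W1 W2.
set P1 := `|Lu| `^ p; set P2 := `|f * b| `^ p'; set G1 := \sum_i da i * du i; set G2 := \sum_i du i ^+ 2.
set T := p * (p - 1) ^+ 2 * g ^+ 2 * b ^+ 2 / (f * b1) * (\sum_i da i ^+ 2).
set GG := h1 * (\sum_i da i ^+ 2) + h * La.
set Q := 2 * p * (p - 1) * a * g ^+ 2 / f.
clearbody P1 P2 G1 G2 T GG Q.
move=> Y2 Y SQ B2 H1 W1 W2; lra.
Qed.

End pointwise.

(** * The integrated inequality *)

Lemma is_derive_continuous {R : realType} (f : R -> R) (s l : R) :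
  is_derive s (1 : R) f l -> {for s, continuous f}.
Proof. by move=> [h _]; apply: differentiable_continuous; exact/derivable1_diffP. Qed.

Lemma normr_powR_continuous {R : realType} (p : R) : 0 < p ->
  continuous (fun t : R => `|t| `^ p).
Proof.
move=> p0 t; have [->|t0] := eqVneq t 0; last first.
  have h1 : ctsat (fun s : R => `|s|) t by exact: norm_continuous.
  have h2 : {for `|t|, continuous (fun s : R => s `^ p)}.
    by apply: is_derive_continuous; apply: is_derive1_powR; rewrite normr_gt0.
  exact: (ctsat_comp h1 h2).
apply/cvgrPdist_le => e e0.
rewrite normr0 powR0 ?gt_eqF//; near=> t0.
rewrite sub0r normrN ger0_norm ?powR_ge0//.
have -> : e = (e `^ p^-1) `^ p by rewrite -powRrM mulVf ?gt_eqF// powRr1// ltW.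
apply: ge0_ler_powR; rewrite ?nnegrE ?powR_ge0 ?normr_ge0 ?(ltW p0)//.
near: t0; have h : 0 < e `^ p^-1 by rewrite powR_gt0.
apply/nbhs_ballP; exists (e `^ p^-1) => //= s.
by rewrite /ball_ /= sub0r normrN; exact: ltW.
Unshelve. all: by end_near. Qed.

Lemma test_closure_bounded {R : realType} {n : nat} (U : set 'rV[R]_n) u : test_function U u ->
  exists M : R, forall x, closure [set x | u x != 0] x -> `|x| <= M.
Proof.
move=> [_ /compact_bounded [M [_ hM]] _]; exists (M + 1) => x Zx.
by apply: (hM (M + 1)); first by rewrite ltrDl.
Qed.

Section test_powers.
Context {R : realType} {n : nat}.
Variables (p : R) (U : set 'rV[R]_n) (u : 'rV[R]_n -> R).
Hypothesis p0 : 0 < p.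
Hypothesis tu : test_function U u.

Lemma laplacian_near0 x : (\forall y \near x, u y = 0) -> laplacian u x = 0.
Proof.
move=> hx; rewrite /laplacian big1// => i _; apply: pderive_near0.
by have := nbhs_interior hx; apply: filterS => y; exact: pderive_near0.
Qed.

Lemma tame_test_powR : tame (fun x => `|u x| `^ p).
Proof.
have [su _ _] := tu; have [M hM] := test_support tu; apply: (continuous_tame (M := M)).
  move=> x; exact: (ctsat_comp (@smooth_continuous _ _ _ su x) (@normr_powR_continuous R p p0 _)).
by move=> x /hM ->; rewrite normr0 powR0// gt_eqF.
Qed.

Lemma tame_laplacian_powR : tame (fun x => `|laplacian u x| `^ p).
Proof.
have [su _ _] := tu; have [M hM] := test_closure_bounded tu.
apply: (continuous_tame (M := M)) => [x|x Mx].
  have cl : ctsat (laplacian u) x.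
    apply: ctsat_sum => i.
    exact: (smooth_continuous (smooth_pderive i (smooth_pderive i su))).
  exact: (ctsat_comp cl (@normr_powR_continuous R p p0 _)).
rewrite laplacian_near0 ?normr0 ?powR0 ?gt_eqF//; apply: near_zero_out => /hM.
by rewrite leNgt Mx.
Qed.

(** Passes from the extended real integrals over Omega to real ones over the
    whole space. *)
Lemma integral_domain Omega (f : 'rV[R]_n -> R) : U `<=` Omega -> tame f ->
  (forall x, ~ closure [set x | u x != 0] x -> f x = 0) ->
  (\int[lebesgue_rV n]_(x in Omega) (f x)%:E = (integ f)%:E)%E.
Proof.
move=> UO tf f0; rewrite -integ_EFin// integral_mkcond; apply: eq_integral => x _.
rewrite patchE; case: ifPn => // xO; rewrite f0// => /(let: And3 _ _ h := tu in h)/UO.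
by move=> Ox; move/negP: xO; apply; rewrite inE.
Qed.

End test_powers.

Section integrated.
Context {R : realType} {n : nat}.
Variables (p k a1 : R).
Hypothesis p1 : 1 < p.
Local Notation p' := (p / (p - 1)).
Local Notation e_ i := (delta_mx ord0 i : 'rV[R]_n).

(** The relation f' = - h - 2 (p - 1) g is what merges the two terms of the
    divergence that contain grad a . grad u; it makes g, rather than f', the
    free parameter. The interval ]0, a1[ is to contain the values of a on the
    support of u. *)
Record admissible (f g h h1 W : R -> R) : Prop := Admissible {
  adm_f_gt0 : forall s, 0 < s < a1 -> 0 < f s;
  adm_df : forall s, 0 < s < a1 -> is_derive s (1 : R) f (- h s - 2 * (p - 1) * g s);
  adm_dh : forall s, 0 < s < a1 -> is_derive s (1 : R) h (h1 s);
  adm_cg : forall s, 0 < s < a1 -> {for s, continuous g};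
  adm_ch1 : forall s, 0 < s < a1 -> {for s, continuous h1};
  adm_cW : forall s, 0 < s < a1 -> {for s, continuous W};
  adm_h_ge0 : forall s, 0 < s < a1 -> 0 <= h s;
  adm_h1_le0 : forall s, 0 < s < a1 -> h1 s <= 0;
  adm_W_ge0 : forall s, 0 < s < a1 -> 0 <= W s;
  adm_W_le : forall s, 0 < s < a1 -> W s <= 2 * s * h1 s + k * h s
     - (p - 1) * f s `^ p' - 2 * p * (p - 1) * s * g s ^+ 2 / f s }.

Variables (f g h h1 W : R -> R).
Hypothesis adm : admissible f g h h1 W.
Variables (U : set 'rV[R]_n) (u a : 'rV[R]_n -> R).
Hypothesis tu : test_function U u.
Local Notation Z := (closure [set x | u x != 0]).
Hypothesis ca : continuous a.
Hypothesis c1a : forall i, C1 i a.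
Hypothesis c2a : forall i, C1 i (pderive i a).
Hypothesis aZ : forall x, Z x -> [/\ 0 < a x < a1, \sum_i pderive i a x ^+ 2 <= 2 * a x & k <= laplacian a x].

Let p0 : 0 < p. Proof. exact: lt_trans p1. Qed.
Let su : smooth u. Proof. by have [] := tu. Qed.
Let cu : continuous u. Proof. exact: smooth_continuous. Qed.
Let cdu i : continuous (pderive i u). Proof. exact: smooth_continuous (smooth_pderive i su). Qed.
Let cddu i : continuous (pderive i (pderive i u)).
Proof. exact: smooth_continuous (smooth_pderive i (smooth_pderive i su)). Qed.
Let G := [set x | 0 < a x < a1].

Let uZ x : ~ Z x -> [/\ u x = 0, forall i, pderive i u x = 0 & forall i, pderive i (pderive i u) x = 0].
Proof.
move=> /near_zero_out hx; split; first exact: nbhs_singleton hx.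
  by move=> i; exact: pderive_near0.
move=> i; apply: pderive_near0.
have := nbhs_interior hx; apply: filterS => y hy; exact: pderive_near0.
Qed.

(** The weights are singular where a = 0, away from the support of u; there
    every integrand is locally constant, equal to 0. *)
Let glue (F : 'rV[R]_n -> R) : (forall x, G x -> ctsat F x) -> (forall x, ~ Z x -> F x = 0) ->
  continuous F.
Proof.
move=> hG hZ x; have [Zx|Zx] := pselect (Z x); first by apply: hG; have [] := aZ Zx.
have h0 : \forall y \near x, 0 = F y.
  have : nbhs x (~` Z).
    by apply: open_nbhs_nbhs; split => //; exact: closed_openC (@closed_closure _ _).
  by apply: filterS => y Zy; rewrite hZ.
change (ctsat F x); rewrite /ctsat /prop_for /continuous_at (hZ _ Zx).
exact: cvg_trans (near_eq_cvg h0) (cvg_cst _).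
Qed.

Let glue_tame (F : 'rV[R]_n -> R) : (forall x, G x -> ctsat F x) -> (forall x, ~ Z x -> F x = 0) ->
  tame F.
Proof.
move=> hG hZ; have [M hM] : exists M : R, forall x, M < `|x| -> ~ Z x.
  have [M hM] := test_closure_bounded tu; exists M => x Mx /hM.
  by rewrite leNgt Mx.
apply: (continuous_tame (M := M)); first exact: glue.
by move=> x /hM /hZ.
Qed.

Let chi (x : 'rV[R]_n) : R := \1_Z x.

Section eps.
Variable e : R.
Hypothesis e0 : 0 < e.
Local Notation beta := (rbeta p e).
Local Notation beta1 := (rbeta1 p e).
Local Notation w := (rw p e).

(** The field of which the divergence, with components dP, is added to |Lap
    u|^p. *)
Let P i x := p * (f (a x) * (beta (u x) * pderive i u x)) + h (a x) * (w (u x) * pderive i a x).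
Let dP i x :=
  p * ((- h (a x) - 2 * (p - 1) * g (a x)) * pderive i a x * (beta (u x) * pderive i u x)
       + f (a x) * (beta1 (u x) * pderive i u x * pderive i u x + beta (u x) * pderive i (pderive i u) x))
  + (h1 (a x) * pderive i a x * (w (u x) * pderive i a x)
     + h (a x) * (p * beta (u x) * pderive i u x * pderive i a x + w (u x) * pderive i (pderive i a) x)).

Let dP_is_derive i x : is_derive x (e_ i) (P i) (dP i x).
Proof.
have du := C1_is_derive x (smooth_C1 i su).
have ddu := C1_is_derive x (smooth_C1 i (smooth_pderive i su)).
have da := C1_is_derive x (c1a i).
have dda := C1_is_derive x (c2a i).
have [Zx|Zx] := pselect (Z x).
  have [ax _ _] := aZ Zx.
  have df := is_derive_comp_line da (adm_df adm ax).
  have dh := is_derive_comp_line da (adm_dh adm ax).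
  have db := is_derive_comp_line du (is_derive_rbeta p e0 (u x)).
  have dw := is_derive_comp_line du (is_derive_rw p e0 (u x)).
  exact: (isdD (isdZ p (isdM df (isdM db ddu))) (isdM dh (isdM dw dda))).
have [u0 du0 ddu0] := uZ Zx.
have -> : dP i x = 0 by rewrite /dP u0 du0 ddu0 (rbeta0 p e) rw0// !(mulr0, mul0r, addr0).
have hx : \forall y \near x, 0 = P i y.
  have : nbhs x (~` Z).
    by apply: open_nbhs_nbhs; split => //; exact: closed_openC (@closed_closure _ _).
  apply: filterS => y Zy; have [v0 dv0 _] := uZ Zy.
  by rewrite /P v0 dv0 (rbeta0 p e) rw0// !(mulr0, mul0r, addr0).
exact: near_eq_is_derive hx (isd_cst 0 x _).
Qed.

Let cont_scalar (F : R -> R) x : (forall s, 0 < s < a1 -> {for s, continuous F}) -> G x ->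
  ctsat (fun y => F (a y)) x.
Proof. by move=> hF Gx; apply: ctsat_comp; [exact: ca|exact: hF]. Qed.

Let cf := fun x => @cont_scalar f x (fun s hs => is_derive_continuous (adm_df adm hs)).
Let ch := fun x => @cont_scalar h x (fun s hs => is_derive_continuous (adm_dh adm hs)).
Let cg := fun x => @cont_scalar g x (adm_cg adm).
Let ch1 := fun x => @cont_scalar h1 x (adm_ch1 adm).

Let cont_u (F : R -> R) x : (forall s, {for s, continuous F}) -> ctsat (fun y => F (u y)) x.
Proof. by move=> hF; apply: ctsat_comp; [exact: cu|exact: hF]. Qed.

Let cbeta := fun x => @cont_u beta x (fun s => is_derive_continuous (is_derive_rbeta p e0 s)).
Let cw := fun x => @cont_u w x (fun s => is_derive_continuous (is_derive_rw p e0 s)).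
Let cbeta1 x : ctsat (fun y => beta1 (u y)) x.
Proof.
apply: cont_u => s.
have hid : ctsat (fun t : R => t) s by exact: cvg_id.
have hq : ctsat (rq e) s by exact: (ctsatD (ctsatX (k := 2) hid) (@ctsat_cst R _ (e ^+ 2) s)).
have hp' : {for rq e s, continuous (fun t : R => t `^ (p / 2 - 2))}.
  by apply: is_derive_continuous; apply: is_derive1_powR; exact: rq_gt0.
have h2 := ctsatD (ctsatM (@ctsat_cst R _ (p - 1) s) (ctsatX (k := 2) hid)) (@ctsat_cst R _ (e ^+ 2) s).
exact: (ctsatM (ctsat_comp hq hp') h2).
Qed.

Let cda i : continuous (pderive i a). Proof. exact: (c1a i).2. Qed.
Let cdda i : continuous (pderive i (pderive i a)). Proof. exact: (c2a i).2. Qed.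

Let P_tame i : tame (P i).
Proof.
apply: glue_tame => x hx; last first.
  have [u0 du0 _] := uZ hx.
  by rewrite /P u0 du0 (rbeta0 p e) rw0// !(mulr0, mul0r, addr0).
apply: ctsatD.
  apply: ctsatM; first exact: ctsat_cst.
  apply: ctsatM; first exact: cf.
  by apply: ctsatM; [exact: cbeta|exact: cdu].
apply: ctsatM; first exact: ch.
by apply: ctsatM; [exact: cw|exact: cda].
Qed.

Let dP_out i x : ~ Z x -> dP i x = 0.
Proof.
by move=> /uZ[u0 du0 ddu0]; rewrite /dP u0 du0 ddu0 (rbeta0 p e) rw0// !(mulr0, mul0r, addr0).
Qed.

Let dP_cont i x : G x -> ctsat (dP i) x.
Proof.
move=> Gx; apply: ctsatD.
  apply: ctsatM; first exact: ctsat_cst.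
  apply: ctsatD.
    apply: ctsatM; last by apply: ctsatM; [exact: cbeta|exact: cdu].
    apply: ctsatM; last exact: cda.
    apply: ctsatB; first by apply: ctsatN; exact: ch.
    by apply: ctsatM; [exact: ctsat_cst|exact: cg].
  apply: ctsatM; first exact: cf.
  apply: ctsatD; last by apply: ctsatM; [exact: cbeta|exact: cddu].
  by apply: ctsatM; [apply: ctsatM; [exact: cbeta1|]|]; exact: cdu.
apply: ctsatD.
  apply: ctsatM; last by apply: ctsatM; [exact: cw|exact: cda].
  by apply: ctsatM; [exact: ch1|exact: cda].
apply: ctsatM; first exact: ch.
apply: ctsatD; last by apply: ctsatM; [exact: cw|exact: cdda].
apply: ctsatM; last exact: cda.
apply: ctsatM; last exact: cdu.
by apply: ctsatM; [exact: ctsat_cst|exact: cbeta].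
Qed.

Let dP_integ i : tame (dP i) /\ integ (dP i) = 0.
Proof.
have c : continuous (dP i) by apply: glue => x; [exact: dP_cont|exact: dP_out].
have [C1P E] := is_derive_C1 (dP_is_derive i) c.
split; first by apply: glue_tame => x; [exact: dP_cont|exact: dP_out].
by rewrite -E; apply: integ_pderive.
Qed.

Let V1 s := 2 * s * h1 s + k * h s.

Lemma tame_W_powR : tame (fun x => W (a x) * `|u x| `^ p).
Proof.
apply: glue_tame => x hx; last first.
  by have [-> _ _] := uZ hx; rewrite normr0 powR0 ?gt_eqF// mulr0.
apply: ctsatM; first exact: (cont_scalar (adm_cW adm)).
exact: (@cont_u (fun s => `|s| `^ p) x (@normr_powR_continuous R p p0)).
Qed.

(** The divergence has integral 0, and C bounds the error of the pointwise
    inequality relative to e^p. *)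
Lemma integrated_eps C : (forall x, Z x -> V1 (a x) <= C) -> 0 <= C ->
  integ (fun x => W (a x) * `|u x| `^ p) - e `^ p * (C * integ chi) <=
  integ (fun x => `|laplacian u x| `^ p).
Proof.
move=> hC C0.
have mZ : measurable Z by apply: closed_measurable_row; exact: closed_closure.
have t1 : tame chi.
  split; first exact: measurable_indic.
  have [M hM] := test_closure_bounded tu; exists 1, M => x; rewrite /chi indicE; split.
    by case: (_ \in _); rewrite ?normr1 ?normr0.
  by move=> Mx; rewrite memNset// => /hM; rewrite leNgt Mx.
have t2 : tame (fun x => e `^ p * (C * chi x)) by apply: tameZ; exact: tameZ.
have t3 : tame (fun x => \sum_i dP i x) by apply: tame_sum => i; have [] := dP_integ i.
have E3 : integ (fun x => \sum_i dP i x) = 0.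
  by rewrite integ_sum ?big1// => i; have [] := dP_integ i.
rewrite -[leRHS]addr0 -E3 -integD//; last exact: (tame_laplacian_powR p0 tu).
have -> : e `^ p * (C * integ chi) = integ (fun x => e `^ p * (C * chi x)).
  by rewrite (integZ _ (tameZ _ t1)) (integZ _ t1).
rewrite -(integB tame_W_powR t2).
apply: integ_le.
- by apply: tameB => //; exact: tame_W_powR.
- by apply: tameD => //; exact: (tame_laplacian_powR p0 tu).
move=> x; have [Zx|Zx] := pselect (Z x); last first.
  have [-> _ ddu] := uZ Zx; rewrite /chi indicE memNset// !mulr0 normr0 powR0 ?gt_eqF// mulr0 subr0.
  by rewrite addr_ge0 ?powR_ge0// big1// => i _; exact: dP_out.
have [ax g2 gl] := aZ Zx; have /andP[a0 _] := ax.
rewrite /chi indicE mem_set// mulr1.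
apply: (@le_trans _ _ (W (a x) * `|u x| `^ p - e `^ p * V1 (a x))).
  by rewrite lerD2l lerN2 ler_wpM2l ?powR_ge0// hC.
have := pointwise_ineq (e := e) p1 e0 (u x) (laplacian u x) (fun i => pderive i u x)
   (adm_f_gt0 adm ax) (adm_h_ge0 adm ax) (adm_h1_le0 adm ax) a0 g2 gl (adm_W_ge0 adm ax) (adm_W_le adm ax).
move=> H; apply: le_trans H _; rewrite lerD2l le_eqVlt; apply/orP; left; apply/eqP.
rewrite /laplacian /dP !mulrDr !mulr_sumr -!big_split; apply: eq_bigr => i _ /=; ring.
Qed.

End eps.

Lemma integrated_ineq :
  integ (fun x => W (a x) * `|u x| `^ p) <= integ (fun x => `|laplacian u x| `^ p).
Proof.
pose V1 s := 2 * s * h1 s + k * h s.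
have [C [C0 hC]] : exists C, 0 <= C /\ forall x, Z x -> V1 (a x) <= C.
  have [Z0|Z0] := pselect (Z !=set0); last first.
    by exists 0; split => // x Zx; exfalso; apply: Z0; exists x.
  have cZ : compact Z by have [] := tu.
  have cV : {within Z, continuous (fun x => V1 (a x))}.
    apply: continuous_in_subspaceT => x; rewrite inE => Zx; have [ax _ _] := aZ Zx.
    have hid : ctsat (fun t : R => t) (a x) by exact: cvg_id.
    have h2 := ctsatM (ctsatM (@ctsat_cst R _ 2 _) hid) (adm_ch1 adm ax).
    have h3 := ctsatM (@ctsat_cst R _ k _) (is_derive_continuous (adm_dh adm ax)).
    exact: (@ctsat_comp _ _ V1 a x (@ca x) (ctsatD h2 h3)).
  have [c _ hc] := EVT_max_rV Z0 cZ cV.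
  exists `|V1 (a c)|; split => // x Zx; apply: le_trans (hc x _) (ler_norm _).
  by rewrite inE.
apply/ler_addgt0Pr => d d0.
pose B := C * integ chi.
have B0 : 0 <= B by apply: mulr_ge0 => //; apply: integ_ge0 => x; rewrite /chi indicE.
(* so that the error e^p B is at most d *)
pose e := (d / (B + 1)) `^ p^-1.
have e0 : 0 < e by rewrite powR_gt0// divr_gt0// ltr_wpDl.
have := integrated_eps e0 hC C0.
have -> : e `^ p = d / (B + 1).
  by rewrite /e -powRrM mulVf ?gt_eqF// powRr1// divr_ge0 ?ltW// ltr_wpDl.
rewrite -/B.
have : d / (B + 1) * B <= d.
  rewrite mulrAC ler_pdivrMr ?ltr_wpDl// ler_wpM2l ?(ltW d0)//; lra.
lra.
Qed.

End integrated.

(** * Sums of products of iterated logarithms *)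

Section logs.
Context {R : realType}.
Implicit Types (t s : R) (i m : nat).

Definition Xprod i t : R := \prod_(1 <= j < i.+1) Xlog j t.
Definition Xsum m t : R := \sum_(1 <= i < m.+1) Xprod i t.
Definition Xsum2 m t : R := \sum_(1 <= i < m.+1) Xprod i t ^+ 2.
(** The image of Xsum2 under t d/dt. *)
Definition Xsum2d m t : R := \sum_(1 <= i < m.+1) 2 * Xprod i t ^+ 2 * Xsum i t.

Lemma Xprod0 t : Xprod 0 t = 1. Proof. by rewrite /Xprod big_geq. Qed.
Lemma XprodS i t : Xprod i.+1 t = Xprod i t * Xlog i.+1 t.
Proof. by rewrite /Xprod big_nat_recr. Qed.
Lemma Xsum0 t : Xsum 0 t = 0. Proof. by rewrite /Xsum big_geq. Qed.
Lemma XsumS m t : Xsum m.+1 t = Xsum m t + Xprod m.+1 t.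
Proof. by rewrite /Xsum big_nat_recr. Qed.
Lemma Xsum20 t : Xsum2 0 t = 0. Proof. by rewrite /Xsum2 big_geq. Qed.
Lemma Xsum2S m t : Xsum2 m.+1 t = Xsum2 m t + Xprod m.+1 t ^+ 2.
Proof. by rewrite /Xsum2 big_nat_recr. Qed.
Lemma Xsum2d0 t : Xsum2d 0 t = 0. Proof. by rewrite /Xsum2d big_geq. Qed.
Lemma Xsum2dS m t : Xsum2d m.+1 t = Xsum2d m t + 2 * Xprod m.+1 t ^+ 2 * Xsum m.+1 t.
Proof. by rewrite /Xsum2d big_nat_recr. Qed.

Lemma X1_in01 t : 0 < t < 1 -> 0 < X1 t < 1.
Proof.
move=> /andP[t0 t1]; have l0 : ln t < 0 by apply: ln_lt0; rewrite t0.
by rewrite /X1 invr_gt0 invf_lt1; lra.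
Qed.

Lemma Xlog_in01 i t : 0 < t < 1 -> 0 < Xlog i t < 1.
Proof. by move=> h; elim: i => //= i IH; exact: X1_in01. Qed.

Lemma Xprod_gt0 i t : 0 < t < 1 -> 0 < Xprod i t.
Proof.
move=> h; elim: i => [|i IH]; first by rewrite Xprod0.
by rewrite XprodS mulr_gt0//; have /andP[] := Xlog_in01 i.+1 h.
Qed.

Lemma Xsum_ge0 m t : 0 < t < 1 -> 0 <= Xsum m t.
Proof.
move=> h; elim: m => [|m IH]; first by rewrite Xsum0.
by rewrite XsumS addr_ge0// ltW// Xprod_gt0.
Qed.

Lemma Xsum2_ge0 m t : 0 <= Xsum2 m t.
Proof. by apply: sumr_ge0 => i _; exact: sqr_ge0. Qed.

Lemma Xsum2_le_sqr m t : 0 < t < 1 -> Xsum2 m t <= Xsum m t ^+ 2.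
Proof.
move=> h; elim: m => [|m IH]; first by rewrite Xsum20 Xsum0 expr0n.
rewrite Xsum2S XsumS; have := Xsum_ge0 m h; have := Xprod_gt0 m.+1 h; nra.
Qed.

Lemma Xsum_homo m t : 0 < t < 1 -> Xsum m t <= Xsum m.+1 t.
Proof. by move=> h; rewrite XsumS lerDl ltW// Xprod_gt0. Qed.

Lemma Xsum2d_ge0 m t : 0 < t < 1 -> 0 <= Xsum2d m t.
Proof.
move=> h; apply: sumr_ge0 => i _; rewrite mulr_ge0 ?Xsum_ge0//.
by rewrite mulr_ge0// sqr_ge0.
Qed.

Lemma Xsum2d_le m t : 0 < t < 1 -> Xsum2d m t <= 2 * Xsum m t * Xsum2 m t.
Proof.
move=> h; elim: m => [|m IH]; first by rewrite Xsum2d0 Xsum20 mulr0.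
rewrite Xsum2dS Xsum2S mulrDr.
have e := Xsum_homo m h.
have : 2 * Xsum m t * Xsum2 m t <= 2 * Xsum m.+1 t * Xsum2 m t.
  by rewrite ler_wpM2r ?Xsum2_ge0// ler_wpM2l.
lra.
Qed.

Lemma Xlog_shift i t : Xlog i.+1 t = Xlog i (X1 t).
Proof. by rewrite /Xlog iterSr. Qed.

Lemma Xprod_shift i t : Xprod i.+1 t = X1 t * Xprod i (X1 t).
Proof.
elim: i => [|i IH]; first by rewrite XprodS Xprod0 mul1r Xprod0 mulr1.
by rewrite XprodS IH [in RHS]XprodS mulrA Xlog_shift.
Qed.

Lemma Xsum_shift m t : Xsum m.+1 t = X1 t * (1 + Xsum m (X1 t)).
Proof.
elim: m => [|m IH]; first by rewrite XsumS Xsum0 Xprod_shift Xprod0 Xsum0 addr0 add0r mulr1.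
by rewrite XsumS IH Xprod_shift XsumS; ring.
Qed.

Lemma ln_lower (y : R) : 0 < y -> 1 - y^-1 <= ln y.
Proof.
move=> y0; have h := @le_ln1Dx R (y^-1 - 1).
have E : 1 + (y^-1 - 1) = y^-1 by ring.
rewrite E lnV ?posrE// in h.
have : - ln y <= y^-1 - 1 by apply: h; rewrite ltrBDl subrr invr_gt0.
lra.
Qed.

(** The bound 1 - 1 / y <= ln y at y = sqrt (1 + L), freed of the square root;
    it is the inequality on which the induction of Xsum_log_bound closes. *)
Lemma ln1D_lower (L : R) : 0 <= L -> 4 * L <= ln (1 + L) * (4 + 3 * L).
Proof.
move=> L0; pose y := Num.sqrt (1 + L).
have y2 : y ^+ 2 = 1 + L by rewrite sqr_sqrtr//; lra.
have y0 : 0 <= y by exact: sqrtr_ge0.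
have y1 : 1 <= y by rewrite -(ler_pXn2r (n := 2))// ?nnegrE// y2 expr1n; lra.
have yp : 0 < y by lra.
have h := ln_lower yp.
have -> : ln (1 + L) = 2 * ln y by rewrite -y2 lnXn// mulr_natl.
have h2 : y - 1 <= y * ln y.
  have := ler_wpM2l y0 h; by rewrite mulrBr mulfV ?gt_eqF// mulr1.
have -> : L = y ^+ 2 - 1 by rewrite y2; ring.
rewrite -(ler_pM2l yp).
have h3 : (y - 1) * (2 * (4 + 3 * (y ^+ 2 - 1))) <= (y * ln y) * (2 * (4 + 3 * (y ^+ 2 - 1))).
  by rewrite ler_wpM2r//; nra.
have h4 : y * (4 * (y ^+ 2 - 1)) <= (y - 1) * (2 * (4 + 3 * (y ^+ 2 - 1))).
  rewrite -subr_ge0.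
  have -> : (y - 1) * (2 * (4 + 3 * (y ^+ 2 - 1))) - y * (4 * (y ^+ 2 - 1)) = 2 * (y - 1) ^+ 2 * (y - 1).
    by ring.
  by rewrite mulr_ge0 ?subr_ge0// mulr_ge0// sqr_ge0.
lra.
Qed.

(** Put L = - ln t, so that X1 t = 1 / (1 + L). The recursion Xsum m.+1 t = X1
    t * (1 + Xsum m (X1 t)) and the bound at X1 t give Xsum m.+1 t <= (1 + 4 /
    ln (1 + L)) / (1 + L), and this is at most 4 / L. *)
Lemma Xsum_log_bound m t : 0 < t < 1 -> Xsum m t * - ln t <= 4.
Proof.
elim: m t => [|m IH] t h; first by rewrite Xsum0 mul0r.
have /andP[t0 t1] := h; have l0 : ln t < 0 by apply: ln_lt0.
pose L := - ln t; have L0 : 0 < L by rewrite /L oppr_gt0.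
have X1E : X1 t = (1 + L)^-1 by rewrite /X1 /L.
have hX := X1_in01 h; have := IH _ hX; have e0 := Xsum_ge0 m hX.
rewrite {2}X1E lnV ?posrE ?addr_gt0// opprK -/L Xsum_shift X1E.
set l := ln (1 + L); set e := Xsum m _ => he.
have hl := ln1D_lower (ltW L0); rewrite -/l in hl.
have l1 : 0 < l by rewrite /l ln_gt0//; lra.
rewrite mulrAC -mulrA mulrC ler_pdivrMr; last lra.
rewrite -(ler_pM2l l1).
have : L * (e * l) <= L * 4 by rewrite ler_wpM2l// ltW.
nra.
Qed.

Lemma Xsum_le_X1 m t : 0 < t -> ln t <= -1 -> Xsum m t <= 8 * X1 t.
Proof.
move=> t0 lt1; have t1 : t < 1 by rewrite -ltr_ln ?posrE// ln1; lra.
have h : 0 < t < 1 by rewrite t0.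
have := Xsum_log_bound m h; have e0 := Xsum_ge0 m h.
rewrite /X1 ler_pdivlMr; last lra.
nra.
Qed.

(** The first term X_1 alone controls the whole sum, so cubic expressions in
    Xsum are at most multiples of Xsum * Xsum2. *)
Lemma Xsum_sqr_le m t : 0 < t -> ln t <= -1 -> Xsum m t ^+ 2 <= 64 * Xsum2 m t.
Proof.
case: m => [|m] t0 lt1; first by rewrite Xsum0 Xsum20 expr0n mulr0.
have t1 : t < 1 by rewrite -ltr_ln ?posrE// ln1; lra.
have h : 0 < t < 1 by rewrite t0.
have e0 := Xsum_ge0 m.+1 h; have := Xsum_le_X1 m.+1 t0 lt1 => e1.
have : X1 t ^+ 2 <= Xsum2 m.+1 t.
  rewrite /Xsum2 big_nat_recl//= /Xprod big_nat1 /=.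
  by rewrite lerDl; apply: sumr_ge0 => i _; exact: sqr_ge0.
nra.
Qed.

Lemma Xsum_small m t (dl : R) : 0 < dl -> 0 < t < 1 -> 4 <= dl * - ln t -> Xsum m t <= dl.
Proof.
move=> d0 h hl; have /andP[t0 t1] := h; have l0 : ln t < 0 by apply: ln_lt0.
have := Xsum_log_bound m h; have L0 : 0 < - ln t by rewrite oppr_gt0.
by move=> e1; rewrite -(ler_pM2r L0); exact: le_trans hl.
Qed.

Section theta.
Variable D : R.
Hypothesis D0 : 0 < D.
Definition tau s : R := Num.sqrt (2 * s) / D.
(** In terms of t = tau s this is the operator t d/dt, under which polynomials
    in the Xprod i are stable. *)
Definition theta (F : R -> R) s l := is_derive s (1 : R) F (l / (2 * s)).

Lemma theta_eq F s a b : theta F s a -> a = b -> theta F s b.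
Proof. by move=> h <-. Qed.
Lemma theta_cst c s : theta (fun=> c) s 0.
Proof. by rewrite /theta mul0r; exact: isd_cst. Qed.
Lemma thetaD F G s a b : theta F s a -> theta G s b -> theta (fun s => F s + G s) s (a + b).
Proof. by move=> hF hG; apply: (isd_eq (isdD hF hG)); ring. Qed.
Lemma thetaB F G s a b : theta F s a -> theta G s b -> theta (fun s => F s - G s) s (a - b).
Proof. by move=> hF hG; apply: (isd_eq (isdB hF hG)); ring. Qed.
Lemma thetaM F G s a b : theta F s a -> theta G s b ->
  theta (fun s => F s * G s) s (a * G s + F s * b).
Proof. by move=> hF hG; apply: (isd_eq (isdM hF hG)); ring. Qed.
Lemma thetaZ F s a c : theta F s a -> theta (fun s => c * F s) s (c * a).
Proof. by move=> hF; apply: (theta_eq (thetaM (theta_cst c s) hF)); rewrite mul0r add0r. Qed.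
Lemma thetaX2 F s a : theta F s a -> theta (fun s => F s ^+ 2) s (2 * F s * a).
Proof.
move=> hF; apply: (theta_eq (thetaM hF hF)); ring.
Qed.
Lemma theta_comp F s a (phi : R -> R) l : theta F s a -> is_derive (F s) (1 : R) phi l ->
  theta (fun s => phi (F s)) s (l * a).
Proof. by move=> hF hp; apply: (isd_eq (is_derive_comp_line hF hp)); rewrite mulrA. Qed.

Lemma theta_tau s : 0 < s -> theta tau s (tau s).
Proof.
move=> s0; have s2 : 0 < 2 * s by rewrite mulr_gt0.
have hid : is_derive s (1 : R) (fun s => s) (1 : R) by exact: is_derive_id.
have h := is_derive_comp_line (isdZ 2 hid) (is_derive1_sqrt s2).
apply: (isd_eq (isdM h (isd_cst D^-1 _ _))).
rewrite mulr0 addr0 mulr1 /tau; have r0 : 0 < Num.sqrt (2 * s) by rewrite sqrtr_gt0.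
have r2 : Num.sqrt (2 * s) ^+ 2 = 2 * s by rewrite sqr_sqrtr// ltW.
rewrite -[X in _ / D / X]r2; field; rewrite !gt_eqF//.
Qed.

Variable s : R.
Hypothesis s0 : 0 < s.
Hypothesis ts : tau s < 1.

Lemma tau_in01 : 0 < tau s < 1.
Proof. by rewrite ts divr_gt0// sqrtr_gt0 mulr_gt0. Qed.

Lemma theta_Xlog i : theta (fun s => Xlog i (tau s)) s (Xprod i (tau s) * Xlog i (tau s)).
Proof.
elim: i => [|i IH]; first by rewrite Xprod0 mul1r; exact: theta_tau.
have /andP[x0 x1] := Xlog_in01 i tau_in01.
have l0 : ln (Xlog i (tau s)) < 0 by apply: ln_lt0; rewrite x0.
have hln := theta_comp IH (is_derive1_ln x0).
have h1 := thetaB (theta_cst 1 s) hln.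
have n0 : 1 - ln (Xlog i (tau s)) != 0 by rewrite gt_eqF//; lra.
have hid : is_derive (1 - ln (Xlog i (tau s))) (1 : R) (fun s => s) (1 : R) by exact: is_derive_id.
have hV := @is_deriveV R (fun s => s) _ _ _ n0 hid.
have h2 := theta_comp h1 hV.
apply: (theta_eq h2); rewrite XprodS /=.
have -> : X1 (Xlog i (tau s)) = (1 - ln (Xlog i (tau s)))^-1 by [].
rewrite -[_ *: 1]/(_ * 1); field.
by rewrite n0 gt_eqF.
Qed.

Lemma theta_Xprod i : theta (fun s => Xprod i (tau s)) s (Xprod i (tau s) * Xsum i (tau s)).
Proof.
elim: i => [|i IH].
  by rewrite Xsum0 mulr0; under eq_fun do rewrite Xprod0; exact: theta_cst.
under eq_fun do rewrite XprodS.
apply: (theta_eq (thetaM IH (theta_Xlog i.+1))).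
by rewrite XsumS XprodS; ring.
Qed.

Lemma theta_Xsum m : theta (fun s => Xsum m (tau s)) s ((Xsum m (tau s) ^+ 2 + Xsum2 m (tau s)) / 2).
Proof.
elim: m => [|m IH].
  by rewrite Xsum0 Xsum20 expr0n addr0 mul0r; under eq_fun do rewrite Xsum0; exact: theta_cst.
under eq_fun do rewrite XsumS.
apply: (theta_eq (thetaD IH (theta_Xprod m.+1))).
by rewrite Xsum2S XsumS; field.
Qed.

Lemma theta_Xsum2 m : theta (fun s => Xsum2 m (tau s)) s (Xsum2d m (tau s)).
Proof.
elim: m => [|m IH].
  by rewrite Xsum2d0; under eq_fun do rewrite Xsum20; exact: theta_cst.
under eq_fun do rewrite Xsum2S.
apply: (theta_eq (thetaD IH (thetaX2 (theta_Xprod m.+1)))).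
by rewrite Xsum2dS; ring.
Qed.

Lemma theta_Xsum2d m : exists l, theta (fun s => Xsum2d m (tau s)) s l.
Proof.
elim: m => [|m [l IH]].
  by exists 0; under eq_fun do rewrite Xsum2d0; exact: theta_cst.
eexists; under eq_fun do rewrite Xsum2dS.
exact: (thetaD IH (thetaM (thetaZ 2 (thetaX2 (theta_Xprod m.+1))) (theta_Xsum m.+1))).
Qed.

End theta.
End logs.

(** * The scalar inequality *)

Section taylor.
Context {R : realType}.

(** The mean value theorem raises the order of vanishing at 0 by one. *)
Lemma integrate_bound (phi psi : R -> R) (K : R) (j : nat) : 0 <= K ->
  (forall c, `|c| <= 2^-1 -> is_derive c (1 : R) phi (psi c)) -> phi 0 = 0 ->
  (forall c, `|c| <= 2^-1 -> `|psi c| <= K * `|c| ^+ j) ->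
  forall s, `|s| <= 2^-1 -> `|phi s| <= K * `|s| ^+ j.+1.
Proof.
move=> K0 hd p0 hb s hs.
have cont c : `|c| <= 2^-1 -> {for c, continuous phi}.
  by move=> hc; exact: is_derive_continuous (hd c hc).
have main a b c : a <= b -> c \in `[a, b] -> `|a| <= `|s| -> `|b| <= `|s| -> `|c| <= `|s|.
  move=> ab; rewrite in_itv/= => /andP[ac cb]; rewrite !ler_norml => /andP[a1 a2] /andP[b1 b2].
  by apply/andP; split; lra.
have [c cs ->] : exists2 c, `|c| <= `|s| & phi s = psi c * s.
  have [s0|s0] := leP 0 s.
    have dd x : x \in `]0, s[ -> is_derive x (1 : R) phi (psi x).
      rewrite in_itv/= => /andP[x0 xs]; apply: hd; apply: le_trans hs.
      by rewrite !ger0_norm// ltW.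
    have cc : {within `[0, s], continuous phi}.
      apply: continuous_in_subspaceT => x; rewrite inE/= => xs; apply: cont; apply: le_trans hs.
      by apply: (main 0 s) => //; rewrite normr0.
    have [c cI E] := MVT_segment s0 dd cc; exists c.
      by apply: (main 0 s) => //; rewrite normr0.
    by move: E; rewrite p0 !subr0.
  have dd x : x \in `]s, 0[ -> is_derive x (1 : R) phi (psi x).
    rewrite in_itv/= => /andP[xs x0]; apply: hd; apply: le_trans hs.
    by rewrite !ltr0_norm// lerN2 ltW.
  have cc : {within `[s, 0], continuous phi}.
    apply: continuous_in_subspaceT => x; rewrite inE/= => xs; apply: cont; apply: le_trans hs.
    by apply: (main s 0) => //; rewrite ?normr0// ltW.
  have [c cI E] := MVT_segment (ltW s0) dd cc; exists c.
    by apply: (main s 0) => //; rewrite ?normr0// ltW.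
  by move: E; rewrite p0 !sub0r mulrN => /oppr_inj.
rewrite normrM exprSr mulrA ler_wpM2r//.
apply: le_trans (hb c (le_trans cs hs)) _.
by rewrite ler_wpM2l// lerXn2r ?nnegrE.
Qed.

Lemma powR_half_two (x r : R) : 2^-1 <= x <= 2 -> x `^ r <= 2 `^ `|r|.
Proof.
move=> /andP[x1 x2]; have x0 : 0 < x by lra.
have [r0|r0] := leP 0 r.
  by rewrite ger0_norm//; apply: ge0_ler_powR; rewrite ?nnegrE//; lra.
rewrite ltr0_norm//.
have -> : x `^ r = (x^-1) `^ (- r).
  by rewrite -(powR_inv1 (ltW x0)) -powRrM mulN1r opprK.
have xi : x^-1 <= 2 by rewrite -(invrK 2) lef_pV2 ?posrE.
apply: ge0_ler_powR; rewrite ?nnegrE ?invr_ge0//; lra.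
Qed.

(** Three applications of integrate_bound, starting from the third derivative,
    which is bounded on [1/2, 3/2]. *)
Lemma powR_taylor (q : R) : exists K : R, 0 <= K /\ forall s, `|s| <= 2^-1 ->
  (1 + s) `^ q <= 1 + q * s + q * (q - 1) / 2 * s ^+ 2 + K * `|s| ^+ 3.
Proof.
pose K : R := `|q * (q - 1) * (q - 2)| * 2 `^ `|q - 3|.
have K0 : 0 <= K by rewrite mulr_ge0// powR_ge0.
have hs1 (s : R) : `|s| <= 2^-1 -> 2^-1 <= 1 + s <= 2.
  by rewrite ler_norml => /andP[? ?]; apply/andP; split; lra.
have dp (r c : R) : `|c| <= 2^-1 -> is_derive c (1 : R) (fun s => (1 + s) `^ r) (r * (1 + c) `^ (r - 1)).
  move=> hc; have /andP[h1 _] := hs1 c hc.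
  have h0 : 0 < 1 + c by lra.
  have hid : is_derive c (1 : R) (fun s => s) (1 : R) by exact: is_derive_id.
  apply: (isd_eq (is_derive_comp_line (isdD (isd_cst 1 c _) hid) (is_derive1_powR r h0))).
  by rewrite add0r mulr1.
have hid c : is_derive c (1 : R) (fun s : R => s) (1 : R) by exact: is_derive_id.
exists K; split => // s hs.
pose r2 (c : R) := q * (q - 1) * ((1 + c) `^ (q - 2) - 1).
pose r1 (c : R) := q * ((1 + c) `^ (q - 1) - 1 - (q - 1) * c).
pose r0 (c : R) := (1 + c) `^ q - 1 - q * c - q * (q - 1) / 2 * (c * c).
have b2 : forall c : R, `|c| <= 2^-1 -> `|r2 c| <= K * `|c| ^+ 1.
  apply: (@integrate_bound r2 (fun c => q * (q - 1) * ((q - 2) * (1 + c) `^ (q - 3))) K 0 K0).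
  - move=> c hc; apply: (isd_eq (isdZ _ (isdB (dp (q - 2) c hc) (isd_cst 1 c _)))).
    by rewrite subr0; congr (_ * (_ * _ `^ _)); ring.
  - by rewrite /r2 addr0 powR1 subrr mulr0.
  - move=> c hc; rewrite expr0 mulr1 mulrA normrM ler_wpM2l//.
    by rewrite ger0_norm ?powR_ge0//; exact: powR_half_two (hs1 c hc).
have b1 : forall c : R, `|c| <= 2^-1 -> `|r1 c| <= K * `|c| ^+ 2.
  apply: (@integrate_bound r1 r2 K 1 K0); last exact: b2; last first.
    by rewrite /r1 addr0 powR1 subrr mulr0 subrr mulr0.
  move=> c hc; apply: (isd_eq (isdZ _ (isdB (isdB (dp (q - 1) c hc) (isd_cst 1 c _)) (isdZ (q - 1) (hid c))))).
  rewrite /r2; have -> : q - 1 - 1 = q - 2 by ring.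
  by ring.
have b0 : forall c : R, `|c| <= 2^-1 -> `|r0 c| <= K * `|c| ^+ 3.
  apply: (@integrate_bound r0 r1 K 2 K0); last exact: b1.
    move=> c hc; apply: (isd_eq (isdB (isdB (isdB (dp q c hc) (isd_cst 1 c _)) (isdZ q (hid c))) (isdZ _ (isdM (hid c) (hid c))))).
    by rewrite /r1; field.
  by rewrite /r0 addr0 powR1 subrr !mulr0 !subr0.
have := le_trans (ler_norm _) (b0 s hs); rewrite /r0 expr2; lra.
Qed.

End taylor.

(** Estimates for the single terms of scalar_core, where et, B, B1 stand for
    the values of Xsum, Xsum2, Xsum2d at one point and e1 for that of the
    image of Xsum under t d/dt. Every error is bounded by a multiple of the
    cubic quantity E = et * B. *)
Section small_values.
Context {R : realType}.
Variables (al dl et B B1 : R).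
Local Notation nal := `|al|.
Hypotheses (d1 : dl <= 1) (dn : dl * (2 * nal) <= 1).
Hypotheses (et0 : 0 <= et) (etd : et <= dl) (B0 : 0 <= B) (Ble : B <= et ^+ 2).
Hypotheses (eB : et ^+ 2 <= 64 * B) (B10 : 0 <= B1) (B1le : B1 <= 2 * et * B).
Let y := 1 + al * et.
Let e1 := (et ^+ 2 + B) / 2.
Let E := et * B.

Lemma sv_E0 : 0 <= E. Proof. exact: mulr_ge0. Qed.
Lemma sv_et3 : et ^+ 3 <= 64 * E.
Proof. have -> : 64 * E = et * (64 * B) by rewrite /E; ring. by rewrite exprS ler_wpM2l. Qed.
Lemma sv_e1 : 0 <= e1 <= et ^+ 2.
Proof. have := sqr_ge0 et; move: B0 Ble; rewrite /e1; move=> *; apply/andP; split; lra. Qed.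
Lemma sv_et2 : et ^+ 2 <= dl.
Proof. by apply: le_trans etd; rewrite expr2 ler_piMr// (le_trans etd). Qed.
Lemma sv_e1d : e1 <= dl.
Proof. by have /andP[_ h] := sv_e1; apply: le_trans h sv_et2. Qed.
Lemma sv_ee1 : 0 <= et * e1 + B1 / 2 <= 2 * dl.
Proof.
have /andP[a1 a2] := sv_e1.
have h1 : 0 <= et * e1 by exact: mulr_ge0.
have e11 : et <= 1 by exact: le_trans etd d1.
have h2 : et * e1 <= 1 * e1 by exact: ler_wpM2r.
have h3 : et * B <= 1 * B by exact: ler_wpM2r.
have h4 := sv_e1d; have h5 := sv_et2.
move: h1 h2 h3 h4 h5 B10 B1le Ble; rewrite -/E -mulrA -/E mul1r; move=> *.
apply/andP; split; lra.
Qed.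
Lemma sv_ee1E : et * e1 + B1 / 2 <= 34 * E.
Proof.
have : et * e1 = (et ^+ 3 + E) / 2 by rewrite /e1 /E; field.
move: sv_et3 B1le sv_E0; rewrite -mulrA -/E; move=> *; lra.
Qed.
Lemma sv_nx : 0 <= nal * et <= 2^-1.
Proof.
have h : nal * et <= nal * dl by exact: ler_wpM2l.
have h0 : 0 <= nal * et by exact: mulr_ge0.
by move: h h0 dn; move=> *; apply/andP; split; lra.
Qed.
Lemma sv_nxE : `|al * et| = nal * et. Proof. by rewrite normrM (ger0_norm et0). Qed.
Lemma sv_y : 1 - nal * et <= y.
Proof.
have h := ler_norm (- (al * et)); rewrite normrN sv_nxE in h.
by move: h; rewrite /y; move=> *; lra.
Qed.
Lemma sv_y12 : 2^-1 <= y.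
Proof. by move: sv_y sv_nx; move=> h /andP[*]; lra. Qed.
Lemma sv_yV : y^-1 <= 1 + 2 * (nal * et).
Proof.
have hy := sv_y; have hy2 := sv_y12; have /andP[n0 n1] := sv_nx.
have y0 : 0 < y by move: hy2; move=> *; lra.
rewrite -(ler_pM2l y0) mulfV ?gt_eqF//.
have h1 : (1 - nal * et) * (1 + 2 * (nal * et)) <= y * (1 + 2 * (nal * et)).
  by apply: ler_wpM2r => //; move: n0; move=> *; lra.
have h2 : 0 <= nal * et * (1 - 2 * (nal * et)) by apply: mulr_ge0 => //; move: n1; move=> *; lra.
by move: h1 h2; move=> *; lra.
Qed.

Lemma sv_al_e1 : al * e1 <= dl * nal.
Proof.
have /andP[a1 _] := sv_e1; apply: le_trans (ler_wpM2r a1 (ler_norm al)) _.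
by rewrite mulrC; apply: ler_wpM2r => //; exact: sv_e1d.
Qed.

Variables (p M : R).
Hypotheses (p1 : 1 < p) (M0 : 0 <= M).
Let p0 : 0 < p. Proof. exact: lt_trans p1. Qed.
Let pm : 0 < p - 1. Proof. by rewrite subr_gt0. Qed.
Let Ga := - et / p - M * et ^+ 2.

Lemma sv_Ga : Ga <= 0.
Proof.
have g1 : 0 <= et / p by rewrite divr_ge0// ltW.
have g2 : 0 <= M * et ^+ 2 by rewrite mulr_ge0// sqr_ge0.
by rewrite /Ga mulNr; move: g1 g2; move=> *; lra.
Qed.

Lemma sv_H (c2 : R) : 0 < c2 -> dl * nal <= c2 / 4 -> c2 / 4 <= c2 * y - 2 * (p - 1) * Ga - al * e1.
Proof.
move=> c20 dk2.
have h1 : c2 * 2^-1 <= c2 * y by rewrite ler_wpM2l ?sv_y12// ltW.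
have h2 := sv_al_e1.
have h4 : 0 <= - (2 * (p - 1) * Ga).
  by rewrite -mulrN mulr_ge0 ?oppr_ge0 ?sv_Ga// mulr_ge0// ltW.
by move: h1 h2 h4 dk2; move=> *; lra.
Qed.

Lemma sv_tH (c2 : R) : 0 < c2 ->
  dl * (c2 * nal + 2 * (p - 1) * (p^-1 + 2 * M) + 2 * nal) <= p * c2 / 2 ->
  c2 * al * e1 + 2 * (p - 1) * (p^-1 + 2 * M * et) * e1 - al * (et * e1 + B1 / 2) <= 2 * p * (c2 / 4).
Proof.
move=> c20 dk3; have /andP[a1 a2] := sv_e1; have ad := sv_e1d.
have t1 : c2 * (al * e1) <= c2 * (dl * nal) by rewrite ler_wpM2l ?sv_al_e1// ltW.
have t2 : 2 * (p - 1) * (p^-1 + 2 * M * et) * e1 <= 2 * (p - 1) * (p^-1 + 2 * M) * dl.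
  have q0 : 0 <= 2 * (p - 1) by rewrite mulr_ge0// ltW.
  have pi0 : 0 <= p^-1 by rewrite invr_ge0 ltW.
  have m0 : 0 <= 2 * M by rewrite mulr_ge0.
  have r0 : p^-1 + 2 * M * et <= p^-1 + 2 * M by rewrite lerD2l ler_piMr// (le_trans etd).
  apply: ler_pM => //; last exact: ler_wpM2l.
  by apply: mulr_ge0 => //; apply: addr_ge0 => //; exact: mulr_ge0.
have t3 : - (al * (et * e1 + B1 / 2)) <= nal * (2 * dl).
  have /andP[b1 b2] := sv_ee1.
  apply: (@le_trans _ _ (nal * (et * e1 + B1 / 2))); last exact: ler_wpM2l.
  by rewrite -mulNr; apply: ler_wpM2r => //; rewrite -normrN ler_norm.
by move: t1 t2 t3 dk3; move=> *; lra.
Qed.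

Lemma sv_al_E : - (34 * nal * E) <= - (al * (et * e1 + B1 / 2)).
Proof.
have /andP[b1 b2] := sv_ee1.
rewrite lerN2; apply: (@le_trans _ _ (nal * (et * e1 + B1 / 2))).
  by apply: ler_wpM2r => //; exact: ler_norm.
have -> : 34 * nal * E = nal * (34 * E) by ring.
by apply: ler_wpM2l => //; exact: sv_ee1E.
Qed.

Lemma sv_taylor (Q K yp : R) : 0 < Q -> 0 <= K ->
  yp <= 1 + p / (p - 1) * (al * et) + p / (p - 1) * (p / (p - 1) - 1) / 2 * (al * et) ^+ 2 + K * `|al * et| ^+ 3 ->
  (p - 1) * Q * yp <= Q * (p - 1) + Q * p * (al * et) + Q * p / (2 * (p - 1)) * (al * et) ^+ 2
    + 64 * Q * (p - 1) * K * nal ^+ 3 * E.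
Proof.
move=> Q0 K0; rewrite sv_nxE => h.
have pQ : 0 <= (p - 1) * Q by rewrite mulr_ge0// ltW.
apply: le_trans (ler_wpM2l pQ h) _.
have -> : (p - 1) * Q * (1 + p / (p - 1) * (al * et) + p / (p - 1) * (p / (p - 1) - 1) / 2 * (al * et) ^+ 2 + K * (nal * et) ^+ 3) =
    Q * (p - 1) + Q * p * (al * et) + Q * p / (2 * (p - 1)) * (al * et) ^+ 2
    + Q * (p - 1) * K * nal ^+ 3 * et ^+ 3.
  by field; rewrite gt_eqF.
rewrite lerD2l.
have -> : 64 * Q * (p - 1) * K * nal ^+ 3 * E = Q * (p - 1) * K * nal ^+ 3 * (64 * E) by ring.
apply: ler_wpM2l; last exact: sv_et3.
by rewrite mulr_ge0 ?exprn_ge0// mulr_ge0// mulrC.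
Qed.

Lemma sv_square : dl * (64 * p * (p - 1) * (M ^+ 2 + 4 * nal * M / p + 2 * nal * M ^+ 2)) <= 1 ->
  p * (p - 1) * Ga ^+ 2 / y <= (p - 1) / p * et ^+ 2 + 2 * (p - 1) * M * et ^+ 3
    + 128 * (p - 1) * nal / p * E + E.
Proof.
move=> dk1.
have pp0 : 0 <= p * (p - 1) by exact: mulr_ge0 (ltW p0) (ltW pm).
have gp : 0 <= p * (p - 1) * Ga ^+ 2 by exact: mulr_ge0 pp0 (sqr_ge0 _).
apply: le_trans (ler_wpM2l gp sv_yV) _.
have n0 : 0 <= nal by [].
have -> : p * (p - 1) * Ga ^+ 2 * (1 + 2 * (nal * et)) =
    (p - 1) / p * et ^+ 2 + 2 * (p - 1) * M * et ^+ 3 + 2 * (p - 1) * nal / p * et ^+ 3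
    + (p * (p - 1) * (M ^+ 2 + 4 * nal * M / p + 2 * nal * M ^+ 2 * et)) * (et * et ^+ 3).
  by rewrite /Ga; field; rewrite gt_eqF.
have pi0 : 0 <= p^-1 by rewrite invr_ge0 ltW.
have u1 : 2 * (p - 1) * nal / p * et ^+ 3 <= 128 * (p - 1) * nal / p * E.
  have -> : 128 * (p - 1) * nal / p * E = 2 * (p - 1) * nal / p * (64 * E) by ring.
  apply: ler_wpM2l; last exact: sv_et3.
  by rewrite mulr_ge0// mulr_ge0// mulr_ge0// ltW.
have w0 : 0 <= 2 * nal * M ^+ 2 by rewrite mulr_ge0 ?sqr_ge0// mulr_ge0.
have w1 : 0 <= M ^+ 2 + 4 * nal * M / p.
  by rewrite addr_ge0 ?sqr_ge0// mulr_ge0// mulr_ge0// mulr_ge0.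
have u2 : (p * (p - 1) * (M ^+ 2 + 4 * nal * M / p + 2 * nal * M ^+ 2 * et)) * (et * et ^+ 3) <= E.
  apply: (@le_trans _ _ ((p * (p - 1) * (M ^+ 2 + 4 * nal * M / p + 2 * nal * M ^+ 2)) * (dl * (64 * E)))).
    apply: ler_pM.
    - by apply: mulr_ge0 => //; apply: addr_ge0 => //; exact: mulr_ge0.
    - by apply: mulr_ge0 => //; exact: exprn_ge0.
    - apply: ler_wpM2l => //; rewrite lerD2l ler_piMr//; exact: le_trans etd d1.
    - by apply: ler_pM => //; [exact: exprn_ge0|exact: sv_et3].
  have -> : p * (p - 1) * (M ^+ 2 + 4 * nal * M / p + 2 * nal * M ^+ 2) * (dl * (64 * E)) =
     (dl * (64 * p * (p - 1) * (M ^+ 2 + 4 * nal * M / p + 2 * nal * M ^+ 2))) * E by ring.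
  by apply: ler_piMl => //; exact: sv_E0.
by move: u1 u2; move=> *; lra.
Qed.

End small_values.

Section scalar_inequality.
Context {R : realType}.
Variables (p k : R).
Hypothesis p1 : 1 < p.
Hypothesis kp : 2 * p < k.
Local Notation p' := (p / (p - 1)).
Let Q := (p - 1) * k * (k - 2 * p) / p ^+ 2.
Let q := Q `^ (p - 1).
Let c1 := (p * k - 2 * k + 2 * p) / p.
Let c2 := 2 * (p - 1) * (k - p) / p.
Let al := c1 * (p - 1) / (Q * p).
Let b := c1 ^+ 2 * (p - 1) / (2 * Q * p) + (p - 1) / p.

Let p0 : 0 < p. Proof. exact: lt_trans p1. Qed.
Let pm : 0 < p - 1. Proof. by rewrite subr_gt0. Qed.
Let Q0 : 0 < Q.
Proof. by rewrite divr_gt0 ?exprn_gt0// !mulr_gt0//; move: kp p0; lra. Qed.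
Let q0 : 0 < q. Proof. exact: powR_gt0. Qed.
Let c20 : 0 < c2.
Proof. by rewrite divr_gt0// !mulr_gt0//; move: kp p0; lra. Qed.

(** The inequality sorted by degree, et having degree 1, B and e1 degree 2.
    Degree 0 gives Q, and the terms of degree 1 cancel because the exponent p'
    is conjugate to p. The choices of al and of the coefficient - 1 / p in Ga
    make the coefficients of et^2 cancel, and then those of B add up to b. In
    degree 3 the term 2 (p - 1) M et B coming from the parameter M exceeds all
    errors once M is large; the terms of higher degree carry a factor dl,
    which is chosen last. *)
Lemma scalar_core : exists M dl : R, [/\ 0 <= M, 0 < dl &
  forall et B B1 : R, 0 <= et -> et <= dl -> 0 <= B -> B <= et ^+ 2 ->
    et ^+ 2 <= 64 * B -> 0 <= B1 -> B1 <= 2 * et * B ->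
  let y := 1 + al * et in
  let e1 := (et ^+ 2 + B) / 2 in
  let Ga := - et / p - M * et ^+ 2 in
  let H := c2 * y - 2 * (p - 1) * Ga - al * e1 in
  let tH := c2 * al * e1 + 2 * (p - 1) * (p^-1 + 2 * M * et) * e1 - al * (et * e1 + B1 / 2) in
  [/\ 0 < y, 0 <= H, tH <= 2 * p * H &
    Q + b * B <= p * Q * y - (p - 1) * Q * y `^ p' - (k - 2 * p) * al * e1 + tH
      - p * (p - 1) * Ga ^+ 2 / y]].
Proof.
have [K [K0 hK]] := powR_taylor p'.
pose nal := `|al|.
have nal0 : 0 <= nal by exact: normr_ge0.
have pi0 : 0 <= p^-1 by rewrite invr_ge0 ltW.
have ppm : 0 <= p - 1 by exact: ltW.
have pp0 : 0 <= p by exact: ltW.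
have QQ0 : 0 <= Q by exact: ltW.
(* the total coefficient of E = et * B in the error terms: in order, from al
   times the image of e1, from Taylor's formula, from the square with 1 / y,
   and from its higher-order part *)
pose Cerr := 34 * nal + 64 * Q * (p - 1) * K * nal ^+ 3 + 128 * (p - 1) * nal / p + 1.
have Ce0 : 0 <= Cerr by do ?[assumption | exact: ler0n | apply: addr_ge0 | apply: mulr_ge0 | apply: exprn_ge0].
pose M := Cerr / (2 * (p - 1)).
have M0 : 0 <= M by rewrite divr_ge0// mulr_ge0.
have ME : 2 * (p - 1) * M = Cerr by rewrite /M; field; rewrite gt_eqF.
pose k1 := 64 * p * (p - 1) * (M ^+ 2 + 4 * nal * M / p + 2 * nal * M ^+ 2).
pose k2 := 4 * nal / c2.
pose k3 := 2 * (c2 * nal + 2 * (p - 1) * (p^-1 + 2 * M) + 2 * nal) / (p * c2).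
have k10 : 0 <= k1.
  by rewrite /k1; do ?[assumption | exact: ler0n | apply: addr_ge0 | apply: mulr_ge0 | apply: exprn_ge0].
have k20 : 0 <= k2 by exact: (divr_ge0 (mulr_ge0 (ler0n _ 4) nal0) (ltW c20)).
have pc : 0 < p * c2 by exact: mulr_gt0.
have k30 : 0 <= k3.
  apply: divr_ge0 (ltW pc); apply: mulr_ge0 => //.
  have cc := ltW c20.
  by do ?[assumption | exact: ler0n | apply: addr_ge0 | apply: mulr_ge0].
(* dl = 1 / S meets all smallness conditions, one for each summand *)
pose S := 1 + 2 * nal + k1 + k2 + k3.
have [S0 S1 S2 S3 S4] : [/\ 1 <= S, 2 * nal <= S, k1 <= S, k2 <= S & k3 <= S].
  by move: nal0 k10 k20 k30; rewrite /S; move=> *; split; lra.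
pose dl := S^-1.
have Sp : 0 < S by exact: lt_le_trans S0.
have d0 : 0 < dl by rewrite invr_gt0.
have dk (c : R) : c <= S -> dl * c <= 1.
  by move=> h; rewrite -(mulVf (lt0r_neq0 Sp)) ler_wpM2l// ltW.
have d1 : dl <= 1 by have := dk 1 S0; rewrite mulr1.
have dn := dk _ S1; have dk1 := dk _ S2.
have dk2 : dl * nal <= c2 / 4.
  have := dk _ S3; rewrite /k2 mulrA ler_pdivrMr// mul1r; move=> *; lra.
have dk3 : dl * (c2 * nal + 2 * (p - 1) * (p^-1 + 2 * M) + 2 * nal) <= p * c2 / 2.
  have := dk _ S4; rewrite /k3 mulrA ler_pdivrMr// mul1r; move=> *; lra.
exists M, dl; split => // et B B1 et0 etd B0 Ble eB B10 B1le y e1 Ga H tH.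
have y12 : 2^-1 <= y by exact: (sv_y12 dn et0 etd).
have y0 : 0 < y by move: y12; move=> *; lra.
have Hlow : c2 / 4 <= H by apply: (sv_H (dl := dl) (B := B)).
split => //.
- by apply: le_trans Hlow; rewrite divr_ge0// ltW.
- apply: (@le_trans _ _ (2 * p * (c2 / 4))); last by rewrite ler_wpM2l// mulr_ge0.
  by apply: (sv_tH (dl := dl)).
have T := sv_taylor et0 eB p1 Q0 K0 (hK (al * et) ltac:(rewrite sv_nxE//; by have /andP[] := sv_nx dn et0 etd)).
have GG := sv_square d1 dn et0 etd B0 eB p1 M0 dk1.
have AL : - (34 * nal * (et * B)) <= - (al * (et * e1 + B1 / 2)).
  exact: (sv_al_E al d1 et0 etd B0 Ble eB B10 B1le).
have C12 : c1 = c2 - (k - 2 * p) by rewrite /c1 /c2; field; rewrite gt_eqF.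
have alE : c1 * al / 2 = Q * p / (2 * (p - 1)) * al ^+ 2.
  by rewrite /al; field; rewrite !gt_eqF.
have bE : b = c1 * al / 2 + (p - 1) / p by rewrite /b /al; field; rewrite !gt_eqF.
have S1' : - (k - 2 * p) * al * e1 + c2 * al * e1 = c1 * al / 2 * (et ^+ 2 + B).
  by rewrite C12 /e1; field.
have S2' : 2 * (p - 1) * (p^-1 + 2 * M * et) * e1 = (p - 1) / p * (et ^+ 2 + B) + 2 * (p - 1) * M * (et ^+ 3 + et * B).
  by rewrite /e1; field; rewrite gt_eqF.
have S3' : Q * p / (2 * (p - 1)) * (al * et) ^+ 2 = c1 * al / 2 * et ^+ 2.
  by rewrite alE exprMn mulrA.
have S4' : 2 * (p - 1) * M * (et * B) = 34 * nal * (et * B) + 64 * Q * (p - 1) * K * nal ^+ 3 * (et * B) + 128 * (p - 1) * nal / p * (et * B) + et * B.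
  by rewrite ME /Cerr; ring.
have Ey : p * Q * y = p * Q + Q * p * (al * et) by rewrite /y; ring.
rewrite /tH bE Ey.
move: T GG AL S1' S2' S3' S4'; rewrite -/nal -/y -/Ga -/e1.
set T1 := (p - 1) * Q * _; set T2 := p * (p - 1) * Ga ^+ 2 / y.
set T3 := al * (et * e1 + B1 / 2).
move=> *; lra.
Qed.

End scalar_inequality.

(** * Construction of the weights *)

Section admissible_functions.
Context {R : realType}.
Variables (p k : R).
Hypothesis p1 : 1 < p.
Hypothesis kp : 2 * p < k.
Local Notation p' := (p / (p - 1)).
Let Q := (p - 1) * k * (k - 2 * p) / p ^+ 2.
Let q := Q `^ (p - 1).
Let c1 := (p * k - 2 * k + 2 * p) / p.
Let c2 := 2 * (p - 1) * (k - p) / p.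
Let al := c1 * (p - 1) / (Q * p).
Let b := c1 ^+ 2 * (p - 1) / (2 * Q * p) + (p - 1) / p.

Let p0 : 0 < p. Proof. exact: lt_trans p1. Qed.
Let pm : 0 < p - 1. Proof. by rewrite subr_gt0. Qed.
Let Q0 : 0 < Q.
Proof. by rewrite divr_gt0 ?exprn_gt0// !mulr_gt0//; move: kp p0; lra. Qed.
Let q0 : 0 < q. Proof. exact: powR_gt0. Qed.
Let b0 : 0 <= b.
Proof.
apply: addr_ge0; last exact: divr_ge0 (ltW pm) (ltW p0).
apply: divr_ge0; first by rewrite mulr_ge0 ?sqr_ge0// ltW.
by rewrite mulr_ge0 ?(ltW p0)// mulr_ge0// ltW.
Qed.

Lemma theta_powR (r s : R) : 0 < s -> theta (fun s => (2 * s) `^ r) s (2 * r * (2 * s) `^ r).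
Proof.
move=> s0; have s2 : 0 < 2 * s by rewrite mulr_gt0.
have hid : is_derive s (1 : R) (fun s => s) (1 : R) by exact: is_derive_id.
apply: (isd_eq (is_derive_comp_line (isdZ 2 hid) (is_derive1_powR r s2))).
rewrite mulr1 powRD_gt0// powR_inv1 ?(ltW s2)//.
have s20 : 2 * s != 0 by rewrite gt_eqF.
by field; rewrite gt_eqF.
Qed.

Lemma theta_continuous (F : R -> R) s l : theta F s l -> {for s, continuous F}.
Proof. exact: is_derive_continuous. Qed.

(** F is the perturbed constant, F = q y. G is a multiple of F plus a
    correction q Ga, a polynomial in Xsum whose parameter M provides the cubic
    slack. H is then forced by the relation f' = - h - 2 (p - 1) g, and what
    is left of the bound on W is scalar_core times q (2s)^(-p). The number t0
    is independent of D and m. *)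
Lemma admissible_exists : exists t0 : R, 0 < t0 /\ forall (D : R) (m : nat), 0 < D ->
  exists f g h h1, @admissible R p k ((D * t0) ^+ 2 / 2) f g h h1
    (fun s => (2 * s) `^ (- p) * (q * Q + q * b * Xsum2 m (tau D s))).
Proof.
have [M [dl [M0 d0 core]]] := scalar_core p1 kp.
(* for t < t0 one has ln t <= -1 and Xsum m t <= dl, whatever m is *)
pose t0 := expR (- (1 + 4 / dl)); exists t0; split; first exact: expR_gt0.
move=> D m D0.
pose T := tau D; pose et s := Xsum m (T s); pose B s := Xsum2 m (T s); pose B1 s := Xsum2d m (T s).
pose y s := 1 + al * et s.
pose e1 s := (et s ^+ 2 + B s) / 2.
pose Ga s := - et s / p - M * et s ^+ 2.
pose H s := c2 * y s - 2 * (p - 1) * Ga s - al * e1 s.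
pose tH s := c2 * al * e1 s + 2 * (p - 1) * (p^-1 + 2 * M * et s) * e1 s - al * (et s * e1 s + B1 s / 2).
pose F s := q * y s.
pose G s := q * (Ga s - (k - 2 * p) / p * y s).
pose Y s := (2 * s) `^ (- p) : R.
pose f s := (2 * s) `^ (1 - p) * F s.
pose g s := Y s * G s.
pose h s := Y s * (q * H s).
pose h1 s := Y s * (q * (tH s - 2 * p * H s)) / (2 * s).
exists f, g, h, h1.
have c4 : 0 < 4 / dl by rewrite divr_gt0.
have dom s : 0 < s < (D * t0) ^+ 2 / 2 -> [/\ 0 < s, T s < 1, ln (T s) <= -1 & 4 <= dl * - ln (T s)].
  move=> /andP[s0 s1].
  have T0 : 0 < T s by rewrite /T /tau divr_gt0// sqrtr_gt0 mulr_gt0.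
  have Dt0 : 0 < D * t0 by rewrite mulr_gt0// expR_gt0.
  have Tt : T s < t0.
    rewrite /T /tau ltr_pdivrMr// (mulrC t0).
    rewrite -(ltr_pXn2r (n := 2))// ?nnegrE ?sqrtr_ge0 ?(ltW Dt0)// sqr_sqrtr; last lra.
    by lra.
  have lt : ln (T s) < - (1 + 4 / dl).
    by rewrite -(expRK (- (1 + 4 / dl))) ltr_ln ?posrE// expR_gt0.
  split => //.
  - by rewrite -ltr_ln ?posrE// ln1; lra.
  - lra.
  - have h4 : dl * (4 / dl) <= dl * - ln (T s) by rewrite ler_wpM2l ?(ltW d0)//; lra.
    by apply: le_trans h4; rewrite mulrC divfK// gt_eqF.
have vals s : 0 < s < (D * t0) ^+ 2 / 2 ->
  [/\ 0 < y s, 0 <= H s, tH s <= 2 * p * H s &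
    Q + b * B s <= p * Q * y s - (p - 1) * Q * y s `^ p' - (k - 2 * p) * al * e1 s + tH s
      - p * (p - 1) * Ga s ^+ 2 / y s].
  move=> hs; have [s0 T1 lT dT] := dom s hs; have hT := tau_in01 D0 s0 T1.
  have /andP[T0 _] := hT.
  apply: core.
  - exact: Xsum_ge0.
  - exact: Xsum_small.
  - exact: Xsum2_ge0.
  - exact: Xsum2_le_sqr.
  - exact: Xsum_sqr_le.
  - exact: Xsum2d_ge0.
  - exact: Xsum2d_le.
have tet s : 0 < s < (D * t0) ^+ 2 / 2 -> theta et s (e1 s).
  by move=> hs; have [s0 T1 _ _] := dom s hs; exact: theta_Xsum.
have tB s : 0 < s < (D * t0) ^+ 2 / 2 -> theta B s (B1 s).
  by move=> hs; have [s0 T1 _ _] := dom s hs; exact: theta_Xsum2.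
have ty s : 0 < s < (D * t0) ^+ 2 / 2 -> theta y s (al * e1 s).
  move=> hs; apply: (theta_eq (thetaD (theta_cst 1 s) (thetaZ al (tet s hs)))).
  by rewrite add0r.
have te1 s : 0 < s < (D * t0) ^+ 2 / 2 -> theta e1 s (et s * e1 s + B1 s / 2).
  move=> hs; apply: (theta_eq (thetaM (thetaD (thetaX2 (tet s hs)) (tB s hs)) (theta_cst 2^-1 s))).
  by field.
have tGa s : 0 < s < (D * t0) ^+ 2 / 2 -> theta Ga s (- (p^-1 + 2 * M * et s) * e1 s).
  move=> hs; have hN := thetaZ (- p^-1) (tet s hs).
  have := thetaB hN (thetaZ M (thetaX2 (tet s hs))).
  have -> : (fun s => - p^-1 * et s - M * et s ^+ 2) = Ga.
    by apply/funext => x; rewrite /Ga; ring.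
  by move=> hh; apply: (theta_eq hh); ring.
have tHH s : 0 < s < (D * t0) ^+ 2 / 2 -> theta H s (tH s).
  move=> hs.
  apply: (theta_eq (thetaB (thetaB (thetaZ c2 (ty s hs)) (thetaZ (2 * (p - 1)) (tGa s hs))) (thetaZ al (te1 s hs)))).
  by rewrite /tH; ring.
have tF s : 0 < s < (D * t0) ^+ 2 / 2 -> theta F s (q * (al * e1 s)).
  by move=> hs; exact: thetaZ (ty s hs).
have pos s : 0 < s < (D * t0) ^+ 2 / 2 -> 0 < 2 * s by move=> /andP[? _]; rewrite mulr_gt0.
have Y1 s : 0 < s < (D * t0) ^+ 2 / 2 -> (2 * s) `^ (1 - p) = 2 * s * Y s.
  by move=> /pos s2; rewrite powRD_gt0// powRr1// ltW.
have Y0 s : 0 < s < (D * t0) ^+ 2 / 2 -> 0 < Y s by move=> /pos s2; exact: powR_gt0.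
have cY s : 0 < s < (D * t0) ^+ 2 / 2 -> {for s, continuous Y}.
  by move=> /andP[s0 _]; exact: theta_continuous (theta_powR (- p) s0).
split.
- move=> s hs; rewrite /f /F Y1//; have [y0 _ _ _] := vals s hs.
  by rewrite !mulr_gt0// ?Y0//; case/andP: hs.
- move=> s hs; have /andP[s0 _] := hs.
  apply: (isd_eq (thetaM (theta_powR (1 - p) s0) (tF s hs))).
  have Y1' := Y1 s hs; rewrite Y1' /h /g /G /F /H /c2.
  have s20 : s != 0 by rewrite gt_eqF.
  by field; rewrite s20 gt_eqF.
- move=> s hs; have /andP[s0 _] := hs.
  apply: (isd_eq (thetaM (theta_powR (- p) s0) (thetaZ q (tHH s hs)))).
  by rewrite /h1 /Y; field; rewrite gt_eqF.
- move=> s hs.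
  exact: theta_continuous (thetaM (theta_powR (- p) (proj1 (andP hs))) (thetaZ q (thetaB (tGa s hs) (thetaZ ((k - 2 * p) / p) (ty s hs))))).
- move=> s hs; have [s0 T1 _ _] := dom s hs; have [l tB1] := theta_Xsum2d D0 s0 T1 m.
  have a1 := thetaB (thetaD (thetaZ (c2 * al) (te1 s hs))
    (thetaM (thetaZ (2 * (p - 1)) (thetaD (theta_cst p^-1 s) (thetaZ (2 * M) (tet s hs)))) (te1 s hs)))
    (thetaZ al (thetaD (thetaM (tet s hs) (te1 s hs)) (thetaM tB1 (theta_cst 2^-1 s)))).
  have a2 := thetaM (theta_powR (- p) s0) (thetaZ q (thetaB a1 (thetaZ (2 * p) (tHH s hs)))).
  have hid : is_derive s (1 : R) (fun s => s) (1 : R) by exact: is_derive_id.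
  have s20 : 2 * s != 0 by rewrite gt_eqF// mulr_gt0.
  have a3 := @is_deriveV R (fun s => 2 * s) _ _ _ s20 (isdZ 2 hid).
  exact: is_derive_continuous (isdM a2 a3).
- move=> s hs; have [s0 T1 _ _] := dom s hs.
  exact: theta_continuous (thetaM (theta_powR (- p) s0) (thetaD (theta_cst (q * Q) s) (thetaZ (q * b) (tB s hs)))).
- move=> s hs; have [_ H0 _ _] := vals s hs.
  by rewrite /h mulr_ge0 ?(ltW (Y0 s hs))// mulr_ge0// ltW.
- move=> s hs; have [_ _ tH0 _] := vals s hs.
  rewrite /h1 pmulr_lle0 ?invr_gt0 ?pos//.
  by rewrite pmulr_rle0 ?Y0// pmulr_rle0// subr_le0.
- move=> s hs; rewrite mulr_ge0 ?(ltW (Y0 s hs))// addr_ge0//.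
    by rewrite mulr_ge0// ltW.
  by rewrite mulr_ge0 ?Xsum2_ge0// mulr_ge0// ltW.
- move=> s hs; have [y0 _ _ main] := vals s hs; have s2 := pos s hs; have YY := Y0 s hs.
  have fp : f s `^ p' = Y s * (q * Q * y s `^ p').
    rewrite /f /F powRM ?powR_ge0//; last by rewrite mulr_ge0// ltW.
    rewrite -powRrM; congr (_ * _).
      by congr powR; field; rewrite gt_eqF.
    rewrite powRM ?(ltW q0) ?(ltW y0)//; congr (_ * _).
    have -> : q * Q = Q `^ (p - 1 + 1) by rewrite powRD_gt0// powRr1// ltW.
    by rewrite /q -powRrM; congr powR; field; rewrite gt_eqF.
  have gf : 2 * p * (p - 1) * s * g s ^+ 2 / f s = Y s * (q * (p * (p - 1) * ((k - 2 * p) ^+ 2 / p ^+ 2 * y s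
       - 2 * (k - 2 * p) / p * Ga s + Ga s ^+ 2 / y s))).
    rewrite /f Y1// /g /G /F; have s20 : s != 0 by move: s2; rewrite pmulr_rgt0// => /lt0r_neq0.
    by field; rewrite s20 !gt_eqF.
  rewrite fp gf.
  have -> : 2 * s * h1 s = Y s * (q * (tH s - 2 * p * H s)).
    rewrite /h1; have s20 : s != 0 by move: s2; rewrite pmulr_rgt0// => /lt0r_neq0.
    by field.
  have -> : Y s * (q * (tH s - 2 * p * H s)) + k * h s - (p - 1) * (Y s * (q * Q * y s `^ p')) -
    Y s * (q * (p * (p - 1) * ((k - 2 * p) ^+ 2 / p ^+ 2 * y s - 2 * (k - 2 * p) / p * Ga s + Ga s ^+ 2 / y s))) =
    Y s * (q * (p * Q * y s - (p - 1) * Q * y s `^ p' - (k - 2 * p) * al * e1 s + tH s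
      - p * (p - 1) * Ga s ^+ 2 / y s)).
    by rewrite /h /H /c2 /Q; field; rewrite !gt_eqF.
  rewrite -mulrA -mulrDr; apply: ler_wpM2l; first exact: ltW.
  by apply: ler_wpM2l => //; exact: ltW.
Qed.

End admissible_functions.

(** * Finitely many logarithmic terms *)

Lemma measurable_Xlog {R : realType} {d} {T : measurableType d} (D : set T) (f : T -> R) i :
  measurable_fun D f -> measurable_fun D (fun x => Xlog i (f x)).
Proof.
move=> mf; elim: i => [|i IH] //.
rewrite (_ : (fun x => _) = fun x => (1 - ln (Xlog i (f x)))^-1)//.
apply: measurable_fun_invr; apply: measurable_funB; first exact: measurable_cst.
exact: (measurableT_comp (@measurable_ln R) IH).
Qed.

Section finite_sums.
Context {R : realType} {n : nat}.
Variables (p k : R) (U K : set 'rV[R]_n).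
Hypothesis p1 : 1 < p.
Hypotheses (oU : open U) (K0 : K !=set0) (cK : closed K) (UK : forall x, U x -> ~ K x).
Hypothesis hdistr : mul_laplacian_ge U (eudist K) (k - 1).
Local Notation d := (eudist K).
Let Q := (p - 1) * k * (k - 2 * p) / p ^+ 2.
Let q := Q `^ (p - 1).
Let b := ((p * k - 2 * k + 2 * p) / p) ^+ 2 * (p - 1) / (2 * Q * p) + (p - 1) / p.
Let p0 : 0 < p. Proof. exact: lt_trans p1. Qed.

Variables (dmax t0 D : R).
Hypothesis hmax : forall x, U x -> d x <= dmax.
Hypothesis adm : forall (D : R) (m : nat), 0 < D ->
  exists f g h h1, @admissible R p k ((D * t0) ^+ 2 / 2) f g h h1
    (fun s => (2 * s) `^ (- p) * (q * Q + q * b * Xsum2 m (tau D s))).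
Hypothesis D0 : 0 < D.
Hypothesis Dt : dmax + 1 <= D * t0.
Hypothesis Dd : dmax < D.
Variable u : 'rV[R]_n -> R.
Hypothesis tu : test_function U u.
Local Notation Z := (closure [set x | u x != 0]).

Definition weight i x : R := `|u x| `^ p / d x `^ (2 * p) * Xprod i (d x / D) ^+ 2.

Let ZU x : Z x -> U x. Proof. by have [_ _] := tu; apply. Qed.
Let uZ x : ~ Z x -> u x = 0.
Proof. by move=> /near_zero_out; exact: nbhs_singleton. Qed.
Let uZ' x : u x != 0 -> Z x. Proof. by move=> ux; exact: subset_closure. Qed.

(** The support of u is compact in U, so it keeps a positive distance from the
    complement of U and hence from K. This bounds the weights and the radii of
    mollification. *)
Let gap : exists dl : R, [/\ 0 < dl, forall x, Z x -> dl <= d x &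
  forall x z, Z x -> enorm z < dl -> U (x + z)].
Proof.
have nU0 : ~` U !=set0.
  by have [y Ky] := K0; exists y => /UK.
have cU : closed (~` U) by exact: open_closedC.
have [Z0|Z0] := pselect (Z !=set0); last first.
  by exists 1; split => // x; [|move=> z] => Zx; exfalso; apply: Z0; exists x.
have cZ : compact Z by have [] := tu.
have ce : {within Z, continuous (eudist (~` U))}.
  by apply: continuous_subspaceT; exact: eudist_continuous.
have [c Zc hc] := EVT_min_rV Z0 cZ ce.
rewrite inE in Zc.
exists (eudist (~` U) c); split.
- by apply: eudist_gt0 => //; apply; exact: ZU.
- move=> x Zx; apply: (@le_trans _ _ (eudist (~` U) x)); first by apply: hc; rewrite inE.
  have [y Ky ->] := nearest_point K0 cK x.
  by apply: eudist_le => /UK.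
- move=> x z Zx hz; apply: contrapT => nU.
  have h1 : eudist (~` U) c <= eudist (~` U) x by apply: hc; rewrite inE.
  have h2 : eudist (~` U) x <= enorm (x - (x + z)) by apply: eudist_le.
  have E : x - (x + z) = - z by rewrite opprD addrA subrr add0r.
  by move: h2; rewrite E enormN => h2; have := le_lt_trans (le_trans h1 h2) hz; rewrite ltxx.
Qed.

Lemma tame_weight i : tame (weight i).
Proof.
have [dl [dl0 hdl _]] := gap.
have md : measurable_fun setT d.
  by apply: continuous_measurable_row; exact: eudist_continuous.
have tup := tame_test_powR p0 tu.
have [_ [C [M hC]]] := tup.
split.
  apply: measurable_funM.
    apply: measurable_funM; first exact: tup.1.
    apply: measurable_fun_invr.
    exact: (measurableT_comp (measurable_powR _) md).
  apply: measurable_funX.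
  rewrite (_ : (fun x => _) = fun x => \prod_(1 <= j < i.+1) Xlog j (d x / D)).
    apply: measurable_prod => j _; apply: measurable_Xlog.
    by apply: measurable_funM => //; exact: measurable_cst.
  by apply/funext.
exists (C / dl `^ (2 * p)), M => x; split; last first.
  by move=> /(hC x).2 E; rewrite /weight E mul0r mul0r.
have C00 : 0 <= C by apply: le_trans (normr_ge0 _) (hC 0).1.
have dlp : 0 < dl `^ (2 * p) by exact: powR_gt0.
have [Zx|Zx] := pselect (Z x); last first.
  rewrite /weight (uZ Zx) (normr0 R) powR0 ?gt_eqF// mul0r mul0r normr0.
  by rewrite divr_ge0// ltW.
have dx0 : 0 < d x by exact: lt_le_trans dl0 (hdl x Zx).
have t01 : 0 < d x / D < 1.
  by rewrite divr_gt0//= ltr_pdivrMr// mul1r (le_lt_trans (hmax (ZU Zx))).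
rewrite /weight ger0_norm; last by rewrite mulr_ge0 ?sqr_ge0// divr_ge0 ?powR_ge0.
rewrite -[leRHS]mulr1; apply: ler_pM.
- by rewrite divr_ge0 ?powR_ge0.
- exact: sqr_ge0.
- apply: ler_pM; rewrite ?powR_ge0 ?invr_ge0 ?powR_ge0//.
    exact: le_trans (ler_norm _) (hC x).1.
  rewrite lef_pV2 ?posrE ?powR_gt0//; apply: ge0_ler_powR; rewrite ?nnegrE ?mulr_ge0 ?(ltW p0) ?(ltW dl0) ?(ltW dx0)//.
  exact: hdl.
- have h : 0 <= Xprod i (d x / D) <= 1.
    elim: i => [|i IH]; first by rewrite Xprod0 ler01 lexx.
    rewrite XprodS; have /andP[a1 a2] := Xlog_in01 i.+1 t01; have /andP[a3 a4] := IH.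
    by rewrite mulr_ge0 ?(ltW a1)//= mulr_ile1// ltW.
  by have /andP[h1 h2] := h; rewrite exprn_ile1.
Qed.

(** Apply the integrated inequality to the mollifications A j of A with radius
    r j, and let j tend to infinity. On the support of u their values stay in
    a compact interval [sa, sb] on which the weights are admissible, so that
    the convergence is dominated. *)
Lemma finite_sum_ineq m :
  q * Q * integ (weight 0) + q * b * \sum_(1 <= i < m.+1) integ (weight i) <=
  integ (fun x => `|laplacian u x| `^ p).
Proof.
(* the mollifiers are built from u, so u = 0 is a case of its own *)
have [u0|/existsNP[x0 /eqP ux0]] := pselect (forall x, u x = 0).
  have w0 i : integ (weight i) = 0.
    rewrite -[RHS](@integ_zero R n); congr integ; apply/funext => x.
    by rewrite /weight u0 (normr0 R) powR0 ?gt_eqF// !mul0r.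
  rewrite w0 mulr0 big1 => [|i _]; last exact: w0.
  by rewrite mulr0 addr0; apply: integ_ge0 => x; exact: powR_ge0.
have [dl [dl0 hdl hU]] := gap.
have [f [g [h [h1 ad]]]] := adm m D0.
set W := (fun s => _) in ad.
(* the radii are at most dl / 2, half of the gap, and at most 1 / 2, so that
   A j stays below (dmax + 1)^2 / 2 on the support of u *)
pose rs : R := Num.min (dl / 2) 2^-1.
have rs0 : 0 < rs by rewrite /rs lt_min; apply/andP; split; [exact: divr_gt0|rewrite invr_gt0].
have rs1 : rs <= dl / 2 by rewrite /rs ge_min lexx.
have rs2 : rs <= 2^-1 by rewrite /rs ge_min lexx orbT.
pose r k := rs * hstep k.
have r0 j : 0 < r j by rewrite mulr_gt0// hstep_gt0.
have rle j : r j <= rs by rewrite /r ler_piMr ?hstep_le1// ltW.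
have hex : forall j, exists e : 'rV[R]_n -> R, mollifier (r j) e.
  by move=> j; exact: (mollifier_exists tu ux0 (r0 j)).
have [eta heta] := choice hex.
pose A j := hsd_moll K (eta j).
have lo j x : Z x -> (d x - r j) ^+ 2 / 2 <= A j x.
  move=> Zx; apply: (hsd_moll_lower K0 cK (heta j)); have := hdl x Zx; have := rle j; lra.
have up j x : A j x <= (d x + r j) ^+ 2 / 2 by exact: (hsd_moll_upper K0 cK (heta j)).
pose sa := (dl / 2) ^+ 2 / 2; pose sb := (dmax + 2^-1) ^+ 2 / 2.
have sab j x : Z x -> sa <= A j x <= sb.
  move=> Zx; have h2 := hdl x Zx; have h3 := rle j; have h4 := hmax (ZU Zx); have h5 := ltW (r0 j).
  apply/andP; split.
    apply: le_trans (lo j x Zx); rewrite /sa ler_pM2r//.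
    by rewrite ler_pXn2r ?nnegrE//; lra.
  apply: le_trans (up j x) _; rewrite /sb ler_pM2r//.
  by rewrite ler_pXn2r ?nnegrE//; lra.
have sa0 : 0 < sa by rewrite /sa divr_gt0// exprn_gt0// divr_gt0.
have [y0 Zy0] : Z !=set0 by exists x0; exact: uZ'.
have dm0 : 0 <= dmax by apply: le_trans (eudist_ge0 K0 cK y0) (hmax (ZU Zy0)).
have sbD : sb < (D * t0) ^+ 2 / 2.
  have a1 : 0 <= dmax + 2^-1 by apply: addr_ge0.
  have a2 : dmax + 2^-1 < D * t0 by apply: lt_le_trans Dt; rewrite ltrD2l invf_lt1 ?ltr1n.
  by rewrite /sb ltr_pM2r// ltr_pXn2r ?nnegrE ?(ltW (le_lt_trans a1 a2)).
have rng s : sa <= s <= sb -> 0 < s < (D * t0) ^+ 2 / 2.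
  by move=> /andP[a1 a2]; rewrite (lt_le_trans sa0 a1) (le_lt_trans a2 sbD).
have step j : integ (fun x => W (A j x) * `|u x| `^ p) <= integ (fun x => `|laplacian u x| `^ p).
  apply: (integrated_ineq p1 ad tu).
  - exact: (hsd_moll_continuous K0 cK (heta j)).
  - by move=> i; exact: (hsd_moll_C1 K0 cK (heta j)).
  - by move=> i; exact: (hsd_moll_C2 K0 cK (heta j)).
  - move=> x Zx; split.
    + exact: rng (sab j x Zx).
    + exact: (hsd_moll_grad K0 cK (heta j)).
    + apply: (hsd_moll_laplacian K0 cK (heta j) oU UK hdistr) => z zr.
      by apply: hU => //; apply: le_lt_trans zr _; have := rle j; lra.
have sab0 : sa <= sb by have /andP[a1 a2] := sab 0 y0 Zy0; exact: le_trans a2.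
have [c _ hc] : exists2 c, c \in `[sa, sb] & forall t, t \in `[sa, sb] -> W t <= W c.
  apply: EVT_max => //; apply: continuous_in_subspaceT => s; rewrite inE /= in_itv /= => hs.
  exact: (adm_cW ad (rng s hs)).
have tup := tame_test_powR p0 tu.
have [_ [C [M hC]]] := tup.
have limit : integ (fun x => W (hsd K x) * `|u x| `^ p) <= integ (fun x => `|laplacian u x| `^ p).
  have [_ cvg] : tame (fun x => W (hsd K x) * `|u x| `^ p) /\
    integ (fun x => W (A j x) * `|u x| `^ p) @[j --> \oo] --> integ (fun x => W (hsd K x) * `|u x| `^ p).
    apply: (integ_cvg (C := `|W c| * C) (M := M)).
    - move=> j; have [] // := @tame_W_powR R n p k ((D * t0) ^+ 2 / 2) p1 f g h h1 W ad U u (A j) tu.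
        exact: (hsd_moll_continuous K0 cK (heta j)).
      move=> x Zx; split.
      + exact: rng (sab j x Zx).
      + exact: (hsd_moll_grad K0 cK (heta j)).
      + apply: (hsd_moll_laplacian K0 cK (heta j) oU UK hdistr) => z zr.
        by apply: hU => //; apply: le_lt_trans zr _; have := rle j; lra.
    - move=> j x; split; last by move=> /(hC x).2 ->; rewrite mulr0.
      have C00 : 0 <= C by apply: le_trans (normr_ge0 _) (hC 0).1.
      have [Zx|Zx] := pselect (Z x); last first.
        by rewrite (uZ Zx) (normr0 R) powR0 ?gt_eqF// mulr0 normr0 mulr_ge0.
      have hs := sab j x Zx.
      rewrite normrM ler_pM// ?(hC x).1//.
      rewrite ger0_norm; last exact: (adm_W_ge0 ad (rng _ hs)).
      by apply: le_trans (hc _ _) (ler_norm _); rewrite in_itv.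
    - move=> x; have [Zx|Zx] := pselect (Z x); last first.
        rewrite (uZ Zx) (normr0 R) powR0 ?gt_eqF// mulr0.
        by under eq_fun do rewrite mulr0; exact: cvg_cst.
      apply: cvgM; last exact: cvg_cst.
      have rc : r j @[j --> \oo] --> 0.
        rewrite -(mulr0 rs); apply: cvgM; [exact: cvg_cst|exact: harmonic_cvg0].
      have cA : A j x @[j --> \oo] --> hsd K x.
        apply: (@squeeze_cvgr _ _ _ _ (fun j => (d x - r j) ^+ 2 / 2) (fun j => (d x + r j) ^+ 2 / 2)).
        - by apply: nearW => j; rewrite lo//= up.
        - rewrite /hsd -[X in X ^+ 2 / _]subr0; apply: cvgM; last exact: cvg_cst.
          by rewrite expr2; apply: cvgM; apply: cvgB => //; exact: cvg_cst.
        - rewrite /hsd -[X in X ^+ 2 / _]addr0; apply: cvgM; last exact: cvg_cst.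
          by rewrite expr2; apply: cvgM; apply: cvgD => //; exact: cvg_cst.
      have dx : dl <= d x by exact: hdl.
      have h4 := hmax (ZU Zx).
      have hA : sa <= hsd K x <= sb.
        rewrite /hsd; apply/andP; split; rewrite ler_pM2r// ler_pXn2r ?nnegrE//; lra.
      exact: (@cvg_comp _ _ _ (fun j => A j x) W _ _ _ cA (adm_cW ad (rng _ hA))).
  rewrite -(cvg_lim _ cvg)//; apply: limr_le; first by apply/cvg_ex; eexists; exact: cvg.
  by apply: nearW => j; exact: step.
apply: le_trans limit.
have tw := tame_weight.
have -> : \sum_(1 <= i < m.+1) integ (weight i) = integ (fun x => \sum_(1 <= i < m.+1) weight i x).
  by rewrite integ_sum.
have ts : tame (fun x => \sum_(1 <= i < m.+1) weight i x) by exact: tame_sum.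
rewrite -(integZ _ (tw 0%N)) -(integZ _ ts) -(integD (tameZ _ (tw 0%N)) (tameZ _ ts)).
rewrite le_eqVlt; apply/orP; left; apply/eqP; congr integ; apply/funext => x.
have [Zx|Zx] := pselect (Z x); last first.
  rewrite /weight (uZ Zx) (normr0 R) powR0 ?gt_eqF// !(mul0r, mulr0) add0r.
  by rewrite big1 ?mulr0// => i _; rewrite !mul0r.
have dx0 : 0 < d x by exact: lt_le_trans dl0 (hdl x Zx).
have E1 : 2 * hsd K x = d x ^+ 2 by rewrite /hsd mulrC divfK.
rewrite /W /tau E1 sqrtr_sqr gtr0_norm//.
have -> : (d x ^+ 2) `^ (- p) = (d x `^ (2 * p))^-1.
  by rewrite -powR_mulrn ?(ltW dx0)// -powRrM mulrN powRN.
rewrite /weight Xprod0 expr1n mulr1 -mulr_sumr /Xsum2; ring.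
Qed.

End finite_sums.

(** * Constants and the full series *)

Section constants.
Context {R : realType}.
Variables (p k : R).
Hypotheses (p1 : 1 < p) (kp : 2 * p < k).
Let Q := (p - 1) * k * (k - 2 * p) / p ^+ 2.

Lemma rellich_const_gt0 : 0 < Q.
Proof.
have p0 : 0 < p by exact: lt_trans p1.
have k0 : 0 < k by apply: lt_trans kp; rewrite mulr_gt0.
by rewrite /Q divr_gt0 ?exprn_gt0// !mulr_gt0 ?subr_gt0.
Qed.

Lemma rellich_const_powR : Q `^ p = Q `^ (p - 1) * Q.
Proof.
by rewrite -{3}(powRr1 (ltW rellich_const_gt0)) -powRD_gt0 ?rellich_const_gt0// subrK.
Qed.

(** The left side is the constant of the theorem, the right side the one
    delivered by the weights; they agree because p k - 2 k + 2 p = k (p - 1) -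
    (k - 2 p), the square of which has the cross term - 2 p^2 Q. *)
Lemma remainder_constE :
  (p - 1) / (2 * p ^+ 3) * `|Q| `^ (p - 2) * (k ^+ 2 * (p - 1) ^+ 2 + (k - 2 * p) ^+ 2) =
  Q `^ (p - 1) * (((p * k - 2 * k + 2 * p) / p) ^+ 2 * (p - 1) / (2 * Q * p) + (p - 1) / p).
Proof.
have Q0 := rellich_const_gt0.
have E : Q `^ (p - 1) = Q `^ (p - 2) * Q.
  rewrite -{3}(powRr1 (ltW Q0)) -powRD_gt0 ?Q0//; congr powR; lra.
rewrite gtr0_norm// E.
have pn : p != 0 by rewrite gt_eqF// (lt_trans _ p1).
set S := Q `^ _.
have -> : S * Q * (((p * k - 2 * k + 2 * p) / p) ^+ 2 * (p - 1) / (2 * Q * p) + (p - 1) / p) =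
  S * (((p * k - 2 * k + 2 * p) / p) ^+ 2 * (p - 1) / (2 * p) + Q * ((p - 1) / p)).
  by field; rewrite pn gt_eqF.
by rewrite /Q; field.
Qed.

Lemma remainder_const_gt0 : 0 < (p - 1) / (2 * p ^+ 3) * `|Q| `^ (p - 2) *
  (k ^+ 2 * (p - 1) ^+ 2 + (k - 2 * p) ^+ 2).
Proof.
have p0 : 0 < p by exact: lt_trans p1.
rewrite !mulr_gt0 ?subr_gt0//.
- by rewrite invr_gt0 mulr_gt0// exprn_gt0.
- by rewrite powR_gt0// normr_gt0 gt_eqF// rellich_const_gt0.
- by apply: ltr_wpDl; [apply: mulr_ge0; exact: sqr_ge0|rewrite exprn_gt0// subr_gt0].
Qed.

End constants.

Lemma nneseries_le_finite {R : realType} (a J C : R) (w : nat -> R) : 0 < C ->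
  (forall i, 0 <= w i) -> (forall m, a + C * \sum_(1 <= i < m.+1) w i <= J) ->
  (a%:E + C%:E * \sum_(1 <= i <oo) (w i)%:E <= J%:E)%E.
Proof.
move=> C0 w0 h.
have hs : (\sum_(1 <= i <oo) (w i)%:E <= ((J - a) / C)%:E)%E.
  apply: lime_le; first by apply: is_cvg_nneseries => i _ _; rewrite lee_fin.
  apply: nearW => m; rewrite sumEFin lee_fin ler_pdivlMr// mulrC lerBrDl.
  case: m => [|m]; last exact: h.
  by have := h 0%N; rewrite !big_geq.
apply: (@le_trans _ _ (a%:E + C%:E * ((J - a) / C)%:E)%E).
  by rewrite leeD2l// lee_pmul2l// ltr0_fin.
by rewrite -EFinM -EFinD lee_fin mulrC divfK ?gt_eqF// addrC subrK.
Qed.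

Theorem theorem2 (R : realType) (p : R) (N k : nat) (Omega K : set 'rV[R]_N)
  (hp : 1 < p) (hN : (2 <= N)%N) (hk : (1 <= k <= N)%N)
  (hOmega : domain Omega)
  (hKclosed : closed K)
  (hKsurface : piecewise_smooth_surface (N - k) K)
  (hKcomponents : finite_set [set connected_component K x | x in K])
  (hKpoints : k = N -> finite_set K)
  (hKboundary : k = 1%N -> K = boundary Omega)
  (hbounded : has_ubound [set eudist K x | x in Omega])
  (hkp : 2 * p < k%:R)
  (hdistr : mul_laplacian_ge (Omega `\` K) (eudist K) (k%:R - 1)) :
  let d := eudist K in
  let Q := (p - 1) * k%:R * (k%:R - 2 * p) / p ^+ 2 in
  exists D0 : R,
    [/\ 0 < D0, sup [set d x | x in Omega] <= D0 &
      forall (D : R) (u : 'rV[R]_N -> R),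
        D0 <= D -> test_function (Omega `\` K) u ->
        ((Q `^ p)%:E *
           \int[lebesgue_rV N]_(x in Omega) (`|u x| `^ p / d x `^ (2 * p))%:E
         + ((p - 1) / (2 * p ^+ 3) * `|Q| `^ (p - 2) *
            (k%:R ^+ 2 * (p - 1) ^+ 2 + (k%:R - 2 * p) ^+ 2))%:E *
           \sum_(1 <= i <oo) \int[lebesgue_rV N]_(x in Omega)
             (`|u x| `^ p / d x `^ (2 * p) *
              \prod_(1 <= j < i.+1) Xlog j (d x / D) ^+ 2)%:E
         <= \int[lebesgue_rV N]_(x in Omega) (`|laplacian u x| `^ p)%:E)%E].
Proof.
move=> d Q; have [K0 _] := hKsurface.
pose U := Omega `\` K.
have oU : open U by have [_ oO _] := hOmega; apply: openI => //; exact: closed_openC.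
have UK x : U x -> ~ K x by case.
have UO : U `<=` Omega by move=> x [].
set dmax := sup [set d x | x in Omega].
have hmaxO x : Omega x -> d x <= dmax.
  by move=> Ox; apply: (ub_le_sup hbounded); exists x.
have hmax x : U x -> d x <= dmax by move=> /UO; exact: hmaxO.
have dmax0 : 0 <= dmax.
  have [[x Ox] _ _] := hOmega; apply: le_trans (hmaxO x Ox); exact: eudist_ge0.
have [t0 [t00 adm]] := admissible_exists hp hkp.
have s0 : 0 <= (dmax + 1) / t0 by rewrite divr_ge0 ?(ltW t00)// addr_ge0.
have d1 : dmax < (dmax + 1) / t0 + (dmax + 1) by rewrite ltr_wpDl// ltrDl.
(* the first summand puts (d + 1) / D below t0, with room for the
   mollification; the second puts d below D *)
exists ((dmax + 1) / t0 + (dmax + 1)); split; [exact: le_lt_trans d1|exact: ltW|].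
move=> D u hD tu.
have Dd : dmax < D by exact: lt_le_trans hD.
have D0 : 0 < D by exact: le_lt_trans Dd.
have Dt : dmax + 1 <= D * t0.
  by rewrite -ler_pdivrMr//; apply: le_trans hD; rewrite lerDl addr_ge0.
have p0 : 0 < p by exact: lt_trans hp.
have tw := tame_weight hp oU K0 hKclosed UK hmax D0 Dd tu.
have w0 i x : ~ closure [set x | u x != 0] x -> weight p K D u i x = 0.
  move=> /near_zero_out/nbhs_singleton h.
  by rewrite /weight h (normr0 R) powR0 ?gt_eqF// !mul0r.
have -> : (\int[lebesgue_rV N]_(x in Omega) (`|u x| `^ p / d x `^ (2 * p))%:E =
    (integ (weight p K D u 0))%:E)%E.
  rewrite -(integral_domain tu UO (tw 0%N) (w0 0%N)).
  by apply: eq_integral => x _; rewrite /weight Xprod0 expr1n mulr1.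
rewrite (integral_domain tu UO (tame_laplacian_powR p0 tu)); last first.
  by move=> x /near_zero_out h; rewrite laplacian_near0// (normr0 R) powR0 ?gt_eqF.
rewrite (eq_eseriesr (g := fun i => (integ (weight p K D u i))%:E)); last first.
  move=> i _; rewrite -(integral_domain tu UO (tw i) (w0 i)).
  by apply: eq_integral => x _; rewrite /weight /Xprod prodrXl.
rewrite -EFinM; apply: nneseries_le_finite.
- exact: remainder_const_gt0.
- move=> i; apply: integ_ge0 => x; rewrite /weight mulr_ge0 ?sqr_ge0//.
  by rewrite divr_ge0// powR_ge0.
- move=> m; rewrite remainder_constE// rellich_const_powR//.
  exact: (finite_sum_ineq hp oU K0 hKclosed UK hdistr hmax adm D0 Dt Dd tu m).
Qed.
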